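(* Fix a compact set $B\subset\mathscr R_{\mathrm{Kaw}}$. There exists $\varepsilon_0=\varepsilon_0(B)>0$, depending only on $B$, such that for every $0<\varepsilon\le\varepsilon_0$ there are constants $\alpha_{B,\varepsilon}>0$, $c_{B,\varepsilon}>0$, $C_{B,\varepsilon}<\infty$ and $n_0=n_0(B,\varepsilon)<\infty$ (depending only on $B$ and $\varepsilon$) such that, for all $(p,\beta)\in B$ and every $n\ge n_0$ with $k=Np\in\mathbb Z$, \[ \mu_\beta^k(\Gamma_{p,\varepsilon/4}^c)\le C_{B,\varepsilon}e^{-c_{B,\varepsilon}n}, \] and for every $x\in\Gamma_{p,\varepsilon/4}$ the following hold. (i) Let $(X_t)_{t\ge0}$ be the full Kawasaki chain with kernel $P$ started from $X_0=x$, and let $(\widetilde X_t)_{t\ge0}$ be the restricted Kawasaki chain with kernel $P_\varepsilon$ started from $\widetilde X_0=x$. For every integer $T\le e^{\alpha_{B,\varepsilon}n}$, the two chains can be coupled so that \[ \mathbb P\big((X_0,\dots,X_T)=(\widetilde X_0,\dots,\widetilde X_T)\big)\ge 1-C_{B,\varepsilon}e^{-c_{B,\varepsilon}n}. \] (ii) Whenever $e^{-c_{B,\varepsilon}n}\le\delta\le1$, with $T=\lceil C_{B,\varepsilon}n^2\log(n^2/\delta)\rceil$, the restricted chain satisfies \[ d_{\mathrm{TV}}\big(xP_\varepsilon^T,\ \mu_\beta^k(\cdot\mid\Gamma_{p,\varepsilon})\big)\le\delta, \] and, for the same value of $T$, the full Kawasaki chain satisfies \[ d_{\mathrm{TV}}\big(xP^T,\mu_\beta^k\big)\le\delta.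 \]
   Context: Parameter region: for $p\in(0,1)$ let $c_p=\frac{\log(p/(1-p))}{2p-1}$ if $p\ne\frac12$ and $c_{1/2}=2$. $\mathscr R_{\mathrm{Kaw}}=\{(p,\beta):0<p<1,\ 0\le\beta<c_p,\ 4\beta p(1-p)<\tfrac12\}$. Model: $\mathcal I=\binom{[n]}{2}$ is the set of $N=n(n-1)/2$ edge-positions; a simple graph on $[n]$ is identified with $X\in\{0,1\}^{\mathcal I}$. $\Omega_k=\{X\in\{0,1\}^{\mathcal I}:\sum_eX_e=k\}$, where throughout $k=Np$ is an integer. $\mathcal H_\beta(X)=\frac{2\beta}{n}\sum_{v=1}^n\binom{\deg_X(v)}{2}$ and $\mu_\beta^k(X)=e^{\mathcal H_\beta(X)}/\sum_{Y\in\Omega_k}e^{\mathcal H_\beta(Y)}$ for $X\in\Omega_k$. Full (global) Kawasaki kernel $P$ on $\Omega_k$: for $x\in\Omega_k$, $s$ with $x_s=1$ and $t$ with $x_t=0$, let $x^{s\leftrightarrow t}$ be obtained by deleting edge $s$ and adding edge $t$; for $y=x^{s\leftrightarrow t}$, \[ P(x,y)=\frac1{k(N-k)}\,\frac{\mu_\beta^k(y)}{\mu_\beta^k(x)+\mu_\beta^k(y)}, \] $P(x,y)=0$ for all other $y\ne x$, and $P(x,x)=1-\sum_{y\ne x}P(x,y)$. Regular set: for edge-positions write $f\sim e$ if $f\ne e$ and $f\cap e\neq\varnothing$; $d(e,X)=|\{f\in\mathcal I:X_f=1,f\sim e\}|$, $r(e,X)=d(e,X)/(2n)$, and $\Gamma_{p,\varepsilon}=\{X\in\Omega_k: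 r(e,X)\in[p-\varepsilon,p+\varepsilon]\ \text{for every }e\in\mathcal I\}$. Complements are taken in $\Omega_k$. Restricted kernel $P_\varepsilon$ on $\Gamma_{p,\varepsilon}$: $P_\varepsilon(x,y)=P(x,y)$ for $x\neq y$ in $\Gamma_{p,\varepsilon}$ and $P_\varepsilon(x,x)=1-\sum_{y\in\Gamma_{p,\varepsilon},y\ne x}P(x,y)$. $xP^T$ denotes the law at time $T$ of the chain started at $x$ (similarly $xP_\varepsilon^T$). *)

(* Defs.v *)
From mathcomp Require Import all_boot all_order all_algebra.
From mathcomp Require Import all_classical all_reals all_analysis.

Set Implicit Arguments.
Unset Strict Implicit.
Unset Printing Implicit Defensive.

Import Order.TTheory GRing.Theory Num.Theory.
Import numFieldNormedType.Exports.

Local Open Scope ring_scope.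

Section Region.
Variable R : realType.

Definition c_crit (p : R) : R :=
  if p == 2^-1 then 2 else ln (p / (1 - p)) / (2 * p - 1).

Definition R_Kaw : set (R * R) :=
  [set q | [/\ 0 < q.1 < 1, 0 <= q.2 < c_crit q.1
             & 4 * q.2 * q.1 * (1 - q.1) < 2^-1]]%classic.

End Region.

(* The set I of edge-positions; its cardinality is 'C(n, 2). *)
Definition edge (n : nat) := {e : {set 'I_n} | #|e| == 2%N}.

Definition graph (n : nat) := {ffun edge n -> bool}.

Section Graphs.
Variable n : nat.
Implicit Types (X : graph n) (e f s t : edge n) (v : 'I_n).

Definition nedges X : nat := #|[pred e | X e]|.

Definition deg X v : nat := #|[pred e | X e & v \in val e]|.

Definition edge_adj f e : bool :=
  (f != e) && (val f :&: val e != finset.set0).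

Definition edge_deg e X : nat := #|[pred f | X f & edge_adj f e]|.

Definition swap X s t : graph n :=
  [ffun e => if e == s then false else if e == t then true else X e].

End Graphs.

Definition Omega (n k : nat) := {X : graph n | nedges X == k}.

Section FiniteMarkovChains.
Variables (R : realType) (S : finType).
Implicit Types (mu nu : S -> R) (K : S -> S -> R) (A : pred S) (x y : S).

Definition mass mu A : R := \sum_(x | A x) mu x.

Definition cond_mass mu A y : R := if A y then mu y / mass mu A else 0.

Definition dTV mu nu : R := 2^-1 * \sum_y `|mu y - nu y|.

(* step_law K x T is the law x K^T. *)
Fixpoint step_law K x (T : nat) : S -> R :=
  if T is T'.+1 then fun y => \sum_z step_law K x T' z * K z y
  else fun y => (y == x)%:R.

(* (X_t) is a Markov chain with kernel K and X_0 = x: the X_t are random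
   variables whose finite-dimensional distributions are the products of the
   transition probabilities. *)
Definition is_markov_chain (d : measure_display) (W : measurableType d)
    (Pr : probability W R) K x (X : nat -> W -> S) : Prop :=
  (forall t y, measurable [set w | X t w = y]%classic) /\
  (forall (m : nat) (a : nat -> S),
     Pr [set w | forall t, (t <= m)%N -> X t w = a t]%classic =
     ((a 0%N == x)%:R * \prod_(t < m) K (a t) (a t.+1))%:E).

(* The chains with kernels K1 and K2, both started from x, can be realized on
   a common probability space so as to agree up to time T with probability at
   least q. *)
Definition coupled_until K1 K2 x (T : nat) (q : R) : Prop :=
  exists (d : measure_display) (W : measurableType d) (Pr : probability W R)
         (X Y : nat -> W -> S),
    [/\ is_markov_chain Pr K1 x X, is_markov_chain Pr K2 x Y
      & (q%:E <=
         Pr [set w | forall t, (t <= T)%N -> X t w = Y t w]%classic)%E].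

End FiniteMarkovChains.

Section Kawasaki.
Variables (R : realType) (n k : nat).
Implicit Types (p beta eps : R) (x y z : Omega n k).

Definition hamiltonian beta (X : graph n) : R :=
  2 * beta / n%:R * \sum_(v < n) 'C(deg X v, 2)%:R.

Definition mu beta x : R :=
  expR (hamiltonian beta (val x)) /
  \sum_(y : Omega n k) expR (hamiltonian beta (val y)).

Definition is_swap x y : bool :=
  [exists s, exists t,
     [&& val x s, ~~ val x t & val y == swap (val x) s t]].

Definition kawasaki_rate beta x y : R :=
  if is_swap x y then
    (k%:R * ('C(n, 2)%:R - k%:R))^-1 * (mu beta y / (mu beta x + mu beta y))
  else 0.

Definition kawasaki beta x y : R :=
  if y == x then 1 - \sum_(z | z != x) kawasaki_rate beta x z
  else kawasaki_rate beta x y.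

Definition edge_ratio (e : edge n) x : R :=
  (edge_deg e (val x))%:R / (2 * n%:R).

Definition Gamma p eps : pred (Omega n k) :=
  [pred x | [forall e, p - eps <= edge_ratio e x <= p + eps]].

(* P_eps is a kernel on Gamma p eps.  It is extended to Omega n k by making
   every state outside Gamma p eps absorbing; a chain started in Gamma p eps
   never leaves it. *)
Definition kawasaki_res p beta eps x y : R :=
  if Gamma p eps x && Gamma p eps y then
    if y == x then
      1 - \sum_(z | Gamma p eps z && (z != x)) kawasaki beta x z
    else kawasaki beta x y
  else (y == x)%:R.

End Kawasaki.

(* Main.v *)
(* Write [N = 'C(n, 2)] and let [d(e, x)] be the edge degree.

   Confinement.  In the regular set, the condition [4 beta p (1 - p) < 1 / 2]
   makes every coordinate [d(e, x) - 2 n p] drift back to [0], so the Lyapunov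
   function [sum_e 2 cosh(lambda (d(e, x) - 2 n p))] grows in one step by at most
   an amount exponentially small relative to its values outside of the regular
   set: started well inside, both chains stay inside, and agree, for an
   exponentially long time.

   Mixing.  Two copies in the regular set are coupled by matching the positions
   where they differ and proposing matched swaps with a common uniform variable.
   The same condition makes the expected Hamming distance contract by a factor
   [1 - eta / (2 N)].

   Statics.  The bound [beta < c_p] is the Kearns-Saul inequality: a centred
   Bernoulli variable is subgaussian with variance proxy [1 / (2 c_p)].  Bounding
   the number of graphs with a given degree sequence by a Chernoff argument first
   shows that [sum_v (deg v - (n-1) p)^2 <= kappa n^3] outside of an event of
   probability [e^{- c n^2}].  Off this event, the mass of the level sets of one
   degree obeys, by reversibility, an approximate recursion whose solution is a
   binomial law tilted by a Gaussian factor, and the subgaussian bound beats the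
   tilt. *)
From HB Require Import structures.
Require Import Defs.
From mathcomp Require Import all_boot all_order all_algebra.
From mathcomp Require Import all_classical all_reals all_analysis.
From mathcomp Require Import ring lra.

Set Implicit Arguments.
Unset Strict Implicit.
Unset Printing Implicit Defensive.

Import Order.TTheory GRing.Theory Num.Theory.
Import numFieldNormedType.Exports.

Local Open Scope ring_scope.

(** * The Kearns-Saul inequality for a centred Bernoulli variable *)

Section KearnsSaul.
Variable R : realType.
Implicit Types a b c p t u w x y z : R.

(** The two conditions of the region act at different places. [4 beta p (1 - p) < 1 / 2] is local:
    it controls the linearisation of the dynamics at density [p] and says nothing far from the
    regular set. [beta < c_p] is global and concerns the measure on all of [Omega n k]. So
    contraction is never claimed on the whole space; the coupling bound carries a term for leaving
    the regular set, and this term limits the attainable precision to [e^{- c n}]. Three nested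
    regular sets occur: chains start at width [eps / 4], drift and contraction hold at width
    [eps / 2], and the restricted kernel lives at width [eps]. The last gap is wider than one swap,
    so both kernels agree on the middle set. In the recursion for a single degree, the ratio of
    consecutive levels depends on all other degrees, which are controlled only off an exceptional
    event. Its mass enters as an additive error that up to [n] steps of the recursion amplify by as
    much as [(K n)^n]. A bound [e^{- c n^2}] survives this; a bound [e^{- c n}] would not. A single
    margin [eta], obtained from the compactness of [B], governs all constants. *)

Definition sinhR u : R := (expR u - expR (- u)) / 2.
Definition coshR u : R := (expR u + expR (- u)) / 2.

Lemma coshR_gt0 u : 0 < coshR u.
Proof. by rewrite /coshR divr_gt0 // addr_gt0 ?expR_gt0. Qed.

Lemma coshRN u : coshR (- u) = coshR u.
Proof. by rewrite /coshR opprK addrC. Qed.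

Lemma coshR0 : coshR 0 = 1.
Proof. rewrite /coshR oppr0 expR0; lra. Qed.

Lemma sinhR0 : sinhR 0 = 0.
Proof. by rewrite /sinhR oppr0 subrr mul0r. Qed.

Lemma is_derive_expRN u : is_derive u 1 (fun x => expR (- x)) (- expR (- u)).
Proof.
have H := @is_derive1_comp R expR (fun x => - x) u (expR (- u)) (-1).
by rewrite -[X in is_derive _ _ _ X]mulrN1; apply: H.
Qed.

Lemma is_derive_sinhR u : is_derive u 1 sinhR (coshR u).
Proof.
have H1 := is_derive_expRN u.
have H : is_derive u 1 (2^-1 *: (expR - (fun x => expR (- x)))) (2^-1 *: (expR u - (- expR (- u)))) by apply: is_deriveZ.
rewrite (_ : sinhR = 2^-1 *: (expR - (fun x => expR (- x)))) ; last first.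
  by apply/funext => x; rewrite /sinhR /= mulrC.
rewrite (_ : coshR u = 2^-1 *: (expR u - (- expR (- u)))) //.
by rewrite /coshR opprK mulrC.
Qed.

Lemma is_derive_coshR u : is_derive u 1 coshR (sinhR u).
Proof.
have H1 := is_derive_expRN u.
have H : is_derive u 1 (2^-1 *: (expR + (fun x => expR (- x)))) (2^-1 *: (expR u + (- expR (- u)))) by apply: is_deriveZ.
rewrite (_ : coshR = 2^-1 *: (expR + (fun x => expR (- x)))) ; last first.
  by apply/funext => x; rewrite /coshR /= mulrC.
by rewrite (_ : sinhR u = 2^-1 *: (expR u + (- expR (- u)))) // /sinhR mulrC.
Qed.

Lemma derive_mvt (f df : R -> R) x y : x < y ->
  (forall z, is_derive z 1 f (df z)) ->
  exists2 c, x < c < y & f y - f x = df c * (y - x).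
Proof.
move=> xy fd.
have [|c] := @MVT R f df x y xy (fun z _ => fd z).
  apply: continuous_subspaceT => z; apply: differentiable_continuous.
  by apply/derivable1_diffP; case: (fd z).
by rewrite in_itv /= => cI E; exists c.
Qed.

Lemma sinhR_ge0 u : 0 <= u -> 0 <= sinhR u.
Proof. by move=> u0; rewrite /sinhR divr_ge0 // subr_ge0 ler_expR; lra. Qed.

Lemma coshR_le x y : 0 <= x -> x <= y -> coshR x <= coshR y.
Proof.
move=> x0; rewrite le_eqVlt => /predU1P[->//|xy].
have [c /andP[xc cy] E] := derive_mvt xy is_derive_coshR.
rewrite -subr_ge0 E mulr_ge0 //; last by lra.
by apply: sinhR_ge0; lra.
Qed.

(** The derivative [coshR] increases on the half-line, so the slope of [sinhR] over [[0, z]] is at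
    most its slope over [[z, y]]: [sinhR u / u] is nondecreasing. *)
Lemma sinhR_star z y : 0 <= z -> z <= y -> y * sinhR z <= z * sinhR y.
Proof.
rewrite le_eqVlt => /predU1P[<-|z0]; first by rewrite sinhR0 mulr0 mul0r.
rewrite le_eqVlt => /predU1P[->//|zy].
have [c /andP[c0 cz] E1] := derive_mvt z0 is_derive_sinhR.
have [d /andP[zd dy] E2] := derive_mvt zy is_derive_sinhR.
have cd : coshR c <= coshR d by apply: coshR_le; lra.
rewrite sinhR0 !subr0 in E1.
have -> : sinhR y = sinhR z + coshR d * (y - z) by rewrite -E2; ring.
have : 0 <= z * (y - z) * (coshR d - coshR c) by rewrite !mulr_ge0 //; lra.
rewrite E1; nra.
Qed.

(** This is [sinhR_star] at the points [a - x] and [a + x], expanded by the addition formulas. It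
    says that [tanh x / x] is nonincreasing. *)
Lemma tanh_star x a : 0 <= x -> x <= a ->
  x * sinhR a * coshR x <= a * sinhR x * coshR a.
Proof.
move=> x0 xa.
have H := @sinhR_star (a - x) (a + x) ltac:(lra) ltac:(lra).
suff E1 : sinhR (a + x) = sinhR a * coshR x + coshR a * sinhR x /\
          sinhR (a - x) = sinhR a * coshR x - coshR a * sinhR x.
  move: H; rewrite E1.1 E1.2; lra.
by rewrite /sinhR /coshR !opprD !opprK !expRD; split; field.
Qed.

Lemma sinhR_le_cosh x : 0 <= x -> sinhR x <= x * coshR x.
Proof.
rewrite le_eqVlt => /predU1P[<-|x0]; first by rewrite sinhR0 mul0r.
have [c /andP[c0 cx] E] := derive_mvt x0 is_derive_sinhR.
move: E; rewrite sinhR0 !subr0 => ->; rewrite mulrC ler_pM2l //.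
by apply: coshR_le; lra.
Qed.

Lemma is_derive_lncosh u :
  is_derive u 1 (fun x => ln (coshR x)) (sinhR u / coshR u).
Proof.
have H1 := is_derive_coshR u.
have H2 := is_derive1_ln (coshR_gt0 u).
rewrite mulrC.
exact: (@is_derive1_comp R (@ln R) coshR u (coshR u)^-1 (sinhR u)).
Qed.

(* The maximum of [ln cosh x - k x^2 / 2] on the half-line is at [a], because
   [tanh x / x] is decreasing. *)
Lemma cosh_quad_bound (k a : R) : 0 <= a ->
  (forall x, 0 <= x -> x <= a -> k * x * coshR x <= sinhR x) ->
  (forall x, a <= x -> sinhR x <= k * x * coshR x) ->
  forall u, coshR u <= coshR a * expR (k / 2 * (u ^+ 2 - a ^+ 2)).
Proof.
move=> a0 Hlo Hhi.
pose f x := k / 2 * x ^+ 2 - ln (coshR x).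
have fd x : is_derive x 1 f (k * x - sinhR x / coshR x).
  have H1 := is_derive_lncosh x.
  have H2 : is_derive x 1 ((k / 2) *: (id * id : R -> R)) (k * x).
    by apply: is_derive_eq; rewrite /GRing.scale /=; field.
  have -> : f = (k / 2) *: (id * id : R -> R) - (fun x => ln (coshR x)).
    by apply/funext => y; rewrite /f expr2.
  exact: is_deriveB.
have fa x : 0 <= x -> f a <= f x.
  move=> x0; case: (ltgtP x a) => [xa|ax|->//].
    have [c /andP[xc ca] E] := derive_mvt xa fd.
    rewrite -subr_le0 E mulr_le0_ge0 //; last by lra.
    by rewrite subr_le0 ler_pdivlMr ?coshR_gt0 // Hlo; lra.
  have [c /andP[xc ca] E] := derive_mvt ax fd.
  rewrite -subr_ge0 E mulr_ge0 //; last by lra.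
  by rewrite subr_ge0 ler_pdivrMr ?coshR_gt0 // Hhi; lra.
suff main u : 0 <= u -> coshR u <= coshR a * expR (k / 2 * (u ^+ 2 - a ^+ 2)).
  move=> u; have [u0|u0] := lerP 0 u; first by have := main u u0.
  by rewrite -coshRN -sqrrN; apply: main; lra.
move=> u0; have := fa u u0; rewrite /f => H.
rewrite -[coshR u]lnK ?posrE ?coshR_gt0 // -[coshR a]lnK ?posrE ?coshR_gt0 //.
rewrite -expRD ler_expR; lra.
Qed.

(** The variance proxy is written [1 / (2 b)] so that a Chernoff bound over [M] trials yields
    [exp (- b u^2 / M)], directly comparable with the factor [exp (beta u^2 / n)] of the Gibbs
    measure. *)
Definition subgauss p b := forall t,
  p * expR (t * (1 - p)) + (1 - p) * expR (- (t * p)) <= expR (t ^+ 2 / (4 * b)).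

Lemma subgaussC p b : subgauss p b -> subgauss (1 - p) b.
Proof.
move=> H t; have := H (- t); rewrite sqrrN => Ht; apply: le_trans Ht.
rewrite le_eqVlt; apply/orP; left; apply/eqP.
have -> : 1 - (1 - p) = p by ring.
by rewrite !mulNr opprK addrC.
Qed.

Lemma subgauss_le p b c : 0 < b -> b <= c -> subgauss p c -> subgauss p b.
Proof.
move=> b0 bc H t; apply: (le_trans (H t)); rewrite ler_expR.
by rewrite ler_wpM2l ?sqr_ge0 // lef_pV2 ?posrE; lra.
Qed.

Lemma subgauss_half : subgauss 2^-1 2.
Proof.
move=> t.
(* The degenerate case [a = 0], [k = 1] of the quadratic bound, that is
   [cosh x <= exp (x^2 / 2)]. *)
have H : coshR (t / 2) <= coshR 0 * expR (1 / 2 * ((t / 2) ^+ 2 - 0 ^+ 2)).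
  apply: cosh_quad_bound => // [x x0 x0'|x x0]; last by rewrite mul1r sinhR_le_cosh.
  have -> : x = 0 by lra.
  by rewrite sinhR0 mulr0 mul0r.
have -> : 2^-1 * expR (t * (1 - 2^-1)) + (1 - 2^-1) * expR (- (t * 2^-1)) =
    coshR (t / 2).
  have -> : t * (1 - 2^-1) = t / 2 by field.
  by rewrite /coshR; field.
apply: le_trans H _; rewrite coshR0 mul1r ler_expR le_eqVlt.
by apply/orP; left; apply/eqP; field.
Qed.

(* With [p = e^{-a} / (2 cosh a)], the moment generating function is
   [e^{t (1/2 - p)} cosh (t/2 - a) / cosh a] and [c_crit p = 2 a / tanh a]. *)
Lemma subgauss_crit_lt p : 0 < p -> p < 2^-1 ->
  2 <= c_crit p /\ subgauss p (c_crit p).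
Proof.
move=> p0 p2; set q := 1 - p.
have q0 : 0 < q by rewrite /q; lra.
pose a := ln (q / p) / 2.
have qp0 : 0 < q / p by rewrite divr_gt0.
have a0 : 0 < a.
  by rewrite /a divr_gt0 // ln_gt0 // ltr_pdivlMr // /q; lra.
have E2a : expR a * expR a = q / p.
  have -> : expR a * expR a = expR (ln (q / p)) by rewrite -expRD /a; congr expR; field.
  by rewrite lnK.
have eaN : expR a * expR (- a) = 1 by rewrite -expRD subrr expR0.
have ea0 := expR_gt0 a. have eaN0 := expR_gt0 (- a).
have Ea : q * expR (- a) = p * expR a.
  apply: (mulfI (lt0r_neq0 ea0)).
  have -> : expR a * (q * expR (- a)) = q * (expR a * expR (- a)) by ring.
  have -> : expR a * (p * expR a) = p * (expR a * expR a) by ring.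
  by rewrite E2a eaN; field; lra.
have ch0 := coshR_gt0 a.
have Ep : p * (2 * coshR a) = expR (- a).
  by rewrite /coshR; move: Ea; rewrite /q; lra.
have Eq : q * (2 * coshR a) = expR a.
  by rewrite /coshR; move: Ea; rewrite /q; lra.
have Esh : sinhR a = (1 - 2 * p) * coshR a.
  by rewrite /sinhR -Eq -Ep /q; field.
have Ec : c_crit p = 2 * a / (1 - 2 * p).
  rewrite /c_crit ifF; last by apply/eqP; lra.
  have -> : p / (1 - p) = (q / p)^-1 by rewrite invf_div.
  rewrite lnV ?posrE // /a; field; apply/andP; split; apply/eqP; lra.
have p12 : 0 < 1 - 2 * p by lra.
have c2 : 2 <= c_crit p.
  rewrite Ec ler_pdivlMr //.
  have := sinhR_le_cosh (ltW a0); rewrite Esh ler_pM2r //; lra.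
split=> // t.
(* Since [tanh a = 1 - 2 p], the choice [k = tanh a / a] makes the bound tight at the points [a] and
   [- a]; the latter corresponds to [t = 0]. *)
have Hb := @cosh_quad_bound ((1 - 2 * p) / a) a (ltW a0) _ _ (t / 2 - a).
have {}Hb : coshR (t / 2 - a) <= coshR a * expR ((1 - 2 * p) / a / 2 * ((t / 2 - a) ^+ 2 - a ^+ 2)).
  apply: Hb => x.
    move=> x0 xa; have := tanh_star x0 xa; rewrite Esh => H.
    have -> : (1 - 2 * p) / a * x * coshR x = (x * (1 - 2 * p) * coshR x) / a.
      by field; lra.
    rewrite ler_pdivrMr // -(ler_pM2r ch0); move: H; lra.
  move=> ax; have := tanh_star (ltW a0) ax; rewrite Esh => H.
  have -> : (1 - 2 * p) / a * x * coshR x = (x * (1 - 2 * p) * coshR x) / a.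
    by field; lra.
  rewrite ler_pdivlMr // -(ler_pM2r ch0); move: H; lra.
have -> : p * expR (t * (1 - p)) + (1 - p) * expR (- (t * p)) =
   expR (t * (2^-1 - p)) * coshR (t / 2 - a) / coshR a.
  apply/eqP; rewrite eq_sym; apply/eqP; rewrite -/q.
  have -> : t * q = t * (2^-1 - p) + t / 2 by rewrite /q; field.
  have -> : - (t * p) = t * (2^-1 - p) + (- (t / 2)) by field.
  rewrite !expRD {1}/coshR opprB expRD [expR (a - t / 2)]expRD -Eq -Ep.
  by field; lra.
rewrite ler_pdivrMr //.
apply: le_trans (_ : expR (t * (2^-1 - p)) * (coshR a * expR ((1 - 2 * p) / a / 2 * ((t / 2 - a) ^+ 2 - a ^+ 2))) <= _).
  by rewrite ler_pM2l ?expR_gt0.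
rewrite mulrCA [leRHS]mulrC ler_pM2l // -expRD ler_expR Ec.
rewrite le_eqVlt; apply/orP; left; apply/eqP; field.
by apply/andP; split; apply/eqP; lra.
Qed.

Lemma subgauss_crit p : 0 < p < 1 -> 2 <= c_crit p /\ subgauss p (c_crit p).
Proof.
move=> /andP[p0 p1]; case: (ltgtP p 2^-1) => p2.
- exact: subgauss_crit_lt.
- have [||c2 H] := @subgauss_crit_lt (1 - p); [lra|lra|].
  suff E : c_crit (1 - p) = c_crit p.
    by rewrite -E; split=> //; have := subgaussC H; rewrite subKr.
  rewrite /c_crit !ifF; [|by apply/eqP; lra..].
  have -> : 1 - (1 - p) = p by ring.
  have -> : (1 - p) / p = (p / (1 - p))^-1 by rewrite invf_div.
  rewrite lnV ?posrE ?divr_gt0 //; last by lra.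
  by field; apply/andP; split; apply/eqP; lra.
- by rewrite p2 /c_crit eqxx; split => //; exact: subgauss_half.
Qed.

End KearnsSaul.

(** * Uniform margins on a compact subset of the parameter region *)

Section RegionUniform.
Local Open Scope classical_set_scope.
Local Open Scope ring_scope.

(** The conclusion is a joint neighbourhood in the point and in [eta], the form required by the
    near-covering characterisation of compactness. *)
Lemma near_ge_pos (R : realType) (f : R * R -> R) (q : R * R) :
  {for q, continuous f} -> 0 < f q ->
  \forall q' \near q & eta \near 0^'+, eta <= f q'.
Proof.
move=> cf fq.
have H1 : \forall q' \near q, f q / 2 < f q'.
  by apply: (cvgr_gt _ cf); lra.
have H2 : \forall eta \near (0:R)^'+, eta < f q / 2.
  by apply: nbhs_right_lt; lra.
near=> q' eta => /=.
rewrite ltW // (@lt_trans _ _ (f q / 2)) //; [near: eta|near: q'] => //.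
Unshelve. all: by end_near. Qed.

Lemma continuous_c_crit (R : realType) (p : R) : 0 < p < 1 -> p != 2^-1 ->
  {for p, continuous (@c_crit R)}.
Proof.
move=> /andP[p0 p1] p2.
have E : {near p, (fun x : R => ln (x * (1 - x)^-1) * (2 * x - 1)^-1) =1 @c_crit R}.
  near=> x; rewrite /c_crit ifF //; apply/negbTE; near: x.
  exact: (open_neq (y := 2^-1)).
apply: cvg_trans (near_eq_cvg E) _.
have -> : c_crit p = ln (p * (1 - p)^-1) * (2 * p - 1)^-1.
  by rewrite /c_crit ifF //; apply/negbTE.
have c1 : (1 - x : R) @[x --> p] --> (1 - p : R).
  by apply: cvgB; [exact: cvg_cst|exact: cvg_id].
apply: cvgM.
  apply: (@continuous_cvg _ _ _ _ _ (fun x : R => x * (1 - x)^-1) (@ln R)).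
    by apply: continuous_ln; rewrite divr_gt0 // subr_gt0.
  by apply: cvgM; [exact: cvg_id|apply: cvgV => //; rewrite subr_eq0 gt_eqF].
apply: cvgV; first by apply/eqP; move/eqP: p2; lra.
apply: cvgB; last exact: cvg_cst.
by apply: cvgM; [exact: cvg_cst|exact: cvg_id].
Unshelve. all: by end_near. Qed.

(** Each strict inequality of the region has a slack bounded below near every point of [B];
    compactness turns these local slacks into one [eta]. *)
Lemma region_uniform (R : realType) (B : set (R * R)) :
  compact B -> (B `<=` @R_Kaw R)%classic ->
  exists eta : R, 0 < eta /\ forall p beta, B (p, beta) ->
    [/\ eta <= p, eta <= 1 - p, 0 <= beta <= eta^-1,
        4 * beta * p * (1 - p) <= 2^-1 - eta & beta + eta <= c_crit p].
Proof.
move=> cB sB.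
pose P (eta : R) (q : R * R) := [/\ eta <= q.1, eta <= 1 - q.1, q.2 <= eta^-1,
        eta <= 2^-1 - 4 * q.2 * q.1 * (1 - q.1) & eta <= c_crit q.1 - q.2].
have /compact_near_coveringP/(_ R (0^'+) P _) H := cB.
have : \forall eta \near (0:R)^'+, (B `<=` P eta)%classic.
  apply: H => //; move=> [p be] /sB [/= /andP[p0 p1] /andP[b0 bc] bp].
  have c1 : {for (p, be), continuous (fun q : R * R => q.1)} by apply: cvg_fst.
  have c2 : {for (p, be), continuous (fun q : R * R => q.2)} by apply: cvg_snd.
  have c3 : {for (p, be), continuous (fun q : R * R => 1 - q.1)}.
    by apply: cvgB; [exact: cvg_cst|exact: c1].
  have F1 := @near_ge_pos R _ _ c1 p0.
  have F2 : \forall q' \near (p, be) & eta \near 0^'+, eta <= 1 - q'.1.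
    by apply: near_ge_pos c3 _ => /=; lra.
  have F3 : \forall q' \near (p, be) & eta \near 0^'+, eta <= 2^-1 - 4 * q'.2 * q'.1 * (1 - q'.1).
    apply: near_ge_pos => /=; last by lra.
    apply: cvgB; first exact: cvg_cst.
    by apply: cvgM => //; apply: cvgM => //; apply: cvgM => //; exact: cvg_cst.
  have F4 : \forall q' \near (p, be) & eta \near 0^'+, eta <= c_crit q'.1 - q'.2.
    (* At [1 / 2] the function [c_crit] is given by a separate clause. There the global bound
       [2 <= c_crit], with [2] its value at that point, replaces continuity. *)
    have [p2|p2] := eqVneq p 2^-1.
      have F : \forall q' \near (p, be) & eta \near 0^'+, eta <= 2 - q'.2.
        apply: near_ge_pos => /=; first by apply: cvgB; [exact: cvg_cst|exact: c2].
        by move: bc; rewrite /c_crit p2 eqxx; lra.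
      have G2 : \forall q' \near (p, be) & eta \near (0:R)^'+, 0 < eta.
        by near=> q' eta => /=; near: eta; exact: nbhs_right_gt.
      apply: filterS (filterI F (filterI G2 (filterI F1 F2))) => -[q' eta] /=.
      move=> [f0 [e0 [f1 f2]]].
      have [|c2' _] := @subgauss_crit R q'.1; first by apply/andP; lra.
      by lra.
    apply: near_ge_pos => /=; last by lra.
    apply: cvgB; last exact: c2.
    apply: (@continuous_cvg _ _ _ _ _ (fun q : R * R => q.1) (@c_crit R)) => //.
    by apply: continuous_c_crit => //; rewrite p0.
  have F5 : \forall q' \near (p, be) & eta \near (0:R)^'+, q'.2 <= eta^-1.
    have H1 : \forall q' \near (p, be), q'.2 < be + 1.
      by apply: (cvgr_lt _ c2) => /=; lra.
    have H2 : \forall eta \near (0:R)^'+, eta < (be + 1)^-1.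
      by apply: nbhs_right_lt; rewrite invr_gt0; lra.
    have H3 : \forall eta \near (0:R)^'+, 0 < eta by exact: nbhs_right_gt.
    near=> q' eta => /=.
    have e1 : eta < (be + 1)^-1 by near: eta.
    have e0 : 0 < eta by near: eta.
    have : q'.2 < be + 1 by near: q'.
    move=> /ltW/le_trans; apply.
    by rewrite -[be + 1]invrK lef_pV2 ?posrE ?invr_gt0 //; lra.
  apply: filterS (filterI F1 (filterI F2 (filterI F3 (filterI F4 F5)))).
  by move=> [q' eta] /= [f1 [f2 [f3 [f4 f5]]]].
move=> HB.
have H3 : \forall eta \near (0:R)^'+, 0 < eta by exact: nbhs_right_gt.
near (0:R)^'+ => eta; exists eta; split; first by near: eta.
move=> p be Bp.
have : (B `<=` P eta)%classic by near: eta.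
move=> /(_ _ Bp)[/= h1 h2 h3 h4 h5].
have [/= _ /andP[b0 _] _] := sB _ Bp.
by split=> //; [rewrite b0|lra|lra].
Unshelve. all: by end_near. Qed.

End RegionUniform.

(** * Markov chains driven by a single uniform variable *)

Section ChainRealization.
Variables (R : realType) (S : finType) (K : S -> S -> R) (x0 : S).
Hypothesis K_ge0 : forall x y, 0 <= K x y.
Hypothesis K_sum1 : forall x, \sum_y K x y = 1.

Definition cumul (z : S) (i : nat) : R :=
  \sum_(0 <= j < i) K z (nth x0 (enum S) j).

Lemma cumul0 z : cumul z 0 = 0.
Proof. by rewrite /cumul big_geq. Qed.

Lemma cumulS z i : cumul z i.+1 = cumul z i + K z (nth x0 (enum S) i).
Proof. by rewrite /cumul big_nat_recr. Qed.

Lemma cumul_le z i j : (i <= j)%N -> cumul z i <= cumul z j.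
Proof.
by move/subnK<-; elim: (j - i)%N => // d H; rewrite addSn cumulS ler_wpDr.
Qed.

Lemma cumul_size z : cumul z #|S| = 1.
Proof. by rewrite /cumul -(K_sum1 z) cardE -(big_nth x0 predT (K z)) big_enum. Qed.

Definition lower_cdf z y := cumul z (index y (enum S)).

Definition next_state z (u : R) : S :=
  nth x0 (enum S) (find (fun i => u < cumul z i.+1) (iota 0 #|S|)).

Lemma lower_ge0 z y : 0 <= lower_cdf z y.
Proof. by rewrite -(cumul0 z) cumul_le. Qed.

Lemma lowerD z y : lower_cdf z y + K z y = cumul z (index y (enum S)).+1.
Proof. by rewrite cumulS nth_index ?mem_enum. Qed.

Lemma lower_le1 z y : lower_cdf z y + K z y <= 1.
Proof.
by rewrite lowerD -(cumul_size z) cumul_le // cardE index_mem mem_enum.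
Qed.

Lemma next_stateP z u y : 0 <= u < 1 ->
  (next_state z u == y) = (lower_cdf z y <= u < lower_cdf z y + K z y).
Proof.
move=> /andP[u0 u1]; rewrite lowerD /next_state.
set a := fun i => _; set i := find a _.
have hi : has a (iota 0 #|S|).
  apply/hasP; exists #|S|.-1.
    by rewrite mem_iota add0n /= ltn_predL; apply/card_gt0P; exists x0.
  rewrite /a prednK ?cumul_size //; apply/card_gt0P; by exists x0.
have li : (i < #|S|)%N by move: hi; rewrite has_find size_iota.
have ai : u < cumul z i.+1.
  by have := nth_find 0%N hi; rewrite -/i nth_iota.
have bi : cumul z i <= u.
  case: (posnP i) => [->|i0]; first by rewrite cumul0.
  have /(before_find 0%N) : (i.-1 < i)%N by rewrite ltn_predL.
  rewrite nth_iota; last by rewrite (leq_trans _ li) // prednK // ltnW.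
  by rewrite add0n /a prednK // leNgt => ->.
apply/eqP/andP => [<-|[ly uy]].
  by rewrite /lower_cdf index_uniq ?enum_uniq // -?cardE.
have -> : i = index y (enum S).
  apply/eqP; rewrite eqn_leq; apply/andP; split; rewrite leqNgt; apply/negP => H.
    by have := lt_le_trans uy (le_trans (cumul_le z H) bi); rewrite ltxx.
  by have := lt_le_trans ai (le_trans (cumul_le z H) ly); rewrite ltxx.
by rewrite nth_index ?mem_enum.
Qed.

(** The second component is the randomness still available. Once the uniform [u] has selected [y],
    its relative position inside the subinterval of [y] is again uniform and drives the next step,
    so one number in [[0, 1)] produces the whole trajectory. *)
Fixpoint traj (t : nat) (w : R) : S * R :=
  if t is t'.+1 then
    let: (z, u) := traj t' w in
    let y := next_state z u in (y, (u - lower_cdf z y) / K z y)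
  else (x0, w).

(** The starting points that follow a given path form a half-open interval whose length is the
    probability of the path, and the residual variable is the affine coordinate on it. Carrying this
    coordinate through the induction is what lets the interval be subdivided at the next step; a
    path of probability zero has an empty interval. *)
Lemma traj_cylinder (a : nat -> S) (m : nat) : a 0%N = x0 ->
  let W := \prod_(t < m) K (a t) (a t.+1) in
  exists l : R, [/\ 0 <= l, l + W <= 1 & forall w, 0 <= w < 1 ->
    ((forall t, (t <= m)%N -> (traj t w).1 = a t) <-> l <= w < l + W) /\
    (l <= w < l + W -> (traj m w).2 = (w - l) / W)].
Proof.
move=> a0; elim: m => [|m [l [l0 lW Hl]]].
  rewrite /= big_ord0; exists 0; split; [exact: lexx|by rewrite add0r lexx|].
  move=> w w01; rewrite add0r w01; split; last by move=> _; rewrite subr0 divr1.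
  by split=> // _ [|//] _; rewrite /= a0.
rewrite /=; set W := \prod_(t < m) _ in lW Hl *.
rewrite big_ord_recr /= -/W.
have W0 : 0 <= W by apply: prodr_ge0.
set lo := lower_cdf (a m) (a m.+1); set k := K (a m) (a m.+1).
have lo0 : 0 <= lo by exact: lower_ge0.
have lo1 : lo + k <= 1 by exact: lower_le1.
have k0 : 0 <= k by exact: K_ge0.
have Wlo : 0 <= W * lo by apply: mulr_ge0.
have Wk : W * (lo + k) <= W by rewrite ler_piMr.
exists (l + W * lo); split; [by lra|by lra|move=> w w01].
have [Ha Hu] := Hl w w01.
have sub : l + W * lo <= w < l + W * lo + W * k ->
    [/\ l <= w < l + W, 0 < W & 0 < k].
  move=> /andP[h1 h2]; have Wk0 : 0 < W * k by lra.
  have Wp : 0 < W.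
    by rewrite lt_neqAle W0 andbT; apply/eqP => W00; move: Wk0; rewrite -W00 mul0r ltxx.
  by split; [apply/andP; lra|done|move: Wk0; rewrite pmulr_rgt0].
have nx : l <= w < l + W ->
    (((traj m.+1 w).1 == a m.+1) = (l + W * lo <= w < l + W * lo + W * k)).
  move=> lw; have Wp : 0 < W by case/andP: lw => ? ?; lra.
  have am : (traj m w).1 = a m by apply: (Ha.2 lw).
  rewrite /= (surjective_pairing (traj m w)) /= am (Hu lw) next_stateP.
    rewrite -/lo -/k ler_pdivlMr // ltr_pdivrMr //.
    by congr andb; apply/idP/idP; lra.
  by case/andP: lw => ? ?; rewrite divr_ge0 //= ?ltr_pdivrMr //; lra.
split; first split=> [H|H].
- have lw : l <= w < l + W by apply/Ha => t tm; apply: H; apply: leqW.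
  by rewrite -nx //; apply/eqP; apply: H.
- have [lw Wp kp] := sub H.
  move=> t; rewrite leq_eqVlt => /predU1P[->|]; last by rewrite ltnS; apply: Ha.2.
  by apply/eqP; rewrite nx.
- move=> H; have [lw Wp kp] := sub H.
  have am : (traj m w).1 = a m by apply: (Ha.2 lw).
  have : (traj m.+1 w).1 = a m.+1 by apply/eqP; rewrite nx.
  rewrite /= (surjective_pairing (traj m w)) /= am (Hu lw) => ->.
  by rewrite -/lo -/k; field; apply/andP; split; apply/eqP; lra.
Qed.

End ChainRealization.

Section ChainExistence.
Local Open Scope classical_set_scope.
Local Open Scope ring_scope.
Variables (R : realType).

(** A measure on the whole real line that is carried by the unit interval; as a sample space the
    line keeps its usual measurable structure. *)
Definition unit_lebesgue :=
  mrestr (@lebesgue_measure R) (measurable_itv `[0 : R, 1[).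

HB.instance Definition _ := Measure.on unit_lebesgue.

Lemma unit_lebesgue_setT : unit_lebesgue setT = 1%E.
Proof.
by rewrite /unit_lebesgue /mrestr setTI lebesgue_measure_itv /= lte_fin ltr01 sube0.
Qed.

HB.instance Definition _ := Measure_isProbability.Build _ _ _
  unit_lebesgue unit_lebesgue_setT.

Variables (S : finType) (K : S -> S -> R) (x0 : S).
Hypothesis K_ge0 : forall x y, 0 <= K x y.
Hypothesis K_sum1 : forall x, \sum_y K x y = 1.

Definition chain_on_unit (t : nat) (w : R) : S :=
  if 0 <= w < 1 then (traj K x0 t w).1 else x0.

Lemma chain_cylinder (m : nat) (a : nat -> S) :
  exists l : R, let W := (a 0%N == x0)%:R * \prod_(t < m) K (a t) (a t.+1) in
  [/\ 0 <= l, l + W <= 1 & forall w, 0 <= w < 1 ->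
    ((forall t, (t <= m)%N -> chain_on_unit t w = a t) <-> l <= w < l + W)].
Proof.
have [a0|a0] := eqVneq (a 0%N) x0.
  have [l [l0 lW H]] := traj_cylinder K_ge0 K_sum1 m a0.
  exists l; rewrite mul1r; split=> // w w01; have [<- _] := H w w01.
  by rewrite /chain_on_unit w01.
exists 0; rewrite mul0r; split; rewrite ?addr0 // => w w01.
split=> [/(_ 0%N isT)|/andP[h1 h2]]; last by move: (lt_le_trans h2 h1); rewrite ltxx.
by rewrite /chain_on_unit w01 /= => E; rewrite -E eqxx in a0.
Qed.

Lemma chain_cylinder_set (m : nat) (a : nat -> S) :
  measurable [set w : R | forall t, (t <= m)%N -> chain_on_unit t w = a t] /\
  unit_lebesgue [set w : R | forall t, (t <= m)%N -> chain_on_unit t w = a t] =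
  ((a 0%N == x0)%:R * \prod_(t < m) K (a t) (a t.+1))%:E.
Proof.
have [l /=] := chain_cylinder m a; set W := _ * _ => -[l0 lW Hl].
set E := [set w | _].
have EI : E `&` `[0, 1[%classic = `[l, l + W[%classic.
  apply/seteqP; split=> w /=.
    by move=> [Ew]; rewrite !in_itv /= => w01; apply/(Hl w w01).
  rewrite !in_itv /= => lw.
  have w01 : 0 <= w < 1 by case/andP: lw => ? ?; apply/andP; lra.
  by split=> //; apply/(Hl w w01).
have W0 : 0 <= W by rewrite mulr_ge0 // prodr_ge0.
split; last first.
  rewrite /unit_lebesgue /mrestr EI lebesgue_measure_itv /= lte_fin.
  case: ifPn => [_|]; first by rewrite -EFinB addrAC subrr add0r.
  by rewrite -leNgt => h; have -> : W = 0 by lra.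
(* Outside the unit interval the chain is constantly [x0], so there the event is everything or
   nothing, according to whether the prescribed path is constantly [x0]. *)
have -> : E = `[l, l + W[%classic `|` (~` `[0, 1[%classic `&` [set _ | forall t, (t <= m)%N -> x0 = a t]).
  rewrite -EI; apply/seteqP; split=> w /=.
    move=> Ew; have [w01|w01] := boolP (w \in `[0, 1[); [by left|right].
    split; first by apply/negP.
    by move=> t tm; rewrite -(Ew t tm) /chain_on_unit ifF //; apply/negbTE.
  move=> [[]//|[w01 Hx] t tm]; rewrite /chain_on_unit.
  have -> : (0 <= w < 1) = false by apply/negP => h; apply: w01; rewrite in_itv.
  exact: Hx.
apply: measurableU; first exact: measurable_itv.
apply: measurableI; first by apply: measurableC; exact: measurable_itv.
case: (pselect (forall t, (t <= m)%N -> x0 = a t)) => H.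
  by rewrite (_ : [set _ | _] = setT) //; apply/seteqP; split.
by rewrite (_ : [set _ | _] = set0) //; apply/seteqP; split.
Qed.

Lemma measurable_chain (t : nat) (y : S) :
  measurable [set w : R | chain_on_unit t w = y].
Proof.
have -> : [set w : R | chain_on_unit t w = y] =
   \bigcup_(a in [set a : {ffun 'I_t.+1 -> S} | a ord_max = y])
     [set w : R | forall s, (s <= t)%N -> chain_on_unit s w = a (inord s)].
  apply/seteqP; split=> w /=.
    move=> Ew; exists [ffun s : 'I_t.+1 => chain_on_unit s w] => /=.
      by rewrite ffunE.
    by move=> s st; rewrite ffunE inordK.
  move=> [a ay] /(_ t (leqnn t)) ->; rewrite -ay; congr (a _).
  by apply/val_inj; rewrite /= inordK.
apply: fin_bigcup_measurable; first exact: finite_finset.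
by move=> a _; have [] := chain_cylinder_set t (fun s => a (inord s)).
Qed.

Lemma markov_chain_exists : exists (d : measure_display) (W : measurableType d)
  (Pr : probability W R) (X : nat -> W -> S), is_markov_chain Pr K x0 X.
Proof.
exists _, (measurableTypeR R), unit_lebesgue, chain_on_unit.
split; first exact: measurable_chain.
by move=> m a; have [] := chain_cylinder_set m a.
Qed.

End ChainExistence.

(** * Probabilities of path events of a Markov chain *)

Section StayProbability.
Local Open Scope classical_set_scope.
Local Open Scope ring_scope.
Variables (R : realType) (S : finType) (K : S -> S -> R).

(* For the chain at [z] at time [s], the probability of being in [A t] at each
   of the [j] times [t = s+1, ..., s+j]. *)
Fixpoint stay_prob (A : nat -> pred S) (s j : nat) (z : S) : R :=
  if j is j'.+1 then \sum_(y | A s.+1 y) K z y * stay_prob A s.+1 j' y else 1.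

Variables (d : measure_display) (W : measurableType d) (Pr : probability W R).

Lemma probability_partition (Z : W -> S) (B : pred S) (E : set W) :
  (forall y, measurable [set w | Z w = y]) -> measurable E ->
  (E `<=` [set w | B (Z w)]) ->
  Pr E = (\sum_(y | B y) Pr (E `&` [set w | Z w = y]))%E.
Proof.
move=> mZ mE EB; rewrite (bigfs _ (index_enum_uniq S)); last first.
  by move=> y; rewrite mem_index_enum.
rewrite -measure_fin_bigcup //; last first.
- by move=> y _; apply: measurableI.
- by apply/trivIsetP => y z _ _ yz; apply/seteqP; split=> // w /= [[_ ->] [_ /eqP]]; rewrite (negbTE yz).
congr (Pr _); apply/seteqP; split=> w /=; last by move=> [y _ []].
by move=> Ew; exists (Z w) => //; apply: EB.
Qed.

(** A prescribed prefix up to time [s] is kept in the event so that the induction on [j] can split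
    according to the state at time [s + 1] and lengthen the prefix by it; the definition of a Markov
    chain only speaks of fully prescribed prefixes. *)
Lemma chain_stay_prob (x : S) (Z : nat -> W -> S) :
  is_markov_chain Pr K x Z -> forall (A : nat -> pred S) (j s : nat) (a : nat -> S),
  let E := [set w | (forall t, (t <= s)%N -> Z t w = a t) /\
                    (forall t, (s < t <= s + j)%N -> A t (Z t w))] in
  measurable E /\
  Pr E = ((a 0%N == x)%:R * \prod_(t < s) K (a t) (a t.+1) * stay_prob A s j (a s))%:E.
Proof.
move=> [mZ PZ] A; elim=> [|j IH] s a E.
  have -> : E = [set w | forall t, (t <= s)%N -> Z t w = a t].
    apply/seteqP; split=> w /=; first by case.
    by move=> H; split=> // t; rewrite addn0 => /andP[/leq_trans H1 /H1]; rewrite ltnn.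
  split; last by rewrite PZ /= mulr1.
  have -> : [set w | forall t, (t <= s)%N -> Z t w = a t] =
    \bigcap_(t in [set` (fun t => (t <= s)%N)]) [set w | Z t w = a t].
    by apply/seteqP; split.
  apply: bigcap_measurable => [|t _]; [by exists 0%N|exact: mZ].
pose a' y t := if t == s.+1 then y else a t.
pose F y := [set w | (forall t, (t <= s.+1)%N -> Z t w = a' y t) /\
                    (forall t, (s.+1 < t <= s.+1 + j)%N -> A t (Z t w))].
have mF y : measurable (F y) by have [] := IH s.+1 (a' y).
have EF y : A s.+1 y -> E `&` [set w | Z s.+1 w = y] = F y.
  move=> Ay; apply/seteqP; split=> w /=.
    move=> [[H1 H2] Zy]; split=> t; last first.
      by rewrite addSnnS => /andP[h1 h2]; apply: H2; rewrite h2 andbT ltnW.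
    by rewrite /a'; case: eqP => [-> //|]; rewrite leq_eqVlt => /eqP/negbTE-> /H1.
  move=> [H1 H2].
  have Zy : Z s.+1 w = y by rewrite (H1 _ (leqnn _)) /a' eqxx.
  split=> //; split=> t.
    by move=> ts; rewrite H1 ?leqW // /a' ltn_eqF.
  rewrite leq_eqVlt => /andP[/predU1P[<-|st] h]; first by rewrite Zy.
  by apply: H2; rewrite st addSnnS.
have UE : E = \bigcup_(y in [set` A s.+1]) F y.
  apply/seteqP; split=> w /=.
    move=> Ew; have Ay : A s.+1 (Z s.+1 w).
      by apply Ew.2; rewrite ltnSn addnS ltnS leq_addr.
    by exists (Z s.+1 w) => //; rewrite -(EF _ Ay).
  by move=> [y Ay]; rewrite -(EF _ Ay) => -[].
have mE : measurable E by rewrite UE; apply: fin_bigcup_measurable => //; exact: finite_finset.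
split=> //.
rewrite (@probability_partition (Z s.+1) (A s.+1)) //; last first.
  by move=> w [_ H] /=; apply: H; rewrite ltnSn addnS ltnS leq_addr.
rewrite (eq_bigr (fun y => ((a 0%N == x)%:R * \prod_(t < s) K (a t) (a t.+1) * (K (a s) y * stay_prob A s.+1 j y))%:E)); last first.
  move=> y Ay; rewrite EF //; have [_ ->] := IH s.+1 (a' y); congr (_%:E).
  rewrite big_ord_recr /= -!mulrA /a' eqxx; congr (_ * _).
  have -> : \prod_(t < s) K (if t == s.+1 :> nat then y else a t)
      (if t.+1 == s.+1 then y else a t.+1) = \prod_(t < s) K (a t) (a t.+1).
    apply: eq_bigr => t _; rewrite eqSS (ltn_eqF (ltn_ord t)).
    by rewrite (ltn_eqF (ltnW _)) // ltnS ltn_ord.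
  by rewrite (ltn_eqF (ltnSn s)).
by rewrite sumEFin /= -mulr_sumr.
Qed.

Lemma chain_all_prob (x : S) (Z : nat -> W -> S) (A : nat -> pred S) (m : nat) :
  is_markov_chain Pr K x Z ->
  let E := [set w | forall t, (t <= m)%N -> A t (Z t w)] in
  measurable E /\ Pr E = ((A 0%N x)%:R * stay_prob A 0 m x)%:E.
Proof.
move=> HZ E; have st := chain_stay_prob HZ A m 0%N.
pose F p := [set w | (forall t, (t <= 0)%N -> Z t w = p) /\
                     (forall t, (0 < t <= m)%N -> A t (Z t w))].
have mF p : measurable (F p) by have [] := st (fun=> p).
have EF p : A 0%N p -> E `&` [set w | Z 0%N w = p] = F p.
  move=> Ap; apply/seteqP; split=> w /=.
    move=> [H Zp]; split=> t; first by rewrite leqn0 => /eqP->.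
    by move=> /andP[_ tm]; apply: H.
  move=> [H1 H2]; split; last exact: H1.
  move=> [_|t tm]; first by rewrite (H1 0%N).
  exact: H2.
have mE : measurable E.
  have -> : E = \bigcup_(p in [set` A 0%N]) F p.
    apply/seteqP; split=> w /=.
      by move=> Ew; exists (Z 0%N w); [exact: Ew|rewrite -EF //; exact: Ew].
    by move=> [p Ap]; rewrite -(EF _ Ap) => -[].
  by apply: fin_bigcup_measurable => //; exact: finite_finset.
split=> //; rewrite (@probability_partition (Z 0%N) (A 0%N)) //; last 2 first.
- exact: HZ.1.
- by move=> w /= Ew; exact: Ew.
rewrite (eq_bigr (fun p => ((p == x)%:R * stay_prob A 0 m p)%:E)); last first.
  by move=> p Ap; rewrite EF //; have [_ ->] := st (fun=> p); rewrite big_ord0 mulr1.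
rewrite sumEFin; congr (_%:E); rewrite big_mkcond /= (bigD1 x) //= eqxx mul1r.
rewrite big1 ?addr0; last by move=> p /negbTE->; rewrite mul0r if_same.
by case: (A 0%N x); rewrite ?mul1r ?mul0r.
Qed.

End StayProbability.

(** * Total variation, survival and contraction for finite kernels *)

Section FiniteKernels.
Variables (R : realType) (S : finType).
Implicit Types (K Q : S -> S -> R) (mu nu : S -> R) (G : pred S) (f : S -> R).

Definition distribution_on mu := (forall x, 0 <= mu x) /\ \sum_x mu x = 1.

Definition stochastic K := forall x, distribution_on (K x).

Lemma sum_delta (f : S -> R) x : \sum_y (y == x)%:R * f y = f x.
Proof.
rewrite (bigD1 x) //= eqxx mul1r big1 ?addr0 // => y /negbTE->.
by rewrite mul0r.
Qed.

(** [step_law] appends its steps at the end, whereas couplings and survival are analysed by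
    conditioning on the first step. *)
Lemma step_law_first K x T y :
  step_law K x T.+1 y = \sum_z K x z * step_law K z T y.
Proof.
elim: T x y => [|T IH] x y /=.
  rewrite sum_delta; under eq_bigr => z _ do rewrite mulrC eq_sym.
  by rewrite sum_delta.
transitivity (\sum_w (\sum_z K x z * step_law K z T w) * K w y).
  by apply: eq_bigr => w _; rewrite -IH.
under [LHS]eq_bigr => w _ do rewrite mulr_suml.
rewrite exchange_big; apply: eq_bigr => z _ /=.
by rewrite mulr_sumr; apply: eq_bigr => w _; rewrite mulrA.
Qed.

Lemma step_law_distribution K x T : stochastic K -> distribution_on (step_law K x T).
Proof.
move=> sK; elim: T => [|T [IH0 IH1]].
  split=> [y /=|]; first by case: eqP.
  by rewrite -[RHS](sum_delta (fun=> 1) x); apply: eq_bigr => y _; rewrite mulr1.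
split=> [y /=|].
  by apply: sumr_ge0 => z _; apply: mulr_ge0 => //; apply: (sK z).1.
rewrite /= exchange_big /= -[RHS]IH1; apply: eq_bigr => z _.
by rewrite -mulr_sumr (sK z).2 mulr1.
Qed.

Lemma step_law_stationary K mu T y :
  (forall y, \sum_x mu x * K x y = mu y) ->
  \sum_x mu x * step_law K x T y = mu y.
Proof.
move=> st; elim: T y => [|T IH] y /=.
  by under eq_bigr => x _ do rewrite mulrC eq_sym; rewrite sum_delta.
rewrite -[RHS]st; under [LHS]eq_bigr => x _ do rewrite mulr_sumr.
rewrite exchange_big; apply: eq_bigr => z _ /=; rewrite -IH mulr_suml.
by apply: eq_bigr => x _; rewrite mulrA.
Qed.

Lemma dTV_le1 mu nu : distribution_on mu -> distribution_on nu -> dTV mu nu <= 1.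
Proof.
move=> [m0 m1] [n0 n1]; rewrite /dTV.
apply: le_trans (_ : 2^-1 * \sum_y (mu y + nu y) <= _).
  rewrite ler_pM2l ?invr_gt0 //; apply: ler_sum => y _.
  by apply: (le_trans (ler_normB _ _)); rewrite !ger0_norm.
rewrite big_split /= m1 n1; lra.
Qed.

Lemma dTV_triangle mu nu rho : dTV mu rho <= dTV mu nu + dTV nu rho.
Proof.
rewrite /dTV -mulrDr ler_pM2l ?invr_gt0 // -big_split /=.
by apply: ler_sum => y _; rewrite ler_distD.
Qed.

Lemma dTVC mu nu : dTV mu nu = dTV nu mu.
Proof. by rewrite /dTV; congr (_ * _); apply: eq_bigr => y _; rewrite distrC. Qed.

Lemma dTVxx mu : dTV mu mu = 0.
Proof. by rewrite /dTV big1 ?mulr0 // => y _; rewrite subrr normr0. Qed.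

(** Joint convexity of total variation: using the same weights for both mixtures amounts to sharing
    the mixing variable. *)
Lemma dTV_mixture (I : finType) (w : I -> R) (m1 m2 : I -> S -> R) mu nu :
  (forall i, 0 <= w i) ->
  (forall y, mu y = \sum_i w i * m1 i y) ->
  (forall y, nu y = \sum_i w i * m2 i y) ->
  dTV mu nu <= \sum_i w i * dTV (m1 i) (m2 i).
Proof.
move=> w0 E1 E2; rewrite /dTV.
under [leRHS]eq_bigr => i _ do rewrite mulrCA mulr_sumr.
rewrite -mulr_sumr ler_pM2l ?invr_gt0 // exchange_big /=.
apply: ler_sum => y _; rewrite E1 E2 -sumrB.
apply: (le_trans (ler_norm_sum _ _ _)); apply: ler_sum => i _.
by rewrite -mulrBr normrM ger0_norm.
Qed.

(** By stationarity [mu] is the [mu]-mixture of the laws at time [T] over all starting points.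
    Starting points in [G] cost at most [e], the others at most 1 each. *)
Lemma dTV_stationary K mu x T (G : pred S) (e : R) :
  stochastic K -> distribution_on mu ->
  (forall y, \sum_x mu x * K x y = mu y) -> 0 <= e ->
  (forall y, G y -> dTV (step_law K x T) (step_law K y T) <= e) ->
  dTV (step_law K x T) mu <= e + mass mu (predC G).
Proof.
move=> sK [m0 m1] st e0 H.
apply: le_trans (_ : \sum_y mu y * dTV (step_law K x T) (step_law K y T) <= _).
  apply: dTV_mixture => // y; first by rewrite -mulr_suml m1 mul1r.
  by rewrite step_law_stationary.
rewrite (bigID G) /=; apply: lerD.
  apply: le_trans (_ : \sum_(y | G y) mu y * e <= _).
    by apply: ler_sum => y Gy; rewrite ler_wpM2l // H.
  rewrite -mulr_suml ler_piMl // -m1 [leRHS](bigID G) /= lerDl.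
  exact: sumr_ge0.
rewrite /mass; apply: ler_sum => y _; rewrite ler_piMr //.
by apply: dTV_le1; apply: step_law_distribution.
Qed.

Lemma dTV_cond_mass mu G : distribution_on mu -> 0 < mass mu G ->
  dTV mu (cond_mass mu G) = mass mu (predC G).
Proof.
move=> [m0 m1] mG; rewrite /dTV (bigID G) /=.
have E : mass mu G + mass mu (predC G) = 1 by rewrite -m1 [RHS](bigID G).
have mC : 0 <= mass mu (predC G) by apply: sumr_ge0.
have -> : \sum_(y | G y) `|mu y - cond_mass mu G y| = \sum_(y | G y) mu y * ((mass mu G)^-1 - 1).
  apply: eq_bigr => y Gy; rewrite /cond_mass Gy distrC ger0_norm.
    by rewrite mulrBr mulr1.
  rewrite subr_ge0 ler_peMr // invf_ge1 //; lra.
have -> : \sum_(y | ~~ G y) `|mu y - cond_mass mu G y| = mass mu (predC G).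
  by apply: eq_bigr => y /negbTE Gy; rewrite /cond_mass Gy subr0 ger0_norm.
rewrite -mulr_suml -/(mass mu G) mulrBr mulfV ?gt_eqF // mulr1; lra.
Qed.

(** Only the states at times [0, ..., t - 1], from which the [t] steps are taken, are required to
    lie in [G]; the final state is free. *)
Fixpoint survival K G (t : nat) (z : S) : R :=
  if t is t'.+1 then if G z then \sum_y K z y * survival K G t' y else 0 else 1.

(** Markov's inequality for [f] stopped at the exit from [G]: the expectation grows by at most [D]
    per step, and at the exit [f] is at least [L]. *)
Lemma survival_lyapunov K G f (L D : R) t z :
  stochastic K -> 0 < L -> 0 <= D -> (forall x, 0 <= f x) ->
  (forall x, G x -> \sum_y K x y * f y <= f x + D) ->
  (forall x, ~~ G x -> L <= f x) ->
  1 - (f z + t%:R * D) / L <= survival K G t z.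
Proof.
move=> sK L0 D0 f0 fG fL.
suff H : L * (1 - survival K G t z) <= f z + t%:R * D.
  by rewrite lerBlDr -lerBlDl ler_pdivlMr // mulrC.
elim: t z => [|t IH] z /=; first by rewrite subrr mulr0 mul0r addr0.
case: ifPn => [Gz|nGz]; last first.
  by rewrite subr0 mulr1 ler_wpDr ?fL // mulr_ge0.
have -> : L * (1 - \sum_y K z y * survival K G t y) =
          \sum_y K z y * (L * (1 - survival K G t y)).
  rewrite -[X in L * (X - _)](sK z).2 -sumrB mulr_sumr; apply: eq_bigr => y _; ring.
apply: le_trans (_ : \sum_y K z y * (f y + t%:R * D) <= _).
  by apply: ler_sum => y _; rewrite ler_wpM2l ?(sK z).1.
under eq_bigr => y _ do rewrite mulrDr.
rewrite big_split /= -mulr_suml (sK z).2 -natr1.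
have := fG z Gz; lra.
Qed.

(** Both chains make the same transitions as long as they stay in [G]; after an exit the trivial
    bound 1 is used. *)
Lemma dTV_survival K Q G x T : stochastic K -> stochastic Q ->
  (forall z, G z -> K z =1 Q z) ->
  dTV (step_law K x T) (step_law Q x T) <= 1 - survival K G T x.
Proof.
move=> sK sQ KQ; elim: T x => [|T IH] x; first by rewrite dTVxx subrr.
have le1 : dTV (step_law K x T.+1) (step_law Q x T.+1) <= 1.
  by apply: dTV_le1; apply: step_law_distribution.
rewrite [survival _ _ _ _]/=; case: ifP => [Gx|_]; last by rewrite subr0.
apply: le_trans (_ : \sum_z K x z * dTV (step_law K z T) (step_law Q z T) <= _).
  apply: dTV_mixture => [z|y|y]; first exact: (sK x).1.
    by rewrite step_law_first.
  by rewrite step_law_first; apply: eq_bigr => z _; rewrite KQ.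
rewrite -[X in X - _](sK x).2 -sumrB; apply: ler_sum => z _.
by rewrite -[X in X - _]mulr1 -mulrBr ler_wpM2l ?(sK x).1.
Qed.

(* The coupled chains contract as long as both stay in [G]; leaving [G] is
   paid for by the Lyapunov function [f]. *)
Lemma dTV_contraction K G f (h : S -> S -> R) (L D r : R) T x y :
  stochastic K -> 0 < L -> 0 <= D -> 0 <= r -> (forall z, 0 <= f z) ->
  (forall z, G z -> \sum_w K z w * f w <= f z + D) ->
  (forall z, ~~ G z -> L <= f z) ->
  (forall z w, 0 <= h z w) -> (forall z w, z != w -> 1 <= h z w) ->
  (forall z w, G z -> G w -> exists J : S -> S -> R,
     [/\ forall z' w', 0 <= J z' w',
         forall z', \sum_w' J z' w' = K z z',
         forall w', \sum_z' J z' w' = K w w' &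
         \sum_z' \sum_w' J z' w' * h z' w' <= r * h z w]) ->
  dTV (step_law K x T) (step_law K y T) <=
    r ^+ T * h x y + (f x + f y + T%:R * (2 * D)) / L.
Proof.
move=> sK L0 D0 r0 f0 fG fL h0 h1 HJ; elim: T x y => [|T IH] x y.
  rewrite expr0 mul1r mul0r addr0; have [->|xy] := eqVneq x y.
    by rewrite dTVxx addr_ge0 // divr_ge0 ?addr_ge0 // ltW.
  apply: le_trans (_ : 1 <= _); first by apply: dTV_le1; apply: step_law_distribution.
  by rewrite ler_wpDr ?h1 // divr_ge0 ?addr_ge0 // ltW.
have T2D : 0 <= T.+1%:R * (2 * D) by rewrite !mulr_ge0.
(* If one of the states is outside [G], its value of [f] is at least [L], so the claimed bound is at
   least 1 and holds trivially. *)
have [/andP[Gx Gy]|nG] := boolP (G x && G y); last first.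
  apply: le_trans (_ : 1 <= _); first by apply: dTV_le1; apply: step_law_distribution.
  rewrite ler_wpDl ?mulr_ge0 ?exprn_ge0 // ler_pdivlMr // mul1r.
  have := f0 x; have := f0 y.
  by move: nG; rewrite negb_and => /orP[/fL|/fL]; lra.
have [J [J0 J1 J2 Jh]] := HJ x y Gx Gy.
apply: le_trans (_ : \sum_(p : S * S) J p.1 p.2 * dTV (step_law K p.1 T) (step_law K p.2 T) <= _).
  apply: dTV_mixture => [p|z|z] //.
    rewrite step_law_first -(pair_big predT predT (fun a b => J a b * step_law K a T z)) /=.
    by apply: eq_bigr => w _; rewrite -mulr_suml J1.
  rewrite step_law_first -(pair_big predT predT (fun a b => J a b * step_law K b T z)) exchange_big /=.
  by apply: eq_bigr => w _; rewrite -mulr_suml J2.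
rewrite -(pair_big predT predT (fun a b => J a b * dTV (step_law K a T) (step_law K b T))) /=.
apply: le_trans (_ : \sum_z \sum_w J z w * (r ^+ T * h z w + (f z + f w + T%:R * (2 * D)) / L) <= _).
  by apply: ler_sum => z _; apply: ler_sum => w _; rewrite ler_wpM2l.
have -> : \sum_z \sum_w J z w * (r ^+ T * h z w + (f z + f w + T%:R * (2 * D)) / L) =
  r ^+ T * (\sum_z \sum_w J z w * h z w) +
  (\sum_z K x z * f z + \sum_w K y w * f w + T%:R * (2 * D)) / L.
  set c := T%:R * (2 * D).
  have Ec : c = \sum_z \sum_w J z w * c.
    under eq_bigr => z _ do rewrite -mulr_suml J1.
    by rewrite -mulr_suml (sK x).2 mul1r.
  rewrite [in RHS]Ec.
  have -> : \sum_z K x z * f z = \sum_z \sum_w J z w * f z.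
    by apply: eq_bigr => z _; rewrite -mulr_suml J1.
  have -> : \sum_w K y w * f w = \sum_z \sum_w J z w * f w.
    by rewrite exchange_big; apply: eq_bigr => z _; rewrite -mulr_suml J2.
  rewrite -!big_split /= mulr_sumr mulr_suml -big_split /=; apply: eq_bigr => z _.
  rewrite -!big_split /= mulr_sumr mulr_suml -big_split /=; apply: eq_bigr => w _.
  by ring.
apply: lerD; first by rewrite exprSr -mulrA ler_wpM2l ?exprn_ge0.
rewrite ler_pM2r ?invr_gt0 // -natr1.
have := fG x Gx; have := fG y Gy; lra.
Qed.

End FiniteKernels.

(** * Coupling two kernels that agree on a set *)

Section SurvivalCoupling.
Variables (R : realType) (S : finType) (K Q : S -> S -> R) (G : pred S).
Hypotheses (sK : stochastic K) (sQ : stochastic Q).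
Hypothesis KQ : forall z, G z -> K z =1 Q z.

(** The two copies move together as long as they coincide inside [G], and independently otherwise.
    The second marginal is correct because the two kernels agree on [G]. *)
Definition joint_kernel (p q : S * S) : R :=
  if (p.1 == p.2) && G p.1 then (q.1 == q.2)%:R * K p.1 q.1
  else K p.1 q.1 * Q p.2 q.2.

Lemma joint_kernel_fst p (z : S) : \sum_w joint_kernel p (z, w) = K p.1 z.
Proof.
rewrite /joint_kernel; case: (_ && _) => /=; last by rewrite -mulr_sumr (sQ p.2).2 mulr1.
rewrite (bigD1 z) //= eqxx mul1r big1 ?addr0 // => w wz.
by rewrite eq_sym (negbTE wz) mul0r.
Qed.

Lemma joint_kernel_snd p (w : S) : \sum_z joint_kernel p (z, w) = Q p.2 w.
Proof.
rewrite /joint_kernel; have [/andP[/eqP E Gp]|_] /= := boolP ((p.1 == p.2) && G p.1).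
  by rewrite (sum_delta (K p.1)) KQ // E.
by rewrite -mulr_suml (sK p.1).2 mul1r.
Qed.

Lemma sum_pairE (F : S * S -> R) : \sum_p F p = \sum_z \sum_w F (z, w).
Proof. by rewrite (pair_big predT predT (fun z w => F (z, w))); apply: eq_bigr => -[]. Qed.

Lemma stochastic_joint : stochastic joint_kernel.
Proof.
move=> p; split=> [q|].
  have K0 := (sK p.1).1 q.1; have Q0 := (sQ p.2).1 q.2.
  by rewrite /joint_kernel; case: ifP => _; exact: mulr_ge0.
rewrite sum_pairE; under eq_bigr => z _ do rewrite joint_kernel_fst.
by rewrite (sK p.1).2.
Qed.

(** Prescribing the path of one coordinate leaves the other one free; summing it out at every step
    reproduces the path probability of [K]. This shows that the first coordinate is a Markov chain
    in the required sense. *)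
Lemma joint_fst_path (a : nat -> S) s j p : p.1 = a s ->
  stay_prob joint_kernel (fun t q => q.1 == a t) s j p =
  \prod_(t < j) K (a (s + t)%N) (a (s + t).+1).
Proof.
elim: j s p => [|j IH] s p E /=; first by rewrite big_ord0.
rewrite big_mkcond sum_pairE /= (bigD1 (a s.+1)) //= [X in _ + X]big1 ?addr0; last first.
  by move=> z /negbTE za; rewrite big1 // => w _; rewrite za.
rewrite eqxx big_ord_recl addn0 -E -joint_kernel_fst mulr_suml.
apply: eq_bigr => w _; congr (_ * _); rewrite IH //.
by apply: eq_bigr => t _; rewrite addSnnS.
Qed.

Lemma joint_snd_path (a : nat -> S) s j p : p.2 = a s ->
  stay_prob joint_kernel (fun t q => q.2 == a t) s j p =
  \prod_(t < j) Q (a (s + t)%N) (a (s + t).+1).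
Proof.
elim: j s p => [|j IH] s p E /=; first by rewrite big_ord0.
rewrite big_mkcond sum_pairE exchange_big /= (bigD1 (a s.+1)) //= [X in _ + X]big1 ?addr0; last first.
  by move=> z /negbTE za; rewrite big1 // => w _; rewrite za.
rewrite eqxx big_ord_recl addn0 -E -joint_kernel_snd mulr_suml.
apply: eq_bigr => w _; congr (_ * _); rewrite IH //.
by apply: eq_bigr => t _; rewrite addSnnS.
Qed.

(** From a diagonal point inside [G] the joint kernel stays on the diagonal, so an exit from [G]
    before the last step is the only way to separate. *)
Lemma joint_diag_survival s j z :
  survival K G j z <= stay_prob joint_kernel (fun _ q => q.1 == q.2) s j (z, z).
Proof.
elim: j s z => [|j IH] s z //=.
have J0 p q : 0 <= joint_kernel p q by apply: (stochastic_joint p).1.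
have st0 t i p : 0 <= stay_prob joint_kernel (fun _ q => q.1 == q.2) t i p.
  elim: i t p => [|i IHi] t p //=; apply: sumr_ge0 => q _; exact: mulr_ge0.
case: ifP => [Gz|_]; last by apply: sumr_ge0 => q _; apply: mulr_ge0.
rewrite [leRHS]big_mkcond sum_pairE; apply: ler_sum => y _ /=.
rewrite (bigD1 y) //= eqxx [X in _ + X]big1 ?addr0; last first.
  by move=> w wy; rewrite eq_sym (negbTE wy).
by rewrite {1}/joint_kernel /= !eqxx Gz mul1r ler_wpM2l //; exact: (sK z).1.
Qed.

Lemma survival_coupled_until x T (q : R) :
  q <= survival K G T x -> coupled_until K Q x T q.
Proof.
move=> qs.
have [d [W [Pr [Z HZ]]]] := markov_chain_exists (x, x)
  (fun p => (stochastic_joint p).1) (fun p => (stochastic_joint p).2).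
have all A m := chain_all_prob A m HZ.
exists d, W, Pr, (fun t w => (Z t w).1), (fun t w => (Z t w).2).
have meas (P : pred (S * S)) t : measurable [set w | P (Z t w)]%classic.
  have -> : [set w | P (Z t w)]%classic =
    (\bigcup_(p in [set` P]) [set w | Z t w = p])%classic.
    apply/seteqP; split=> w /=; first by move=> Pw; exists (Z t w).
    by move=> [p Pp] ->.
  apply: fin_bigcup_measurable => [|p _]; [exact: finite_finset|exact: HZ.1].
split.
- split=> [t y|m a].
    have := meas (fun p => p.1 == y) t; congr measurable.
    by apply/seteqP; split=> w /= /eqP.
  have [_] := all (fun t p => p.1 == a t) m.
  have -> : [set w | forall t, (t <= m)%N -> (Z t w).1 == a t]%classic =
    [set w | forall t, (t <= m)%N -> (Z t w).1 = a t]%classic.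
    by apply/seteqP; split=> w /= H t tm; apply/eqP; apply: H.
  move=> ->; rewrite eq_sym; have [E|] := eqVneq (a 0%N) x; last by rewrite !mul0r.
  by rewrite (joint_fst_path (a := a)).
- split=> [t y|m a].
    have := meas (fun p => p.2 == y) t; congr measurable.
    by apply/seteqP; split=> w /= /eqP.
  have [_] := all (fun t p => p.2 == a t) m.
  have -> : [set w | forall t, (t <= m)%N -> (Z t w).2 == a t]%classic =
    [set w | forall t, (t <= m)%N -> (Z t w).2 = a t]%classic.
    by apply/seteqP; split=> w /= H t tm; apply/eqP; apply: H.
  move=> ->; rewrite eq_sym; have [E|] := eqVneq (a 0%N) x; last by rewrite !mul0r.
  by rewrite (joint_snd_path (a := a)).
have [_] := all (fun _ p => p.1 == p.2) T.
have -> : [set w | forall t, (t <= T)%N -> (Z t w).1 == (Z t w).2]%classic =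
    [set w | forall t, (t <= T)%N -> (Z t w).1 = (Z t w).2]%classic.
  by apply/seteqP; split=> w /= H t tm; apply/eqP; apply: H.
move=> ->; rewrite eqxx mul1r lee_fin; apply: le_trans qs _.
exact: joint_diag_survival.
Qed.

End SurvivalCoupling.

(** * Edge degrees, vertex degrees and the effect of a swap *)

Section EdgeCombinatorics.
Variables (R : realType) (n : nat).
Implicit Types (X Y : graph n) (e f s t : edge n) (v w : 'I_n).

Lemma card_edge : #|{: edge n}| = 'C(n, 2).
Proof.
rewrite card_sig -[X in 'C(X, _)]card_ord -card_draws; apply: eq_card => A.
by rewrite !inE.
Qed.

Lemma card_val_edge e : #|val e| = 2%N.
Proof. exact/eqP/(valP e). Qed.

Lemma edge_adjC f e : edge_adj f e = edge_adj e f.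
Proof. by rewrite /edge_adj eq_sym finset.setIC. Qed.

Lemma edge_adjxx e : edge_adj e e = false.
Proof. by rewrite /edge_adj eqxx. Qed.

(** Two edge-positions share 0, 1 or 2 vertices. This identity converts sums over vertices into sums
    over adjacent edges. *)
Lemma card_edgeI f e : #|val f :&: val e| = (edge_adj f e + 2 * (f == e))%N.
Proof.
rewrite /edge_adj; have [->|fe] /= := eqVneq f e.
  by rewrite finset.setIid card_val_edge.
rewrite muln0 addn0; have [->|ne0] := eqVneq (val f :&: val e) finset.set0.
  by rewrite cards0.
apply/eqP; rewrite eqn_leq card_gt0 ne0 andbT leqNgt; apply: contraNN fe => h.
rewrite -val_eqE eqEcard !card_val_edge leqnn andbT.
have /eqP <- : val f :&: val e == val f; last exact: finset.subsetIr.
by rewrite eqEcard finset.subsetIl card_val_edge.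
Qed.

Lemma card_edges_through2 v w : v != w ->
  #|[pred e : edge n | (v \in val e) && (w \in val e)]| = 1%N.
Proof.
move=> vw; have c2 : #|[set v; w]%SET| == 2%N by rewrite cards2 vw.
apply/eqP/card1P; exists (Sub [set v; w]%SET c2 : edge n) => e; rewrite !inE.
apply/andP/eqP => [[ve we]|->]; last by rewrite /= !inE !eqxx orbT.
apply/val_inj/esym/eqP; rewrite eqEcard /= card_val_edge cards2 vw andbT.
by apply/fintype.subsetP => u; rewrite !inE => /orP[]/eqP->.
Qed.

(** Counting pairs of an edge through [v] and its other endpoint [w]: every [w] different from [v]
    determines exactly one edge. *)
Lemma card_edges_through v : #|[pred e : edge n | v \in val e]| = n.-1.
Proof.
have : (\sum_(w | w != v) #|[pred e : edge n | (v \in val e) && (w \in val e)]| =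
       \sum_(e : edge n | v \in val e) 1)%N.
  under eq_bigr => w _ do rewrite -sum1_card big_mkcond /=.
  rewrite exchange_big [RHS]big_mkcond /=; apply: eq_bigr => e _.
  case: ifPn => ve; last by rewrite big1 // => w _; rewrite inE (negbTE ve).
  under eq_bigr => w _ do rewrite inE ve /=.
  rewrite -big_mkcondr sum1_card /=.
  have -> : #|[pred w | (w != v) && (w \in val e)]| = #|val e :\ v|.
    by apply: eq_card => w; rewrite !inE.
  by have := cardsD1 v (val e); rewrite ve card_val_edge => -[].
rewrite (eq_bigr (fun=> 1%N)) => [|w wv]; last by rewrite card_edges_through2 // eq_sym.
rewrite !sum1_card => H; rewrite -[LHS]H.
have -> : #|[pred w : 'I_n | w != v]| = #|predC1 v| by apply: eq_card.
by have := cardC1 v; rewrite card_ord.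
Qed.

Definition adj f e : R := (edge_adj f e)%:R.
Definition edg X e : R := (X e)%:R.
Definition edeg X e : R := (edge_deg e X)%:R.
Definition degR X v : R := (deg X v)%:R.

Lemma adjC f e : adj f e = adj e f. Proof. by rewrite /adj edge_adjC. Qed.
Lemma adjxx e : adj e e = 0. Proof. by rewrite /adj edge_adjxx. Qed.
Lemma adj_ge0 f e : 0 <= adj f e. Proof. by rewrite /adj. Qed.
Lemma adj_le1 f e : adj f e <= 1. Proof. by rewrite /adj; case: edge_adj. Qed.
Lemma edg_ge0 X e : 0 <= edg X e. Proof. by rewrite /edg. Qed.
Lemma edg_le1 X e : edg X e <= 1. Proof. by rewrite /edg; case: (X e). Qed.

Lemma card_natr (T : finType) (P : pred T) : (#|P|)%:R = \sum_x (P x)%:R :> R.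
Proof.
by rewrite -sum1_card natr_sum big_mkcond /=; apply: eq_bigr => x _; rewrite unfold_in; case: (P x).
Qed.

Lemma edegE X e : edeg X e = \sum_f edg X f * adj f e.
Proof.
by rewrite /edeg /edge_deg card_natr; apply: eq_bigr => f _ /=; rewrite -natrM mulnb.
Qed.

Lemma degRE X v : degR X v = \sum_e edg X e * (v \in val e)%:R.
Proof.
by rewrite /degR /deg card_natr; apply: eq_bigr => f _ /=; rewrite -natrM mulnb.
Qed.

Lemma nedgesE X : (nedges X)%:R = \sum_e edg X e :> R.
Proof. by rewrite /nedges card_natr. Qed.

Lemma sum_edgeI f e : \sum_(v : 'I_n) (v \in val f)%:R * (v \in val e)%:R =
  adj f e + 2 * (f == e)%:R.
Proof.
rewrite /adj -natrM -natrD -card_edgeI card_natr; apply: eq_bigr => v _.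
by rewrite -natrM mulnb; congr (_%:R); rewrite -finset.in_setI.
Qed.

Lemma sum_deg_edge X e : \sum_(v in val e) degR X v = edeg X e + 2 * edg X e.
Proof.
rewrite big_mkcond /= (eq_bigr (fun v => \sum_f edg X f * ((v \in val f)%:R * (v \in val e)%:R))); last first.
  move=> v _; case: ifP => ve; last by rewrite big1 // => f _; rewrite mulr0 mulr0.
  by rewrite degRE; apply: eq_bigr => f _; rewrite mulr1.
rewrite exchange_big /=; under eq_bigr => f _ do rewrite -mulr_sumr sum_edgeI mulrDr.
rewrite big_split /= -edegE; congr (_ + _).
rewrite (bigD1 e) //= eqxx mulr1 big1 ?addr0; first by rewrite mulrC.
by move=> f /negbTE->; rewrite !mulr0.
Qed.

Lemma sum_deg X : \sum_v degR X v = 2 * (nedges X)%:R.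
Proof.
under eq_bigr => v _ do rewrite degRE.
rewrite exchange_big /= nedgesE mulr_sumr; apply: eq_bigr => e _.
rewrite -mulr_sumr -card_natr.
have -> : #|(fun v => v \in val e)| = 2%N by rewrite -[RHS](card_val_edge e); apply: eq_card.
by rewrite mulrC.
Qed.

Lemma sum_deg2 X : \sum_v degR X v ^+ 2 = \sum_e edg X e * (edeg X e + 2).
Proof.
under eq_bigr => v _ do rewrite expr2 {1}degRE mulr_suml.
rewrite exchange_big /=; apply: eq_bigr => e _.
have -> : edg X e * (edeg X e + 2) = edg X e * (edeg X e + 2 * edg X e).
  by rewrite /edg; case: (X e); rewrite ?mul0r ?mulr1.
rewrite -sum_deg_edge [in RHS]big_mkcond mulr_sumr; apply: eq_bigr => v _.
by case: (v \in val e); rewrite ?mulr1 ?mulr0 ?mul0r.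
Qed.

Lemma sum_bin_deg X : \sum_(v < n) 'C(deg X v, 2)%:R = 2^-1 * \sum_e edg X e * edeg X e.
Proof.
have H (d : nat) : 'C(d, 2)%:R = 2^-1 * (d%:R ^+ 2 - d%:R) :> R.
  elim: d => [|d IH]; first by rewrite bin0n /= expr2 mulr0 subr0 mulr0.
  by rewrite binS bin1 natrD IH -natr1; field.
under eq_bigr => v _ do rewrite H.
rewrite -mulr_sumr sumrB sum_deg2 sum_deg; congr (_ * _).
under eq_bigr => e _ do rewrite mulrDr.
by rewrite big_split /= -mulr_suml -nedgesE mulrC addrK.
Qed.

(** The pairs of edges meeting at a vertex, summed over the vertices, are the adjacent pairs of
    edges, each counted twice by the sum over [e]. In this quadratic form the effect of a swap is
    explicit. *)
Lemma hamiltonianE (beta : R) X :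
  hamiltonian beta X = beta / n%:R * \sum_e edg X e * edeg X e.
Proof.
rewrite /hamiltonian sum_bin_deg mulrA; congr (_ * _); rewrite -!mulrA mulrCA.
by congr (_ * _); rewrite mulrCA mulfV // mulr1.
Qed.

Lemma hamiltonian_degE (beta : R) X :
  hamiltonian beta X = beta / n%:R * (\sum_v degR X v ^+ 2 - 2 * (nedges X)%:R).
Proof.
rewrite hamiltonianE sum_deg2; congr (_ * _).
under [in RHS]eq_bigr => e _ do rewrite mulrDr.
by rewrite big_split /= -mulr_suml -nedgesE [2 * _]mulrC addrK.
Qed.

Lemma sum_adj e : \sum_f adj f e = 2 * (n%:R - 2).
Proof.
have n0 : (0 < n)%N.
  have : (0 < #|val e|)%N by rewrite card_val_edge.
  by case/card_gt0P => v _; case: n v => // -[].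
have : \sum_(f : edge n) \sum_(v : 'I_n) (v \in val f)%:R * (v \in val e)%:R =
   \sum_f (adj f e + 2 * (f == e)%:R).
  by apply: eq_bigr => f _; rewrite sum_edgeI.
have d : \sum_(f : edge n) (f == e)%:R = 1 :> R.
  by rewrite (bigD1 e) //= eqxx big1 ?addr0 // => f /negbTE->.
rewrite exchange_big big_split /= -mulr_sumr d.
under eq_bigr => v _ do rewrite -mulr_suml -card_natr card_edges_through.
rewrite -mulr_sumr -card_natr.
have -> : #|(fun v => v \in val e)| = 2%N by rewrite -[RHS](card_val_edge e); apply: eq_card.
have -> : n.-1%:R = n%:R - 1 :> R by rewrite -[in RHS](prednK n0) -natr1 addrK.
lra.
Qed.

Section Swap.
Variables (X : graph n) (s t : edge n).
Hypotheses (Xs : X s) (Xt : ~~ X t).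

Lemma swap_neq : s != t.
Proof. by apply: contraNneq Xt => <-. Qed.

Lemma edg_swap e : edg (swap X s t) e = edg X e - (e == s)%:R + (e == t)%:R.
Proof.
rewrite /edg ffunE; have [->|es] := eqVneq e s.
  by rewrite Xs (negbTE swap_neq) subrr add0r.
have [->|et] := eqVneq e t; last by rewrite subr0 addr0.
by rewrite (negbTE Xt) subr0 add0r.
Qed.

Lemma nedges_swap : nedges (swap X s t) = nedges X.
Proof.
apply/eqP; rewrite -(eqr_nat R) !nedgesE.
under eq_bigr => e _ do rewrite edg_swap.
rewrite big_split sumrB /=.
have d u : \sum_(e : edge n) (e == u)%:R = 1 :> R.
  by rewrite (bigD1 u) //= eqxx big1 ?addr0 // => e /negbTE->.
by rewrite !d subrK.
Qed.

Lemma edeg_swap e : edeg (swap X s t) e = edeg X e - adj s e + adj t e.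
Proof.
rewrite !edegE; under eq_bigr => f _ do rewrite edg_swap mulrDl mulrBl.
by rewrite big_split sumrB /= !(sum_delta (fun f => adj f e)).
Qed.

Lemma degR_swap v :
  degR (swap X s t) v = degR X v - (v \in val s)%:R + (v \in val t)%:R.
Proof.
rewrite !degRE; under eq_bigr => f _ do rewrite edg_swap mulrDl mulrBl.
by rewrite big_split sumrB /= !(sum_delta (fun f => (v \in val f)%:R)).
Qed.

Lemma swapK : swap (swap X s t) t s = X.
Proof.
apply/ffunP => e; rewrite !ffunE; have [->|et] := eqVneq e t.
  by rewrite (negbTE Xt).
by have [->|es] := eqVneq e s; rewrite ?Xs.
Qed.

Lemma swap_s : ~~ swap X s t s. Proof. by rewrite ffunE eqxx. Qed.
Lemma swap_t : swap X s t t.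
Proof. by rewrite ffunE eq_sym (negbTE swap_neq) eqxx. Qed.

(** The added edge [t] gains the neighbours it has once [s] has been deleted, which explains the
    correction [adj s t]; the deleted edge loses its own neighbours. *)
Lemma hamiltonian_swap (beta : R) : hamiltonian beta (swap X s t) =
  hamiltonian beta X + 2 * beta / n%:R * (edeg X t - adj s t - edeg X s).
Proof.
rewrite !hamiltonianE.
have -> : \sum_e edg (swap X s t) e * edeg (swap X s t) e =
  \sum_e edg X e * edeg X e + 2 * (edeg X t - adj s t - edeg X s).
  under eq_bigr => e _ do rewrite edg_swap mulrDl mulrBl.
  rewrite big_split sumrB /= !(sum_delta (edeg (swap X s t))) !edeg_swap !adjxx.
  under eq_bigr => e _ do rewrite edeg_swap mulrDr mulrBr.
  rewrite big_split sumrB /=.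
  under [\sum_i edg X i * adj s i]eq_bigr => e _ do rewrite adjC.
  under [\sum_i edg X i * adj t i]eq_bigr => e _ do rewrite adjC.
  rewrite -!edegE [adj t s]adjC; ring.
ring.
Qed.

End Swap.

Lemma edeg_le X e : edeg X e <= 2 * n%:R.
Proof.
rewrite edegE; apply: le_trans (_ : \sum_f adj f e <= _).
  by apply: ler_sum => f _; rewrite ler_piMl ?adj_ge0 ?edg_le1.
by rewrite sum_adj; lra.
Qed.

End EdgeCombinatorics.

(** * Acceptance probabilities and the Kawasaki kernel *)

Section Sigmoid.
Variable R : realType.
Implicit Types a b z : R.

Definition sigmoid z : R := (1 + expR (- z))^-1.

Lemma sigmoid_gt0 z : 0 < sigmoid z.
Proof. by rewrite invr_gt0 addr_gt0 ?expR_gt0. Qed.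

Lemma sigmoid_le1 z : sigmoid z <= 1.
Proof. by rewrite invf_le1 ?lerDl ?expR_ge0 // addr_gt0 ?expR_gt0. Qed.

Lemma sigmoid0 : sigmoid 0 = 2^-1.
Proof. by rewrite /sigmoid oppr0 expR0. Qed.

Lemma sigmoidE a b : expR b / (expR a + expR b) = sigmoid (b - a).
Proof.
rewrite /sigmoid opprB expRD expRN; field.
by rewrite !gt_eqF ?expR_gt0 // addr_gt0 ?expR_gt0.
Qed.

Lemma is_derive_sigmoid z : is_derive z 1 sigmoid (sigmoid z * (1 - sigmoid z)).
Proof.
have pos : 0 < 1 + expR (- z) by rewrite addr_gt0 ?expR_gt0.
have H1 : is_derive z 1 (cst 1 + (fun x : R => expR (- x))) (0 + - expR (- z)).
  by have := @is_derive_expRN R z; apply: is_deriveD.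
have ne : (cst 1 + (fun x : R => expR (- x))) z != 0 by rewrite gt_eqF.
have -> : sigmoid z * (1 - sigmoid z) =
   - ((1 + expR (- z)) ^- 2) *: (0 + - expR (- z)).
  by rewrite /sigmoid /GRing.scale /=; field; rewrite gt_eqF.
exact: (is_deriveV ne H1).
Qed.

(** The derivative is [s (1 - s)], at most [1 / 4]. This constant is the origin of the threshold in
    [4 beta p (1 - p) < 1 / 2]. *)
Lemma sigmoid_lip a b : `|sigmoid a - sigmoid b| <= `|a - b| / 4.
Proof.
suff main x y : x < y -> `|sigmoid y - sigmoid x| <= `|y - x| / 4.
  have [ab|ba|->] := ltgtP a b; last by rewrite !subrr normr0 mul0r.
    by rewrite distrC [`|a - b|]distrC main.
  exact: main.
move=> xy; have [c _ ->] := derive_mvt xy is_derive_sigmoid.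
rewrite normrM mulrC ler_pM2l ?normr_gt0 ?subr_eq0 ?gt_eqF //.
have s0 := sigmoid_gt0 c; have s1 := sigmoid_le1 c.
rewrite ger0_norm ?mulr_ge0 ?(ltW s0) ?subr_ge0 //.
have := sqr_ge0 (sigmoid c - 2^-1); rewrite expr2; nra.
Qed.

Lemma sigmoid_ge z b : `|z| <= b -> 2^-1 - b / 4 <= sigmoid z.
Proof.
move=> zb; have := sigmoid_lip z 0; rewrite sigmoid0 subr0 => H.
have := ler_norm (- (sigmoid z - 2^-1)); rewrite normrN; lra.
Qed.

Lemma sigmoid_le z b : `|z| <= b -> sigmoid z <= 2^-1 + b / 4.
Proof.
move=> zb; have := sigmoid_lip z 0; rewrite sigmoid0 subr0 => H.
have := ler_norm (sigmoid z - 2^-1); lra.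
Qed.

End Sigmoid.

(* Locked: the unifier must not compare swapped configurations by computation. *)
HB.lock Definition swapO n k (x : Omega n k) (p : edge n * edge n) : Omega n k :=
  insubd x (swap (val x) p.1 p.2).

Section KawasakiKernel.
Variables (R : realType) (n k : nat) (beta : R).
Hypotheses (k_gt0 : (0 < k)%N) (k_lt : (k < 'C(n, 2))%N).
Implicit Types (x y z : Omega n k) (s t e : edge n) (p : edge n * edge n).

Definition swappable (X : graph n) p := X p.1 && ~~ X p.2.

Lemma nedges_val x : nedges (val x) = k. Proof. exact/eqP/(valP x). Qed.

Lemma val_swapO x p : swappable (val x) p ->
  val (swapO x p) = swap (val x) p.1 p.2.
Proof.
by move=> /andP[xs xt]; rewrite swapO.unlock val_insubd nedges_swap // nedges_val eqxx.
Qed.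

Definition pair_rate : R := (k%:R * ('C(n, 2)%:R - k%:R))^-1.

Definition swap_energy (X : graph n) p : R :=
  2 * beta / n%:R * (edeg R X p.2 - adj R p.1 p.2 - edeg R X p.1).

Definition accept (X : graph n) p : R := sigmoid (swap_energy X p).

Lemma pair_rate_gt0 : 0 < pair_rate.
Proof. by rewrite invr_gt0 mulr_gt0 ?ltr0n // subr_gt0 ltr_nat. Qed.

Lemma mu_denom_gt0 : 0 < \sum_(y : Omega n k) expR (hamiltonian beta (val y)) \/
  (forall x : Omega n k, False).
Proof.
have [x0|no] := pickP (@predT (Omega n k)); last by right=> x; have := no x.
left; rewrite (bigD1 x0) //=.
by rewrite ltr_pwDl ?expR_gt0 // sumr_ge0 // => y _; rewrite expR_ge0.
Qed.

Lemma mu_denom x : 0 < \sum_(y : Omega n k) expR (hamiltonian beta (val y)).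
Proof. by case: mu_denom_gt0 => // /(_ x). Qed.

Lemma mu_gt0 x : 0 < mu beta x.
Proof. by rewrite divr_gt0 ?expR_gt0 ?mu_denom. Qed.

Lemma mu_distribution x : distribution_on (@mu R n k beta).
Proof.
split=> [y|]; first exact/ltW/mu_gt0.
by rewrite -mulr_suml mulfV // gt_eqF ?mu_denom.
Qed.

Lemma mu_ratio x y : mu beta y / (mu beta x + mu beta y) =
  sigmoid (hamiltonian beta (val y) - hamiltonian beta (val x)).
Proof.
rewrite -sigmoidE /mu; have d0 := mu_denom x.
field; rewrite !gt_eqF ?expR_gt0 // ?addr_gt0 ?expR_gt0 //.
Qed.

Lemma mu_ratio_swap x p : swappable (val x) p ->
  mu beta (swapO x p) / (mu beta x + mu beta (swapO x p)) = accept (val x) p.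
Proof.
move=> xp; rewrite mu_ratio val_swapO //; case/andP: xp => xs xt.
by rewrite hamiltonian_swap // addrC addKr.
Qed.

Lemma card_swappable x :
  \sum_(p | swappable (val x) p) pair_rate = 1.
Proof.
have Ec : #|[pred p | swappable (val x) p]| = (k * ('C(n, 2) - k))%N.
  transitivity #|predX [pred s | val x s] [pred t | ~~ val x t]|.
    by apply: eq_card => -[s t].
  rewrite cardX; congr (_ * _)%N; first by rewrite -[RHS](nedges_val x).
  rewrite -card_edge -[X in (_ - X)%N](nedges_val x) /nedges -(cardC [pred e | val x e]) addKn.
  by apply: eq_card.
transitivity (pair_rate *+ #|[pred p | swappable (val x) p]|).
  by rewrite -sumr_const; apply: eq_bigl.
rewrite Ec /pair_rate -[LHS]mulr_natl natrM natrB ?(ltnW k_lt) // mulfV // gt_eqF //.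
by rewrite mulr_gt0 ?ltr0n // subr_gt0 ltr_nat.
Qed.

(** From a fixed graph the deleted and the added edge can be read off the result, so every neighbour
    comes from exactly one proposal. *)
Lemma swapO_inj x p q : swappable (val x) p -> swappable (val x) q ->
  swapO x p = swapO x q -> p = q.
Proof.
move=> xp xq /(congr1 val); rewrite (val_swapO xp) (val_swapO xq) => E.
case/andP: xp xq E => xs xt /andP[xs' xt'] E.
case: p q xs xt xs' xt' E => [s t] [s' t'] /= xs xt xs' xt' E.
move: (congr1 (fun X : graph n => X s) E) (congr1 (fun X : graph n => X t) E).
rewrite /swap !ffunE !eqxx [t == s]eq_sym.
rewrite (negbTE (swap_neq xs xt)) xs (negbTE xt).
case: (s =P s') => [<- _|_]; last by case: (s == t').
case: (t =P s) => [ts|_]; first by rewrite ts xs in xt.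
by case: (t =P t') => [->|].
Qed.

Lemma swapO_neq x p : swappable (val x) p -> swapO x p != x.
Proof.
move=> xp; apply/eqP => /(congr1 (fun z => val z p.1)); rewrite val_swapO //.
by case/andP: xp => xs _; rewrite ffunE eqxx xs.
Qed.

Lemma is_swapP x y :
  reflect (exists2 p, swappable (val x) p & y = swapO x p) (is_swap x y).
Proof.
apply: (iffP existsP) => [[s /existsP[t /and3P[xs xt /eqP E]]]|[[s t] xp E]].
  have xp : swappable (val x) (s, t) by rewrite /swappable xs.
  by exists (s, t) => //; apply/val_inj; rewrite val_swapO.
exists s; apply/existsP; exists t; rewrite E val_swapO // eqxx andbT.
by case/andP: xp => -> ->.
Qed.

Lemma kawasaki_rateE x y : kawasaki_rate beta x y =
  \sum_(p | swappable (val x) p) pair_rate * accept (val x) p * (y == swapO x p)%:R.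
Proof.
rewrite /kawasaki_rate; case: is_swapP => [[q xq ->]|no].
  rewrite (mu_ratio_swap xq) (bigD1 q xq) /= eqxx mulr1 big1 ?addr0; first by [].
  move=> p /andP[xp pq].
  have -> : (swapO x q == swapO x p) = false; last by rewrite mulr0.
  by apply/eqP => /swapO_inj E; rewrite E ?eqxx in pq.
rewrite big1 // => p xp; case: eqP => [E|]; last by rewrite mulr0.
by exfalso; apply: no; exists p.
Qed.

(** The kernel as a proposal chain: a swappable pair is drawn uniformly and accepted with
    probability [accept]. All drift and coupling computations are averages over proposals. *)
Lemma kawasakiE x y : kawasaki beta x y =
  \sum_(p | swappable (val x) p) pair_rate *
    (accept (val x) p * (y == swapO x p)%:R + (1 - accept (val x) p) * (y == x)%:R).
Proof.
have ne z : z != x -> \sum_(p | swappable (val x) p) pair_rate *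
    (accept (val x) p * (z == swapO x p)%:R + (1 - accept (val x) p) * (z == x)%:R)
    = kawasaki_rate beta x z.
  move=> zx; rewrite kawasaki_rateE; apply: eq_bigr => p _.
  by rewrite (negbTE zx) mulr0 addr0 mulrA.
rewrite /kawasaki; have [->|yx] := eqVneq y x; last by rewrite -(ne _ yx) (negbTE yx).
under eq_bigr => z zx do rewrite -ne //.
rewrite exchange_big /=; rewrite -{1}(card_swappable x) -sumrB.
apply: eq_bigr => p xp; rewrite -mulr_sumr -[X in X - _]mulr1 -mulrBr; congr (_ * _).
rewrite (bigD1 (swapO x p)) ?swapO_neq //= eqxx mulr1 (negbTE (swapO_neq xp)) mulr0 addr0.
rewrite eq_sym (negbTE (swapO_neq xp)) mulr0 add0r mulr1 big1 ?addr0 //.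
by move=> z /andP[zx zp]; rewrite (negbTE zx) (negbTE zp) !mulr0 addr0.
Qed.

Lemma accept_ge0 X p : 0 <= accept X p. Proof. exact/ltW/sigmoid_gt0. Qed.
Lemma accept_le1 X p : accept X p <= 1. Proof. exact: sigmoid_le1. Qed.

Lemma kawasaki_expect x (phi : Omega n k -> R) :
  \sum_y kawasaki beta x y * phi y = phi x +
  \sum_(p | swappable (val x) p) pair_rate * accept (val x) p * (phi (swapO x p) - phi x).
Proof.
under [LHS]eq_bigr => y _ do rewrite kawasakiE mulr_suml.
have -> : phi x + \sum_(p | swappable (val x) p)
    pair_rate * accept (val x) p * (phi (swapO x p) - phi x) =
  \sum_(p | swappable (val x) p) (pair_rate * phi x +
    pair_rate * accept (val x) p * (phi (swapO x p) - phi x)).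
  by rewrite big_split /= -mulr_suml card_swappable mul1r.
rewrite exchange_big /=.
apply: eq_bigr => p _.
under eq_bigr => y _ do rewrite -mulrA mulrDl -!mulrA.
rewrite -mulr_sumr big_split /= -!mulr_sumr !(sum_delta phi); ring.
Qed.

Lemma stochastic_kawasaki : stochastic (@kawasaki R n k beta).
Proof.
move=> x; split=> [y|].
  rewrite kawasakiE; apply: sumr_ge0 => p _; rewrite mulr_ge0 ?(ltW pair_rate_gt0) //.
  by rewrite addr_ge0 ?mulr_ge0 ?accept_ge0 ?subr_ge0 ?accept_le1.
have := kawasaki_expect x (fun=> 1).
under eq_bigr => y _ do rewrite mulr1.
move=> ->; rewrite big1 ?addr0 // => p _; by rewrite subrr mulr0.
Qed.

Lemma is_swapC x y : is_swap x y = is_swap y x.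
Proof.
have main (u v : Omega n k) : is_swap u v -> is_swap v u.
  rewrite {1}/is_swap => /existsP[s /existsP[t /and3P[us ut /eqP E]]].
  apply/existsP; exists t; apply/existsP; exists s.
  by rewrite E (swap_t us ut) swap_s (swapK us ut) eqxx.
by apply/idP/idP; apply: main.
Qed.

(** Detailed balance: the rate from [x] to [y], weighted by [mu x], is symmetric in the two
    graphs. *)
Lemma mu_stationary y : \sum_x mu beta x * kawasaki beta x y = mu beta y.
Proof.
have rev (u v : Omega n k) : mu beta u * kawasaki beta u v = mu beta v * kawasaki beta v u.
  have [->|uv] := eqVneq u v; first by [].
  rewrite /kawasaki eq_sym (negbTE uv) /kawasaki_rate [is_swap v u]is_swapC.
  case: ifP => _; last by rewrite !mulr0.
  by rewrite [mu beta u + _]addrC; ring.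
under eq_bigr => x _ do rewrite rev.
by rewrite -mulr_sumr (stochastic_kawasaki y).2 mulr1.
Qed.

End KawasakiKernel.

(** * The restricted kernel and the regular set *)

Section RestrictedKernel.
Variables (R : realType) (n k : nat) (p beta eps : R).
Hypotheses (k_gt0 : (0 < k)%N) (k_lt : (k < 'C(n, 2))%N).
Implicit Types (x y z : Omega n k).

Lemma stochastic_kawasaki_res : stochastic (@kawasaki_res R n k p beta eps).
Proof.
move=> x; have sK := stochastic_kawasaki beta k_gt0 k_lt x.
have [Gx|nGx] := boolP (Gamma p eps x); last first.
  have E y : kawasaki_res p beta eps x y = (y == x)%:R.
    by rewrite /kawasaki_res (negbTE nGx).
  split=> [y|]; first by rewrite E ler0n.
  rewrite (eq_bigr _ (fun y _ => E y)) (bigD1 x) //= eqxx big1 ?addr0 //.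
  by move=> y /negbTE->.
have le1 : \sum_(z | Gamma p eps z && (z != x)) kawasaki beta x z <= 1.
  rewrite -sK.2 [leRHS](bigID (fun z => Gamma p eps z && (z != x))) /= lerDl.
  by apply: sumr_ge0 => y _; exact: sK.1.
split=> [y|].
  rewrite /kawasaki_res Gx /=; case: ifP => _; last by rewrite ler0n.
  by case: ifP => _; [rewrite subr_ge0|exact: sK.1].
rewrite (bigD1 x) //= {1}/kawasaki_res Gx eqxx /= [X in _ + X](bigID (Gamma p eps)) /=.
rewrite [X in _ + (_ + X)]big1 ?addr0; last first.
  by move=> y /andP[yx Gy]; rewrite /kawasaki_res (negbTE Gy) andbF (negbTE yx).
rewrite [X in _ + X](eq_big (fun z => Gamma p eps z && (z != x)) (kawasaki beta x)) ?subrK //.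
  by move=> y; rewrite andbC.
by move=> y /andP[yx Gy]; rewrite /kawasaki_res Gx Gy (negbTE yx).
Qed.

(** If all neighbours of [x] are regular, no transition out of [x] is suppressed, so the holding
    probabilities agree as well. *)
Lemma kawasaki_res_interior x : Gamma p eps x ->
  (forall q, swappable (val x) q -> Gamma p eps (swapO x q)) ->
  kawasaki beta x =1 kawasaki_res p beta eps x.
Proof.
move=> Gx nb y.
have out z : z != x -> ~~ Gamma p eps z -> kawasaki beta x z = 0.
  move=> zx Gz; rewrite /kawasaki (negbTE zx) /kawasaki_rate.
  by case: is_swapP => // -[q xq E]; rewrite E nb in Gz.
rewrite /kawasaki_res Gx /=; have [Gy|Gy] := boolP (Gamma p eps y); last first.
  have yx : y != x by apply: contraNneq Gy => ->.
  by rewrite (negbTE yx) out.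
have [->|//] := eqVneq y x.
rewrite {1}/kawasaki eqxx; congr (1 - _).
rewrite (bigID (Gamma p eps)) /= [X in _ + X]big1 ?addr0; last first.
  by move=> z /andP[zx Gz]; rewrite -(out z zx Gz) /kawasaki (negbTE zx).
apply: eq_big => [z|z /andP[zx _]]; first by rewrite andbC.
by rewrite /kawasaki (negbTE zx).
Qed.

End RestrictedKernel.

Section GammaFacts.
Variables (R : realType) (n k : nat) (p : R).
Implicit Types (x y z : Omega n k) (eps : R).

Lemma GammaP eps x : (0 < n)%N ->
  reflect (forall e, `|edeg R (val x) e - 2 * n%:R * p| <= 2 * n%:R * eps)
    (Gamma p eps x).
Proof.
move=> n0; have nn : 0 < 2 * n%:R :> R by rewrite mulr_gt0 // ltr0n.
apply: (iffP forallP) => H e; have := H e; rewrite /edge_ratio -/(edeg R (val x) e).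
  rewrite ler_pdivlMr // ler_pdivrMr // => /andP[h1 h2].
  by rewrite ler_norml; apply/andP; split; lra.
rewrite ler_norml ler_pdivlMr // ler_pdivrMr // => /andP[h1 h2].
by apply/andP; split; lra.
Qed.

Lemma edeg_swapO x q e : swappable (val x) q ->
  edeg R (val (swapO x q)) e = edeg R (val x) e - adj R q.1 e + adj R q.2 e.
Proof. by move=> xq; rewrite val_swapO //; case/andP: xq => xs xt; exact: edeg_swap. Qed.

(** A swap changes an edge degree by at most 1, while the gap between widths [eps / 2] and [eps] is
    [n eps] in edge degrees. *)
Lemma Gamma_swap eps x q : (0 < n)%N -> 1 <= n%:R * eps -> Gamma p (eps / 2) x ->
  swappable (val x) q -> Gamma p eps (swapO x q).
Proof.
move=> n0 neps /GammaP-/(_ n0) Gx xq; apply/GammaP => // e; rewrite edeg_swapO //.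
have := Gx e; rewrite !ler_norml => /andP[h1 h2].
have a0 := adj_ge0 R q.1 e; have a1 := adj_le1 R q.1 e.
have b0 := adj_ge0 R q.2 e; have b1 := adj_le1 R q.2 e.
apply/andP; split; lra.
Qed.

Lemma Gamma_le (eps1 eps2 : R) x : (0 < n)%N -> eps1 <= eps2 -> Gamma p eps1 x -> Gamma p eps2 x.
Proof.
move=> n0 e12 /GammaP-/(_ n0) Gx; apply/GammaP => // e; apply: le_trans (Gx e) _.
by rewrite ler_wpM2l // mulr_ge0.
Qed.

(** A swappable pair is an independent choice of a present and of an absent edge, so product
    summands factorise. *)
Lemma sum_swappable (X : graph n) (F G : edge n -> R) :
  \sum_(q | swappable X q) F q.1 * G q.2 =
  (\sum_s edg R X s * F s) * (\sum_t (1 - edg R X t) * G t).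
Proof.
rewrite big_mkcond /= mulr_suml; under [RHS]eq_bigr => s _ do rewrite mulr_sumr.
rewrite pair_big; apply: eq_bigr => -[s t] _ /=.
by rewrite /swappable /edg /=; case: (X s); case: (X t); rewrite /= ?subr0 ?subrr ?mul1r ?mul0r ?mulr0.
Qed.

Lemma sum_edg x : \sum_e edg R (val x) e = k%:R.
Proof. by rewrite -nedgesE nedges_val. Qed.

Lemma sum_edgC x : \sum_e (1 - edg R (val x) e) = 'C(n, 2)%:R - k%:R.
Proof. by rewrite sumrB sum_edg sumr_const -card_edge. Qed.

Lemma sum_edgC_adj x e :
  \sum_f (1 - edg R (val x) f) * adj R f e = 2 * (n%:R - 2) - edeg R (val x) e.
Proof.
under eq_bigr => f _ do rewrite mulrBl mul1r.
by rewrite sumrB -edegE sum_adj.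
Qed.

Lemma edeg_le_k x e : edeg R (val x) e <= k%:R.
Proof.
rewrite edegE -(sum_edg x); apply: ler_sum => f _.
by rewrite ler_piMr ?edg_ge0 ?adj_le1.
Qed.

Lemma edeg_le_adj x e : edeg R (val x) e <= 2 * (n%:R - 2).
Proof.
rewrite edegE -(sum_adj R e); apply: ler_sum => f _.
by rewrite ler_piMl ?adj_ge0 ?edg_le1.
Qed.

(** Both edge degrees lie within [2 n eps] of [2 n p], so they differ by at most [4 n eps]; one more
    unit accounts for the adjacency of the two edges. *)
Lemma swap_energy_bound beta eps x q : (0 < n)%N -> 0 <= beta -> Gamma p eps x ->
  `|swap_energy beta (val x) q| <= 8 * beta * eps + 2 * beta / n%:R.
Proof.
move=> n0 b0 /GammaP-/(_ n0) Gx; have nn : 0 < n%:R :> R by rewrite ltr0n.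
rewrite /swap_energy normrM ger0_norm; last by rewrite divr_ge0 ?mulr_ge0 // ltW.
have -> : 8 * beta * eps + 2 * beta / n%:R = 2 * beta / n%:R * (4 * n%:R * eps + 1).
  by field; rewrite gt_eqF.
rewrite ler_wpM2l ?divr_ge0 ?mulr_ge0 ?(ltW nn) //.
have := Gx q.1; have := Gx q.2; rewrite !ler_norml => /andP[h1 h2] /andP[h3 h4].
have a0 := adj_ge0 R q.1 q.2; have a1 := adj_le1 R q.1 q.2.
apply/andP; split; lra.
Qed.

End GammaFacts.

(** * Drift of the edge degrees towards their typical value *)

Section Drift.
Variable R : realType.

(** Here [d] is the edge degree over [2 n]. With [a = d - p] the unbiased rates satisfy
    [(1 - d) p - d (1 - p) = - a], and their sum is [2 p (1 - p) + a (1 - 2 p)]. An acceptance bias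
    of [2 beta eps] thus pushes outwards by [4 beta p (1 - p) eps], at most [(1 / 2 - eta) eps],
    against an inward pull [a / 2], at least [(1 - eta) eps / 2]. A margin [eta eps / 2] remains;
    half of it covers the lower-order terms. *)
Lemma drift_margin (eta p beta eps d b : R) :
  0 < eta -> 0 <= p -> p <= 1 -> 0 <= beta -> beta * eta <= 1 ->
  4 * beta * p * (1 - p) <= 2^-1 - eta ->
  0 < eps -> 16 * eps <= eta ^+ 2 -> eta <= 1 -> 0 <= b -> 16 * b <= eta * eps ->
  (1 - eta) * eps <= d - p -> d - p <= eps ->
  (2^-1 + (2 * beta * eps + b / 2)) * ((1 - d) * p) <=
  (2^-1 - (2 * beta * eps + b / 2)) * (d * (1 - p)) - eta * eps / 4.
Proof.
move=> e0 p0 p1 b0 be q ep0 ep e1 bb0 bb dl du.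
have be' : 16 * (beta * eps) <= eta.
  have h1 : beta * (16 * eps) <= beta * eta ^+ 2 by rewrite ler_wpM2l.
  have h2 : beta * eta ^+ 2 <= 1 * eta by rewrite expr2 mulrA ler_wpM2r // ltW.
  lra.
have bee : 16 * (beta * eps * eps) <= eta * eps by rewrite !mulrA ler_wpM2r ?(ltW ep0) //; lra.
have eps1 : eps <= 1 by move: e1 ep; rewrite expr2; nra.
pose a := d - p.
have a0 : 0 <= a by apply: le_trans dl; rewrite mulr_ge0 ?(ltW ep0) ?subr_ge0.
have pq1 : p * (1 - p) <= 1 by nra.
have pq0 : 0 <= p * (1 - p) by nra.
have s1 : 4 * beta * p * (1 - p) * eps <= (2^-1 - eta) * eps by rewrite ler_wpM2r // ltW.
have s2 : b * (p * (1 - p)) <= b by rewrite ler_piMr.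
have aa : a * (1 - 2 * p) <= a by nra.
have s3 : beta * eps * (a * (1 - 2 * p)) <= beta * eps * eps.
  by rewrite ler_wpM2l ?mulr_ge0 ?(ltW ep0) //; apply: le_trans aa _.
have s4 : b * (a * (1 - 2 * p)) <= b.
  by rewrite ler_piMr //; apply: le_trans aa _; apply: le_trans du _.
have -> : d = p + a by rewrite /a; ring.
have dl' : (1 - eta) * eps <= a by [].
nra.
Qed.

End Drift.

Section Lyapunov.
Variable R : realType.

(** [eta] is the margin supplied by compactness and [eps] the width of the regular set on which
    drift and contraction hold. [regime_eps_le] keeps the terms quadratic in [eps] below the margin,
    and [regime_large] does the same for the terms of order [1 / n]. *)
Record drift_regime (n k : nat) (p beta eta eps : R) : Prop := DriftRegime {
  regime_k : k%:R = 'C(n, 2)%:R * p;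
  regime_n : (2 <= n)%N;
  regime_eta : 0 < eta;
  regime_p : eta <= p;
  regime_q : eta <= 1 - p;
  regime_beta : 0 <= beta;
  regime_beta_eta : beta * eta <= 1;
  regime_crit : 4 * beta * p * (1 - p) <= 2^-1 - eta;
  regime_eps : 0 < eps;
  regime_eps_le : 16 * eps <= eta ^+ 2;
  regime_large : 64 <= n%:R * eta ^+ 2 * eps
}.

(** Half of the margin [eta eps / 4] left by [drift_margin], so that replacing a linear drift by an
    exponential one costs no more than half of it. *)
Definition tilt (eta eps : R) : R := eta * eps / 8.
(** The energy bound on the regular set times the Lipschitz constant [1 / 4]: the largest deviation
    of an acceptance probability from [1 / 2]. *)
Definition accept_dev (n : nat) (beta eps : R) : R :=
  2 * beta * eps + (beta / n%:R) / 2.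

Lemma binR2 n : 'C(n, 2)%:R = n%:R * (n%:R - 1) / 2 :> R.
Proof.
elim: n => [|m IH]; first by rewrite bin0n mul0r mul0r.
by rewrite binS bin1 natrD IH -natr1; field.
Qed.

Lemma nn_ge2 n k (p beta eta eps : R) (H : drift_regime n k p beta eta eps) : 2 <= n%:R :> R.
Proof.
have [kE n_ge2 eta_gt0 eta_p eta_q beta_ge0 beta_eta crit eps_gt0 eps_le n_large] := H.
by rewrite (ler_nat R 2 n). Qed.

Lemma NN_gt0 n k (p beta eta eps : R) (H : drift_regime n k p beta eta eps) : 0 < 'C(n, 2)%:R :> R.
Proof.
have [kE n_ge2 eta_gt0 eta_p eta_q beta_ge0 beta_eta crit eps_gt0 eps_le n_large] := H.
by rewrite binR2; have := nn_ge2 H; nra. Qed.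

Lemma k_pos n k (p beta eta eps : R) (H : drift_regime n k p beta eta eps) : (0 < k)%N.
Proof.
have [kE n_ge2 eta_gt0 eta_p eta_q beta_ge0 beta_eta crit eps_gt0 eps_le n_large] := H.
by rewrite -(ltr0n R) kE; apply: mulr_gt0; [exact: (NN_gt0 H)|lra]. Qed.

Lemma k_small n k (p beta eta eps : R) (H : drift_regime n k p beta eta eps) : (k < 'C(n, 2))%N.
Proof.
have [kE n_ge2 eta_gt0 eta_p eta_q beta_ge0 beta_eta crit eps_gt0 eps_le n_large] := H.
rewrite -(ltr_nat R) kE -[ltRHS]mulr1 ltr_pM2l; last exact: (NN_gt0 H).
lra.
Qed.

Lemma eta_le_half n k (p beta eta eps : R) (H : drift_regime n k p beta eta eps) : 2 * eta <= 1.
Proof.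
have [kE n_ge2 eta_gt0 eta_p eta_q beta_ge0 beta_eta crit eps_gt0 eps_le n_large] := H.
lra. Qed.

(** [4 / (n - 1)] is the ratio of [2 n] to the number of edge-positions; it measures how far the
    pools of present and absent edges are depleted by the neighbours of one edge. *)
Lemma w_bounds n k (p beta eta eps : R) (H : drift_regime n k p beta eta eps) : [/\ 0 < (4 / (n%:R - 1)) :> R, 2 / n%:R <= (4 / (n%:R - 1)) :> R, 2 * n%:R = 'C(n, 2)%:R * (4 / (n%:R - 1)) :> R & 16 * (4 / (n%:R - 1)) <= eta * eps].
Proof.
have [kE n_ge2 eta_gt0 eta_p eta_q beta_ge0 beta_eta crit eps_gt0 eps_le n_large] := H.
have n2 := (nn_ge2 H); have n1 : 0 < n%:R - 1 :> R by lra.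
split.
- by rewrite divr_gt0.
- rewrite ler_pdivrMr; last by lra.
  by rewrite mulrAC ler_pdivlMr //; lra.
- by rewrite binR2; field; lra.
have h : 64 * 1 <= n%:R * (eta * eps) * eta by move: n_large; rewrite expr2; lra.
have ee : 0 < eta * eps by rewrite mulr_gt0.
have h2 : 128 <= n%:R * (eta * eps).
  have : n%:R * (eta * eps) * (2 * eta) <= n%:R * (eta * eps) * 1.
    by rewrite ler_wpM2l ?(eta_le_half H) // mulr_ge0 // ltW.
  lra.
rewrite mulrA ler_pdivrMr //.
have : n%:R <= 2 * (n%:R - 1) :> R by lra.
move=> h3; have : n%:R * (eta * eps) <= 2 * (n%:R - 1) * (eta * eps) by rewrite ler_wpM2r // ltW.
lra.
Qed.

Lemma lam_gt0 n k (p beta eta eps : R) (H : drift_regime n k p beta eta eps) : 0 < tilt eta eps.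
Proof.
have [kE n_ge2 eta_gt0 eta_p eta_q beta_ge0 beta_eta crit eps_gt0 eps_le n_large] := H.
by rewrite divr_gt0 ?mulr_gt0. Qed.

Lemma accept_bounds n k (p beta eta eps : R) (H : drift_regime n k p beta eta eps) (x : Omega n k) q : Gamma p eps x ->
  2^-1 - accept_dev n beta eps <= accept beta (val x) q <= 2^-1 + accept_dev n beta eps.
Proof.
have [kE n_ge2 eta_gt0 eta_p eta_q beta_ge0 beta_eta crit eps_gt0 eps_le n_large] := H.
move=> Gx; have n0 : (0 < n)%N by apply: ltnW.
have b := swap_energy_bound q n0 beta_ge0 Gx.
have -> : (accept_dev n beta eps) = (8 * beta * eps + 2 * beta / n%:R) / 4.
  by rewrite /accept_dev; field; have := (nn_ge2 H); lra.
by rewrite sigmoid_ge ?sigmoid_le.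
Qed.

Lemma margin n k (p beta eta eps : R) (H : drift_regime n k p beta eta eps) d : (1 - eta) * eps <= d - p -> d - p <= eps ->
  (2^-1 + accept_dev n beta eps) * ((1 - d) * p) <= (2^-1 - accept_dev n beta eps) * (d * (1 - p)) - eta * eps / 4.
Proof.
have [kE n_ge2 eta_gt0 eta_p eta_q beta_ge0 beta_eta crit eps_gt0 eps_le n_large] := H.
have n2 := (nn_ge2 H); have e2 := (eta_le_half H).
apply: drift_margin => //; try lra; first by rewrite divr_ge0 //; lra.
rewrite mulrA ler_pdivrMr; last by lra.
have h : 64 <= n%:R * eta ^+ 2 * eps := n_large.
have : 64 * beta <= n%:R * eta ^+ 2 * eps * beta by rewrite ler_wpM2r.
have : (beta * eta) * (n%:R * eta * eps) <= 1 * (n%:R * eta * eps).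
  by rewrite ler_wpM2r // !mulr_ge0 //; lra.
rewrite expr2; lra.
Qed.

(** The same estimate after complementation, with [d] and [p] replaced by [1 - d] and [1 - p]. *)
Lemma marginC n k (p beta eta eps : R) (H : drift_regime n k p beta eta eps) d : (1 - eta) * eps <= p - d -> p - d <= eps ->
  (2^-1 + accept_dev n beta eps) * (d * (1 - p)) <= (2^-1 - accept_dev n beta eps) * ((1 - d) * p) - eta * eps / 4.
Proof.
have [kE n_ge2 eta_gt0 eta_p eta_q beta_ge0 beta_eta crit eps_gt0 eps_le n_large] := H.
have n2 := (nn_ge2 H); have e2 := (eta_le_half H) => h1 h2.
have -> : d * (1 - p) = (1 - (1 - d)) * (1 - p) by ring.
have -> : (1 - d) * p = (1 - d) * (1 - (1 - p)) by ring.
apply: drift_margin => //; try lra; first by rewrite divr_ge0 //; lra.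
rewrite mulrA ler_pdivrMr; last by lra.
have h : 64 <= n%:R * eta ^+ 2 * eps := n_large.
have : 64 * beta <= n%:R * eta ^+ 2 * eps * beta by rewrite ler_wpM2r.
have : (beta * eta) * (n%:R * eta * eps) <= 1 * (n%:R * eta * eps).
  by rewrite ler_wpM2r // !mulr_ge0 //; lra.
rewrite expr2; lra.
Qed.

(** Read off [margin] at the boundary [d = p + eps]: a deviation above [1 / 2] would make its left
    side nonnegative and its right side negative. *)
Lemma z4_bounds n k (p beta eta eps : R) (H : drift_regime n k p beta eta eps) : 0 <= (accept_dev n beta eps) /\ (accept_dev n beta eps) <= 2^-1.
Proof.
have [kE n_ge2 eta_gt0 eta_p eta_q beta_ge0 beta_eta crit eps_gt0 eps_le n_large] := H.
have n2 := (nn_ge2 H); have e2 := (eta_le_half H).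
split; first by rewrite /accept_dev addr_ge0 ?mulr_ge0 ?divr_ge0 // ltW.
have := (margin H) (p + eps); have -> : p + eps - p = eps by ring.
move=> /(_ _ (lexx _)) mg.
have : (1 - eta) * eps <= eps by rewrite ler_piMl ?(ltW eps_gt0) //; lra.
move=> /mg {}mg.
rewrite leNgt; apply/negP => z2.
have eps1 : eps <= eta by move: eps_le; rewrite expr2; nra.
have := eta_gt0; have := eps_gt0; have := eta_p; have := eta_q.
have d1 : 0 <= (1 - (p + eps)) * p by rewrite mulr_ge0; lra.
have d2 : 0 <= (p + eps) * (1 - p) by rewrite mulr_ge0; lra.
have : (2^-1 - accept_dev n beta eps) * ((p + eps) * (1 - p)) <= 0 by rewrite mulr_le0_ge0 //; lra.
have : 0 <= (2^-1 + accept_dev n beta eps) * ((1 - (p + eps)) * p) by rewrite mulr_ge0 //; lra.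
have : 0 < eta * eps by rewrite mulr_gt0.
lra.
Qed.

Lemma expRN_lam n k (p beta eta eps : R) (H : drift_regime n k p beta eta eps) : 1 - tilt eta eps <= expR (- tilt eta eps).
Proof.
have [kE n_ge2 eta_gt0 eta_p eta_q beta_ge0 beta_eta crit eps_gt0 eps_le n_large] := H.
exact: expR_ge1Dx. Qed.

(* [ups] and [downs] count the swaps that raise, resp. lower, the degree of [e]. *)
Definition ups n (e : edge n) (q : edge n * edge n) : R := adj R q.2 e * (1 - adj R q.1 e).
Definition downs n (e : edge n) (q : edge n * edge n) : R := adj R q.1 e * (1 - adj R q.2 e).

Lemma sum_ups n k (x : Omega n k) e : \sum_(q | swappable (val x) q) ups e q =
  (2 * (n%:R - 2) - edeg R (val x) e) * (k%:R - edeg R (val x) e).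
Proof.
rewrite -(sum_edgC_adj R x e) -(sum_edg R x) edegE mulrC -sumrB.
have -> : \sum_f (edg R (val x) f - edg R (val x) f * adj R f e) =
  \sum_f edg R (val x) f * (1 - adj R f e).
  by apply: eq_bigr => f _; rewrite mulrBr mulr1.
rewrite -(sum_swappable (val x) (fun f => 1 - adj R f e) (fun f => adj R f e)).
by apply: eq_bigr => q _; rewrite mulrC.
Qed.

Lemma sum_downs n k (x : Omega n k) e : \sum_(q | swappable (val x) q) downs e q =
  edeg R (val x) e * ('C(n, 2)%:R - k%:R - (2 * (n%:R - 2) - edeg R (val x) e)).
Proof.
rewrite -(sum_edgC_adj R x e) -(sum_edgC R x) edegE -sumrB.
have -> : \sum_f (1 - edg R (val x) f - (1 - edg R (val x) f) * adj R f e) =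
  \sum_f (1 - edg R (val x) f) * (1 - adj R f e).
  by apply: eq_bigr => f _; rewrite mulrBr mulr1.
by rewrite -(sum_swappable (val x) (fun f => adj R f e) (fun f => 1 - adj R f e)).
Qed.

Lemma ups_ge0 n (e : edge n) q : 0 <= ups e q.
Proof. by rewrite mulr_ge0 ?adj_ge0 // subr_ge0 adj_le1. Qed.

Lemma downs_ge0 n (e : edge n) q : 0 <= downs e q.
Proof. by rewrite mulr_ge0 ?adj_ge0 // subr_ge0 adj_le1. Qed.

(** Since [e^{- lambda} - 1 = - (e^lambda - 1) e^{- lambda}], a lowering move offsets a raising one
    up to the factor [e^{- lambda}]. Replacing the acceptance probabilities by their extreme values
    reduces the sign to a comparison of two counts. *)
Lemma tilt_sum_le0 n k (p beta eta eps : R) (H : drift_regime n k p beta eta eps) (x : Omega n k) (U V : edge n * edge n -> R) : Gamma p eps x ->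
  (forall q, 0 <= U q) -> (forall q, 0 <= V q) ->
  (2^-1 + accept_dev n beta eps) * (\sum_(q | swappable (val x) q) U q) <=
  expR (- tilt eta eps) * ((2^-1 - accept_dev n beta eps) * (\sum_(q | swappable (val x) q) V q)) ->
  \sum_(q | swappable (val x) q) pair_rate R n k * accept beta (val x) q *
     (U q * (expR (tilt eta eps) - 1) + V q * (expR (- tilt eta eps) - 1)) <= 0.
Proof.
have [kE n_ge2 eta_gt0 eta_p eta_q beta_ge0 beta_eta crit eps_gt0 eps_le n_large] := H.
move=> Gx U0 V0 UV.
have el : 0 <= expR (tilt eta eps) - 1 by rewrite subr_ge0 -expR0 ler_expR ltW ?(lam_gt0 H).
have ee : expR (tilt eta eps) * expR (- tilt eta eps) = 1 by rewrite -expRD subrr expR0.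
have en := expR_gt0 (- tilt eta eps).
have r0 := pair_rate_gt0 R (k_pos H) (k_small H).
apply: le_trans (_ : pair_rate R n k * ((expR (tilt eta eps) - 1) * \sum_(q | swappable (val x) q)
   ((2^-1 + accept_dev n beta eps) * U q - expR (- tilt eta eps) * ((2^-1 - accept_dev n beta eps) * V q))) <= _).
  rewrite !mulr_sumr; apply: ler_sum => q _; rewrite -mulrA ler_pM2l //.
  have /andP[a1 a2] := accept_bounds H q Gx.
  have -> : expR (- tilt eta eps) - 1 = - (expR (tilt eta eps) - 1) * expR (- tilt eta eps).
    by rewrite mulNr mulrBl ee mul1r opprB.
  have -> : accept beta (val x) q * (U q * (expR (tilt eta eps) - 1) + V q * (- (expR (tilt eta eps) - 1) * expR (- tilt eta eps)))
    = (expR (tilt eta eps) - 1) * (accept beta (val x) q * U q - expR (- tilt eta eps) * (accept beta (val x) q * V q)) by ring.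
  rewrite ler_wpM2l //; apply: lerB; first by rewrite ler_wpM2r.
  by rewrite ler_pM2l // ler_wpM2r.
by rewrite mulr_ge0_le0 ?(ltW r0) // mulr_ge0_le0 // sumrB -!mulr_sumr subr_le0.
Qed.

Lemma edeg_frac n k (p beta eta eps : R) (H : drift_regime n k p beta eta eps) (x : Omega n k) e : exists d, [/\ edeg R (val x) e = 2 * n%:R * d, 0 <= d, d <= 1
  & edeg R (val x) e = 'C(n, 2)%:R * ((4 / (n%:R - 1)) * d)].
Proof.
have [kE n_ge2 eta_gt0 eta_p eta_q beta_ge0 beta_eta crit eps_gt0 eps_le n_large] := H.
have n2 := (nn_ge2 H); exists (edeg R (val x) e / (2 * n%:R)).
have [_ _ E _] := (w_bounds H).
have D0 : 0 <= edeg R (val x) e by [].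
have D1 := edeg_le R (val x) e.
split; first by field; lra.
- by rewrite divr_ge0 //; lra.
- by rewrite ler_pdivrMr ?mul1r //; lra.
by rewrite mulrA -E; field; lra.
Qed.

(** The margin [eta eps / 4] pays for the tilt, [eta eps / 8], and for the depletion term
    [4 / (n - 1)], at most [eta eps / 16]. *)
Lemma ups_downs n k (p beta eta eps : R) (H : drift_regime n k p beta eta eps) (x : Omega n k) e : Gamma p eps x ->
  2 * n%:R * (p + (1 - eta) * eps) <= edeg R (val x) e ->
  (2^-1 + accept_dev n beta eps) * (\sum_(q | swappable (val x) q) ups e q) <=
  expR (- tilt eta eps) * ((2^-1 - accept_dev n beta eps) * (\sum_(q | swappable (val x) q) downs e q)).
Proof.
have [kE n_ge2 eta_gt0 eta_p eta_q beta_ge0 beta_eta crit eps_gt0 eps_le n_large] := H.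
move=> Gx Dl; rewrite sum_ups sum_downs.
have n2 := (nn_ge2 H); have [w0 wn wE we] := (w_bounds H); have N0 := (NN_gt0 H).
have [d [Ed d0 d1 Ew]] := edeg_frac H x e.
have [z0 z1] := (z4_bounds H).
have nn2 : 0 < 2 * n%:R :> R by lra.
have m0 : 0 <= 2^-1 - accept_dev n beta eps by lra.
have Du : edeg R (val x) e <= 2 * n%:R * (p + eps).
  have := GammaP p eps x (ltnW n_ge2) => /elimT/(_ Gx)/(_ e).
  by rewrite ler_norml => /andP[_]; lra.
have Dk := edeg_le_k R x e; have Da := edeg_le_adj R x e.
have dl : (1 - eta) * eps <= d - p.
  by move: Dl; rewrite Ed ler_pM2l //; lra.
have du : d - p <= eps by move: Du; rewrite Ed ler_pM2l //; lra.
have mg := margin H dl du.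
apply: le_trans (_ : (2^-1 + accept_dev n beta eps) * ((2 * n%:R * 'C(n, 2)%:R) * ((1 - d) * p)) <= _).
  rewrite ler_wpM2l //; first by lra.
  have -> : 2 * n%:R * 'C(n, 2)%:R * ((1 - d) * p) = (2 * n%:R - 2 * n%:R * d) * ('C(n, 2)%:R * p) by ring.
  rewrite -Ed ler_pM // ?subr_ge0 //; first by lra.
  by rewrite kE; have : 0 <= edeg R (val x) e by []; lra.
apply: le_trans (_ : 2 * n%:R * 'C(n, 2)%:R * ((1 - tilt eta eps) * ((2^-1 - accept_dev n beta eps) * (d * (1 - p - (4 / (n%:R - 1)))))) <= _); last first.
  have lam1 : 0 <= 1 - tilt eta eps.
    have : eps <= 1 by move: eps_le (eta_le_half H); rewrite expr2; nra.
    by rewrite /tilt; have := (eta_le_half H); nra.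
  have E1 : 'C(n, 2)%:R * (1 - p - (4 / (n%:R - 1))) <= 'C(n, 2)%:R - k%:R - (2 * (n%:R - 2) - edeg R (val x) e).
    by rewrite kE; have : 0 <= edeg R (val x) e by []; lra.
  have E2 : 0 <= 1 - p - (4 / (n%:R - 1)).
    have : eta * eps <= eta by rewrite ler_piMr ?ltW //; move: eps_le (eta_le_half H); rewrite expr2; nra.
    lra.
  have -> : 2 * n%:R * 'C(n, 2)%:R * ((1 - tilt eta eps) * ((2^-1 - accept_dev n beta eps) * (d * (1 - p - (4 / (n%:R - 1)))))) =
    (1 - tilt eta eps) * ((2^-1 - accept_dev n beta eps) * (2 * n%:R * d * ('C(n, 2)%:R * (1 - p - (4 / (n%:R - 1)))))) by ring.
  rewrite -Ed ler_pM ?(expRN_lam H) //.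
    by rewrite !mulr_ge0 // ltW.
  by rewrite ler_wpM2l // ler_wpM2l.
have -> : (2^-1 + accept_dev n beta eps) * (2 * n%:R * 'C(n, 2)%:R * ((1 - d) * p)) =
  2 * n%:R * 'C(n, 2)%:R * ((2^-1 + accept_dev n beta eps) * ((1 - d) * p)) by ring.
rewrite ler_pM2l ?mulr_gt0 //; last by lra.
apply: le_trans mg _.
have l0 := (lam_gt0 H).
have dp0 : 0 <= (2^-1 - accept_dev n beta eps) * (d * (1 - p)).
  by rewrite !mulr_ge0 //; lra.
have dp1 : (2^-1 - accept_dev n beta eps) * (d * (1 - p)) <= 1.
  have p1 : 0 <= 1 - p by lra.
  by rewrite mulr_ile1 ?mulr_ge0 //; [|rewrite mulr_ile1 //]; clear -z0 z1 p1 eta_gt0 eta_p; lra.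
have dw1 : (2^-1 - accept_dev n beta eps) * (d * (4 / (n%:R - 1))) <= (4 / (n%:R - 1)).
  by rewrite mulrA ler_piMl ?(ltW w0) // mulr_ile1 //; lra.
have dw0 : 0 <= (2^-1 - accept_dev n beta eps) * (d * (4 / (n%:R - 1))) by rewrite mulr_ge0 // mulr_ge0 // ltW.
have : tilt eta eps * ((2^-1 - accept_dev n beta eps) * (d * (1 - p))) <= tilt eta eps by rewrite ler_piMr // ltW.
have : 0 <= tilt eta eps * ((2^-1 - accept_dev n beta eps) * (d * (4 / (n%:R - 1)))) by rewrite mulr_ge0 // ltW.
have : tilt eta eps = eta * eps / 8 by [].
lra.
Qed.

(** Here the depletion occurs in both factors of the raising count and costs [2 * (4 / (n - 1))], at
    most [eta eps / 8]. Together with the tilt this uses up exactly the margin [eta eps / 4]. *)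
Lemma downs_ups n k (p beta eta eps : R) (H : drift_regime n k p beta eta eps) (x : Omega n k) e : Gamma p eps x ->
  edeg R (val x) e <= 2 * n%:R * (p - (1 - eta) * eps) ->
  (2^-1 + accept_dev n beta eps) * (\sum_(q | swappable (val x) q) downs e q) <=
  expR (- tilt eta eps) * ((2^-1 - accept_dev n beta eps) * (\sum_(q | swappable (val x) q) ups e q)).
Proof.
have [kE n_ge2 eta_gt0 eta_p eta_q beta_ge0 beta_eta crit eps_gt0 eps_le n_large] := H.
move=> Gx Dl; rewrite sum_ups sum_downs.
have n2 := (nn_ge2 H); have [w0 wn wE we] := (w_bounds H); have N0 := (NN_gt0 H).
have [d [Ed d0 d1 Ew]] := edeg_frac H x e.
have [z0 z1] := (z4_bounds H).
have nn2 : 0 < 2 * n%:R :> R by lra.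
have m0 : 0 <= 2^-1 - accept_dev n beta eps by lra.
have Du : 2 * n%:R * (p - eps) <= edeg R (val x) e.
  have := GammaP p eps x (ltnW n_ge2) => /elimT/(_ Gx)/(_ e).
  by rewrite ler_norml => /andP[+ _]; lra.
have Dk := edeg_le_k R x e; have Da := edeg_le_adj R x e.
have dl : (1 - eta) * eps <= p - d.
  by move: Dl; rewrite Ed ler_pM2l //; lra.
have du : p - d <= eps by move: Du; rewrite Ed ler_pM2l //; lra.
have mg := marginC H dl du.
have lam1 : 0 <= 1 - tilt eta eps.
  have : eps <= 1 by move: eps_le (eta_le_half H); rewrite expr2; nra.
  by rewrite /tilt; have := (eta_le_half H); nra.
apply: le_trans (_ : (2^-1 + accept_dev n beta eps) * ((2 * n%:R * 'C(n, 2)%:R) * (d * (1 - p))) <= _).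
  rewrite ler_wpM2l //; first by lra.
  have -> : 2 * n%:R * 'C(n, 2)%:R * (d * (1 - p)) = (2 * n%:R * d) * ('C(n, 2)%:R - 'C(n, 2)%:R * p) by ring.
  by rewrite -Ed ler_wpM2l // kE; lra.
have -> : (2^-1 + accept_dev n beta eps) * (2 * n%:R * 'C(n, 2)%:R * (d * (1 - p))) =
  2 * n%:R * 'C(n, 2)%:R * ((2^-1 + accept_dev n beta eps) * (d * (1 - p))) by ring.
apply: le_trans (_ : 2 * n%:R * 'C(n, 2)%:R * ((2^-1 - accept_dev n beta eps) * ((1 - d) * p) - eta * eps / 4) <= _).
  by rewrite ler_wpM2l // mulr_ge0 // ltW.
have U2 : (1 - d) * p - 2 * (4 / (n%:R - 1)) <= (1 - d - 2 / n%:R) * (p - (4 / (n%:R - 1)) * d).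
  have h0 : 0 <= (4 / (n%:R - 1)) * d by rewrite mulr_ge0 // ltW.
  have h1 : (4 / (n%:R - 1)) * d * (1 - d) <= (4 / (n%:R - 1)).
    by rewrite -mulrA ler_piMr ?(ltW w0) // mulr_ile1 //; lra.
  have h2 : 2 / n%:R * p <= (4 / (n%:R - 1)).
    by apply: le_trans wn; rewrite ler_piMr ?divr_ge0 //; clear - eta_q eta_gt0; lra.
  have h3 : 0 <= 2 / n%:R * ((4 / (n%:R - 1)) * d) by apply: mulr_ge0; rewrite ?divr_ge0.
  lra.
have -> : 2 * (n%:R - 2) - edeg R (val x) e = 2 * n%:R * (1 - d - 2 / n%:R).
  by rewrite Ed; field; lra.
have -> : k%:R - edeg R (val x) e = 'C(n, 2)%:R * (p - (4 / (n%:R - 1)) * d) by rewrite Ew kE; ring.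
have -> : expR (- tilt eta eps) * ((2^-1 - accept_dev n beta eps) * (2 * n%:R * (1 - d - 2 / n%:R) * ('C(n, 2)%:R * (p - (4 / (n%:R - 1)) * d)))) =
  2 * n%:R * 'C(n, 2)%:R * (expR (- tilt eta eps) * ((2^-1 - accept_dev n beta eps) * ((1 - d - 2 / n%:R) * (p - (4 / (n%:R - 1)) * d)))) by ring.
rewrite ler_pM2l ?mulr_gt0 //; last by lra.
have F1 : 0 <= 1 - d - 2 / n%:R.
  rewrite -(pmulr_rge0 _ nn2).
  have -> : 2 * n%:R * (1 - d - 2 / n%:R) = 2 * (n%:R - 2) - edeg R (val x) e.
    by rewrite Ed; field; lra.
  by rewrite subr_ge0.
have F2 : 0 <= p - 4 / (n%:R - 1) * d.
  rewrite -(pmulr_rge0 _ N0).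
  have -> : 'C(n, 2)%:R * (p - 4 / (n%:R - 1) * d) = k%:R - edeg R (val x) e.
    by rewrite Ew kE; ring.
  by rewrite subr_ge0.
have P0 := mulr_ge0 F1 F2.
have Q1 : (1 - d - 2 / n%:R) * (p - 4 / (n%:R - 1) * d) <= 1.
  have h0 : 0 <= 4 / (n%:R - 1) * d by rewrite mulr_ge0 // ltW.
  have h1 : 0 <= 2 / n%:R :> R by rewrite divr_ge0.
  by rewrite mulr_ile1 //; clear -h0 h1 d0 eta_q eta_gt0; lra.
apply: le_trans (_ : (1 - tilt eta eps) * ((2^-1 - accept_dev n beta eps) * ((1 - d - 2 / n%:R) * (p - (4 / (n%:R - 1)) * d))) <= _); last first.
  by rewrite ler_wpM2r ?(expRN_lam H) // mulr_ge0.
have l0 := (lam_gt0 H).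
have dp0 : 0 <= (2^-1 - accept_dev n beta eps) * ((1 - d) * p).
  by rewrite !mulr_ge0 //; clear - eta_gt0 eta_p d1; lra.
have mle : 2^-1 - accept_dev n beta eps <= 1 by lra.
set Q := (1 - d - 2 / n%:R) * (p - (4 / (n%:R - 1)) * d) in U2 P0 Q1 *.
have mQ : (2^-1 - accept_dev n beta eps) * Q <= 1 by rewrite mulr_ile1.
have : (2^-1 - accept_dev n beta eps) * ((1 - d) * p - 2 * (4 / (n%:R - 1))) <= (2^-1 - accept_dev n beta eps) * Q by rewrite ler_wpM2l.
have : (2^-1 - accept_dev n beta eps) * (2 * (4 / (n%:R - 1))) <= 2 * (4 / (n%:R - 1)) by rewrite ler_piMl // mulr_ge0 // ltW.
have : tilt eta eps * ((2^-1 - accept_dev n beta eps) * Q) <= tilt eta eps by rewrite ler_piMr // ltW.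
have : tilt eta eps = eta * eps / 8 by [].
lra.
Qed.

End Lyapunov.

(** * The exponential Lyapunov function *)

Section LyapunovFunction.
Variable R : realType.

Definition excess n k (p : R) (x : Omega n k) (e : edge n) : R :=
  edeg R (val x) e - 2 * n%:R * p.

Definition lyapunov n k (p lam : R) (x : Omega n k) : R :=
  \sum_e (expR (lam * excess p x e) + expR (- lam * excess p x e)).

Lemma lyapunov_ge0 n k p lam (x : Omega n k) : 0 <= lyapunov p lam x.
Proof. by apply: sumr_ge0 => e _; rewrite addr_ge0 ?expR_ge0. Qed.

Lemma excess_swapO n k p (x : Omega n k) q e : swappable (val x) q ->
  excess p (swapO x q) e = excess p x e + (adj R q.2 e - adj R q.1 e).
Proof. by move=> xq; rewrite /excess edeg_swapO //; ring. Qed.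

Lemma expR_adj n (lam : R) (e : edge n) q :
  expR (lam * (adj R q.2 e - adj R q.1 e)) - 1 =
  ups R e q * (expR lam - 1) + downs R e q * (expR (- lam) - 1).
Proof.
rewrite /ups /downs /adj; case: edge_adj; case: edge_adj => /=.
- by rewrite !subrr mulr0 expR0; ring.
- by rewrite subr0 mulr1; ring.
- by rewrite sub0r mulrN1; ring.
- by rewrite !subrr mulr0 expR0; ring.
Qed.

Lemma sum_accept_le n k beta (x : Omega n k) (c : R) (F : edge n * edge n -> R) :
  (0 < k)%N -> (k < 'C(n, 2))%N -> 0 <= c ->
  (forall q, swappable (val x) q -> F q <= c) ->
  \sum_(q | swappable (val x) q) pair_rate R n k * accept beta (val x) q * F q <= c.
Proof.
move=> k0 k1 c0 Fc; have r0 := pair_rate_gt0 R k0 k1.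
rewrite -[leRHS]mul1r -(card_swappable R k0 k1 x) mulr_suml.
apply: ler_sum => q xq; rewrite -mulrA ler_pM2l //.
apply: le_trans (_ : accept beta (val x) q * c <= _).
  by rewrite ler_wpM2l ?accept_ge0 // Fc.
by rewrite ler_piMl // accept_le1.
Qed.

(** Each edge and each sign is treated alone. An excess beyond [2 n (1 - eta) eps] has nonpositive
    exponential drift. Below that threshold the value after one step is already at most [c], where
    the summand 1 in its exponent is the size of a jump. *)
Lemma lyapunov_drift n k (p beta eta eps : R) (x : Omega n k) :
  drift_regime n k p beta eta eps -> Gamma p eps x ->
  \sum_y kawasaki beta x y * lyapunov p (tilt eta eps) y <=
  lyapunov p (tilt eta eps) x +
  2 * 'C(n, 2)%:R * expR (tilt eta eps * (1 + 2 * n%:R * ((1 - eta) * eps))).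
Proof.
move=> H Gx; have k0 := k_pos H; have k1 := k_small H.
rewrite kawasaki_expect // lerD2l; set lam := tilt eta eps.
have l0 : 0 < lam := lam_gt0 H.
set c := expR _; have c0 : 0 <= c by apply: expR_ge0.
pose S (F : edge n * edge n -> R) :=
  \sum_(q | swappable (val x) q) pair_rate R n k * accept beta (val x) q * F q.
have -> : \sum_(q | swappable (val x) q) pair_rate R n k * accept beta (val x) q *
    (lyapunov p lam (swapO x q) - lyapunov p lam x) =
  \sum_e (expR (lam * excess p x e) *
            S (fun q => expR (lam * (adj R q.2 e - adj R q.1 e)) - 1) +
          expR (- lam * excess p x e) *
            S (fun q => expR (- lam * (adj R q.2 e - adj R q.1 e)) - 1)).
  transitivity (\sum_(q | swappable (val x) q) \sum_e
    (expR (lam * excess p x e) * (pair_rate R n k * accept beta (val x) q *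
       (expR (lam * (adj R q.2 e - adj R q.1 e)) - 1)) +
     expR (- lam * excess p x e) * (pair_rate R n k * accept beta (val x) q *
       (expR (- lam * (adj R q.2 e - adj R q.1 e)) - 1)))).
    apply: eq_bigr => q xq; rewrite -sumrB mulr_sumr; apply: eq_bigr => e _.
    rewrite excess_swapO // ![_ * (excess p x e + _)]mulrDr !expRD; ring.
  rewrite exchange_big; apply: eq_bigr => e _ /=.
  by rewrite big_split /= -!mulr_sumr.
have -> : 2 * 'C(n, 2)%:R * c = \sum_(e : edge n) (c + c).
  by rewrite sumr_const card_edge -mulr_natr; ring.
apply: ler_sum => e _.
have step_le q : `|adj R q.2 e - adj R q.1 e| <= 1.
  have := adj_ge0 R q.2 e; have := adj_le1 R q.2 e.
  have := adj_ge0 R q.1 e; have := adj_le1 R q.1 e.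
  by rewrite ler_norml => *; apply/andP; split; lra.
(* Below the threshold no drift is used: the increment is at most the new value, and the excess
   moves by at most 1. *)
have low (s : R) : `|s| = 1 -> s * excess p x e <= 2 * n%:R * ((1 - eta) * eps) ->
    expR (s * lam * excess p x e) *
      S (fun q => expR (s * lam * (adj R q.2 e - adj R q.1 e)) - 1) <= c.
  move=> s1 sl; rewrite /S mulr_sumr.
  under eq_bigr => q _ do rewrite mulrCA.
  apply: sum_accept_le => // q _.
  rewrite mulrBr mulr1 -expRD -mulrDr lerBlDr ler_wpDr ?expR_ge0 // ler_expR.
  have -> : s * lam * (excess p x e + (adj R q.2 e - adj R q.1 e)) =
    lam * (s * (adj R q.2 e - adj R q.1 e) + s * excess p x e) by ring.
  rewrite ler_pM2l //.
  apply: lerD => //; apply: le_trans (ler_norm _) _.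
  by rewrite normrM s1 mul1r.
have n2 := nn_ge2 H.
apply: lerD.
  have [hi|lo] := lerP (2 * n%:R * ((1 - eta) * eps)) (excess p x e); last first.
    by have := low 1; rewrite normr1 !mul1r; apply => //; apply: ltW.
  apply: le_trans c0; rewrite pmulr_rle0 ?expR_gt0 // /S.
  under eq_bigr => q _ do rewrite expR_adj.
  apply: (tilt_sum_le0 H Gx); [exact: ups_ge0|exact: downs_ge0|].
  by apply: (ups_downs H Gx); move: hi; rewrite /excess; lra.
have [hi|lo] := lerP (excess p x e) (- (2 * n%:R * ((1 - eta) * eps))); last first.
  by have := low (-1); rewrite normrN1 !mulN1r; apply => //; lra.
apply: le_trans c0; rewrite pmulr_rle0 ?expR_gt0 // /S.
under eq_bigr => q _ do rewrite expR_adj opprK addrC.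
apply: (tilt_sum_le0 H Gx); [exact: downs_ge0|exact: ups_ge0|].
by apply: (downs_ups H Gx); move: hi; rewrite /excess; lra.
Qed.

Lemma lyapunov_outside n k (p lam eps : R) (x : Omega n k) : (0 < n)%N -> 0 <= lam ->
  ~~ Gamma p eps x -> expR (lam * (2 * n%:R * eps)) <= lyapunov p lam x.
Proof.
move=> n0 l0 nG.
have [e he] : exists e, 2 * n%:R * eps < `|excess p x e|.
  apply/not_existsP => no; move/negP: nG; apply; apply/GammaP => // e.
  by rewrite leNgt; apply/negP; exact: no.
rewrite /lyapunov (bigD1 e) //= -[leLHS]addr0; apply: lerD; last first.
  by apply: sumr_ge0 => f _; rewrite addr_ge0 ?expR_ge0.
have [ge|lt] := lerP 0 (excess p x e).
  rewrite -[leLHS]addr0 lerD ?expR_ge0 // ler_expR ler_wpM2l //.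
  by move: he; rewrite ger0_norm // => /ltW.
rewrite -[leLHS]add0r lerD ?expR_ge0 // ler_expR mulNr -mulrN ler_wpM2l //.
by move: he; rewrite ltr0_norm // => /ltW.
Qed.

Lemma lyapunov_inside n k (p lam eps : R) (x : Omega n k) : (0 < n)%N -> 0 <= lam ->
  Gamma p eps x ->
  lyapunov p lam x <= 2 * 'C(n, 2)%:R * expR (lam * (2 * n%:R * eps)).
Proof.
move=> n0 l0 /GammaP-/(_ n0) Gx.
set c := expR _.
have -> : 2 * 'C(n, 2)%:R * c = \sum_(e : edge n) (c + c).
  by rewrite sumr_const card_edge -mulr_natr; ring.
apply: ler_sum => e _; have := Gx e; rewrite -/(excess p x e) ler_norml => /andP[h1 h2].
by apply: lerD; rewrite ler_expR ?mulNr -?mulrN ler_wpM2l //; lra.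
Qed.

End LyapunovFunction.

(** * The one-step contractive coupling *)

Section Matching.
Variable T : finType.

(** Equal edge counts mean that the positions present only in [x] and those present only in [y] are
    equally many; pairing them gives an involution that fixes all other positions and carries [x] to
    [y]. *)
Lemma balanced_matching (x y : T -> bool) : #|[pred e | x e]| = #|[pred e | y e]| ->
  exists g : T -> T, [/\ involutive g, forall e, y (g e) = x e
                       & forall e, x e = y e -> g e = e].
Proof.
move=> cxy.
pose A := [pred e | x e && ~~ y e]; pose B := [pred e | y e && ~~ x e].
have cAB : #|A| = #|B|.
  have hx := cardID [pred e | y e] [pred e | x e].
  have hy := cardID [pred e | x e] [pred e | y e].
  have e1 : #|[predI [pred e | x e] & [pred e | y e]]| = #|[predI [pred e | y e] & [pred e | x e]]|.
    by apply: eq_card => e; rewrite !inE andbC.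
  have e2 : #|[predD [pred e | x e] & [pred e | y e]]| = #|A|.
    by apply: eq_card => e; rewrite !inE andbC.
  have e3 : #|[predD [pred e | y e] & [pred e | x e]]| = #|B|.
    by apply: eq_card => e; rewrite !inE andbC.
  by apply/eqP; rewrite -e2 -e3 -(eqn_add2l #|[predI [pred e | x e] & [pred e | y e]]|) hx e1 hy cxy.
have szAB : size (enum A) = size (enum B) by rewrite -!cardE.
pose g e := if A e then nth e (enum B) (index e (enum A))
            else if B e then nth e (enum A) (index e (enum B)) else e.
have iA e : A e -> (index e (enum A) < size (enum B))%N.
  by move=> Ae; rewrite -szAB index_mem mem_enum.
have iB e : B e -> (index e (enum B) < size (enum A))%N.
  by move=> Be; rewrite szAB index_mem mem_enum.
have gA e : A e -> B (g e).
  move=> Ae; rewrite /g Ae; have := mem_nth e (iA e Ae).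
  by rewrite mem_enum.
have AB e : B e -> ~~ A e by rewrite /= => /andP[-> /negbTE->].
have gB e : B e -> A (g e).
  move=> Be; rewrite /g (negbTE (AB e Be)) Be; have := mem_nth e (iB e Be).
  by rewrite mem_enum.
exists g; split.
- move=> e; have [Ae|nA] := boolP (A e).
    have Bg := gA e Ae; rewrite {1}/g (negbTE (AB _ Bg)) Bg.
    rewrite {2}/g Ae index_uniq ?enum_uniq ?iA // (set_nth_default e).
      by rewrite nth_index // mem_enum.
    by rewrite index_mem mem_enum.
  have [Be|nB] := boolP (B e); last by rewrite /g (negbTE nA) (negbTE nB) (negbTE nA) (negbTE nB).
  have Ag := gB e Be; rewrite {1}/g Ag.
  rewrite {2}/g (negbTE nA) Be index_uniq ?enum_uniq ?iB // (set_nth_default e).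
    by rewrite nth_index // mem_enum.
  by rewrite index_mem mem_enum.
- move=> e; have [Ae|nA] := boolP (A e).
    by have /andP[-> _] := gA e Ae; case/andP: Ae => ->.
  have [Be|nB] := boolP (B e).
    by have /andP[_ /negbTE->] := gB e Be; case/andP: Be => _ /negbTE->.
  rewrite /g (negbTE nA) (negbTE nB); move: nA nB => /=.
  by case: (x e); case: (y e).
- move=> e E; rewrite /g /= E andbN /=.
  by case: (y e).
Qed.

End Matching.

Section Contraction.
Variable R : realType.

Definition differ n (X Y : graph n) (e : edge n) : R := (X e != Y e)%:R.

Definition hamming n k (x y : Omega n k) : R := \sum_e differ (val x) (val y) e.

Lemma differ_ge0 n (X Y : graph n) e : 0 <= differ X Y e.
Proof. by rewrite /differ ler0n. Qed.

Lemma hamming_ge0 n k (x y : Omega n k) : 0 <= hamming x y.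
Proof. by apply: sumr_ge0 => e _; exact: differ_ge0. Qed.

Lemma hammingC n k (x y : Omega n k) : hamming x y = hamming y x.
Proof. by apply: eq_bigr => e _; rewrite /differ eq_sym. Qed.

Lemma hamming_ge1 n k (x y : Omega n k) : x != y -> 1 <= hamming x y.
Proof.
move=> xy; have [e he] : exists e, val x e != val y e.
  apply/existsP; rewrite -negb_forall; apply: contra xy => /forallP H.
  by apply/eqP/val_inj/ffunP => e; apply/eqP.
rewrite /hamming (bigD1 e) //= {1}/differ he lerDl.
by apply: sumr_ge0 => f _; exact: differ_ge0.
Qed.

Lemma hamming_le n k (x y : Omega n k) : hamming x y <= 'C(n, 2)%:R.
Proof.
rewrite -card_edge -sum1_card natr_sum; apply: ler_sum => e _.
by rewrite /differ; case: (_ != _).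
Qed.

Lemma hamming_swapO n k (x y : Omega n k) q : swappable (val x) q ->
  hamming (swapO x q) y = hamming x y +
    (1 - 2 * differ (val x) (val y) q.1) + (1 - 2 * differ (val x) (val y) q.2).
Proof.
move=> xq; rewrite /hamming val_swapO //; case/andP: xq => xs xt.
have st := swap_neq xs xt.
rewrite (bigD1 q.1) //= (bigD1 q.2) 1?eq_sym //=.
rewrite [in RHS](bigD1 q.1) //= [in RHS](bigD1 q.2) 1?eq_sym //=.
have -> : \sum_(e | (e != q.1) && (e != q.2)) differ (swap (val x) q.1 q.2) (val y) e =
  \sum_(e | (e != q.1) && (e != q.2)) differ (val x) (val y) e.
  by apply: eq_bigr => e /andP[/negbTE h1 /negbTE h2]; rewrite /differ ffunE h1 h2.
rewrite /differ !ffunE !eqxx [q.2 == q.1]eq_sym (negbTE st) xs (negbTE xt).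
by case: (val y q.1); case: (val y q.2) => /=; lra.
Qed.

(** Both graphs have [k] edges, so half of the differing positions are occupied in [x] and half are
    vacant. *)
Lemma sum_edg_differ n k (x y : Omega n k) :
  \sum_e edg R (val x) e * differ (val x) (val y) e = hamming x y / 2 /\
  \sum_e (1 - edg R (val x) e) * differ (val x) (val y) e = hamming x y / 2.
Proof.
have E : \sum_e edg R (val x) e * differ (val x) (val y) e -
         \sum_e (1 - edg R (val x) e) * differ (val x) (val y) e = 0.
  rewrite -sumrB; transitivity (\sum_e edg R (val x) e - \sum_e edg R (val y) e).
    rewrite -sumrB; apply: eq_bigr => e _; rewrite /edg /differ.
    by case: (val x e); case: (val y e) => /=; ring.
  by rewrite !sum_edg subrr.
have S : \sum_e edg R (val x) e * differ (val x) (val y) e +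
         \sum_e (1 - edg R (val x) e) * differ (val x) (val y) e = hamming x y.
  by rewrite -big_split /=; apply: eq_bigr => e _; ring.
by split; lra.
Qed.

Lemma edeg_diff_le n (X Y : graph n) e :
  `|edeg R X e - edeg R Y e| <= \sum_f differ X Y f * adj R f e.
Proof.
rewrite !edegE -sumrB; apply: (le_trans (ler_norm_sum _ _ _)).
apply: ler_sum => f _; rewrite -mulrBl normrM (ger0_norm (adj_ge0 _ _ _)).
rewrite ler_wpM2r ?adj_ge0 // /edg /differ; case: (X f); case: (Y f) => /=.
- by rewrite subrr normr0.
- by rewrite subr0 normr1.
- by rewrite sub0r normrN1.
- by rewrite subrr normr0.
Qed.

(** After exchanging the sums, a differing position [f] is counted once for each proposal whose
    present or absent edge is adjacent to [f]. In the regular set there are about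
    [2 n N * (2 p (1 - p))] such proposals, which is how [p (1 - p)] enters the contraction rate. *)
Lemma sum_edeg_diff n k (p beta eta eps : R) (x y : Omega n k) :
  drift_regime n k p beta eta eps -> Gamma p eps x ->
  \sum_(q | swappable (val x) q)
     (`|edeg R (val x) q.2 - edeg R (val y) q.2| +
      `|edeg R (val x) q.1 - edeg R (val y) q.1|) <=
  hamming x y * ('C(n, 2)%:R * (2 * n%:R) * (2 * p * (1 - p) + eps)).
Proof.
move=> H Gx; have N0 := NN_gt0 H; have n2 := nn_ge2 H.
have [kE _ eta0 ep eq _ _ _ eps0 _ _] := H.
pose d e : R := \sum_f differ (val x) (val y) f * adj R f e.
apply: le_trans (_ : \sum_(q | swappable (val x) q) (d q.2 + d q.1) <= _).
  by apply: ler_sum => q _; apply: lerD; exact: edeg_diff_le.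
rewrite big_split /=.
have -> : \sum_(q | swappable (val x) q) d q.2 =
    k%:R * (\sum_t (1 - edg R (val x) t) * d t).
  rewrite -(sum_edg R x) -(eq_bigr _ (fun e _ => mulr1 (edg R (val x) e))).
  rewrite -(sum_swappable (val x) (fun=> 1) d).
  by apply: eq_bigr => q _; rewrite mul1r.
have -> : \sum_(q | swappable (val x) q) d q.1 =
    (\sum_s edg R (val x) s * d s) * ('C(n, 2)%:R - k%:R).
  rewrite -(sum_edgC R x) -(eq_bigr _ (fun e _ => mulr1 (1 - edg R (val x) e))).
  rewrite -(sum_swappable (val x) d (fun=> 1)).
  by apply: eq_bigr => q _; rewrite mulr1.
have swapsum (c : edge n -> R) : \sum_t c t * d t =
    \sum_f differ (val x) (val y) f * (\sum_t c t * adj R t f).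
  under eq_bigr => t _ do rewrite mulr_sumr.
  rewrite exchange_big; apply: eq_bigr => f _; rewrite mulr_sumr.
  by apply: eq_bigr => t _; rewrite (adjC R f t); ring.
rewrite !swapsum /hamming mulr_suml mulr_sumr mulr_suml -big_split /=.
apply: ler_sum => f _; rewrite sum_edgC_adj -edegE.
have -> : k%:R * (differ (val x) (val y) f * (2 * (n%:R - 2) - edeg R (val x) f)) +
  differ (val x) (val y) f * edeg R (val x) f * ('C(n, 2)%:R - k%:R) =
  differ (val x) (val y) f * (k%:R * (2 * (n%:R - 2) - edeg R (val x) f) +
    edeg R (val x) f * ('C(n, 2)%:R - k%:R)) by ring.
rewrite ler_wpM2l ?differ_ge0 // kE.
have -> : 'C(n, 2)%:R * p * (2 * (n%:R - 2) - edeg R (val x) f) +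
    edeg R (val x) f * ('C(n, 2)%:R - 'C(n, 2)%:R * p) =
  'C(n, 2)%:R * (p * (2 * (n%:R - 2) - edeg R (val x) f) + edeg R (val x) f * (1 - p)) by ring.
rewrite -!mulrA ler_pM2l //.
have := GammaP p eps x (ltnW (regime_n H)) => /elimT/(_ Gx)/(_ f).
rewrite ler_norml => /andP[h1 h2].
have p0 : 0 <= p by lra.
have q0 : 0 <= 1 - p by lra.
have g1 : p * (2 * (n%:R - 2) - edeg R (val x) f) <= p * (2 * n%:R * (1 - p + eps)).
  by rewrite ler_wpM2l //; lra.
have g2 : edeg R (val x) f * (1 - p) <= 2 * n%:R * (p + eps) * (1 - p).
  by rewrite ler_wpM2r //; lra.
by lra.
Qed.

End Contraction.

Section Coupling.
Variable R : realType.
Variables (n k : nat) (beta : R) (x y : Omega n k) (g : edge n -> edge n).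
Hypotheses (k0 : (0 < k)%N) (k1 : (k < 'C(n, 2))%N).
Hypotheses (gK : involutive g) (gxy : forall e, val y (g e) = val x e).
Hypothesis gfix : forall e, val x e = val y e -> g e = e.
Implicit Types (q : edge n * edge n) (z w : Omega n k).

Let gq q := (g q.1, g q.2).
Let a1 q : R := accept beta (val x) q.
Let a2 q : R := accept beta (val y) (gq q).
Let am q : R := Num.min (a1 q) (a2 q).
Let r : R := pair_rate R n k.

(* Propose [q] to [x] and [g q] to [y], and accept with the same uniform variable. *)
Definition matched_coupling z w : R := \sum_(q | swappable (val x) q) r *
  (am q * ((z == swapO x q)%:R * (w == swapO y (gq q))%:R) +
   (a1 q - am q) * ((z == swapO x q)%:R * (w == y)%:R) +
   (a2 q - am q) * ((z == x)%:R * (w == swapO y (gq q))%:R) +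
   (1 - a1 q - a2 q + am q) * ((z == x)%:R * (w == y)%:R)).

Lemma swappable_matched q : swappable (val y) (gq q) = swappable (val x) q.
Proof. by rewrite /swappable /= !gxy. Qed.

Lemma min_accept_facts q : [/\ 0 <= am q, am q <= a1 q, am q <= a2 q &
  0 <= 1 - a1 q - a2 q + am q].
Proof.
have h1 := accept_le1 beta (val x) q; have h2 := accept_le1 beta (val y) (gq q).
have h3 := accept_ge0 beta (val x) q; have h4 := accept_ge0 beta (val y) (gq q).
rewrite /am /a1 /a2; case: (lerP (accept beta (val x) q) (accept beta (val y) (gq q))) => h.
  by split; rewrite ?lexx // addrAC subrK subr_ge0.
by split; rewrite ?lexx ?(ltW h) // subrK subr_ge0.
Qed.

Lemma matched_coupling_ge0 z w : 0 <= matched_coupling z w.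
Proof.
apply: sumr_ge0 => q _; have [m0 m1 m2 m3] := min_accept_facts q.
apply: mulr_ge0; first exact/ltW/pair_rate_gt0.
by rewrite !addr_ge0 // mulr_ge0 ?mulr_ge0 ?subr_ge0 ?ler0n.
Qed.

Lemma matched_coupling_expect (h : Omega n k -> Omega n k -> R) :
  \sum_z \sum_w matched_coupling z w * h z w =
  \sum_(q | swappable (val x) q) r *
    (am q * h (swapO x q) (swapO y (gq q)) + (a1 q - am q) * h (swapO x q) y +
     (a2 q - am q) * h x (swapO y (gq q)) + (1 - a1 q - a2 q + am q) * h x y).
Proof.
have pt (a b : Omega n k) : \sum_z \sum_w ((z == a)%:R * (w == b)%:R) * h z w = h a b.
  under eq_bigr => z _ do under eq_bigr => w _ do rewrite -mulrA.
  under eq_bigr => z _ do rewrite -mulr_sumr (sum_delta (h z)).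
  by rewrite (sum_delta (fun z => h z b)).
rewrite /matched_coupling.
under eq_bigr => z _ do under eq_bigr => w _ do rewrite mulr_suml.
under eq_bigr => z _ do rewrite exchange_big.
rewrite exchange_big; apply: eq_bigr => q _ /=.
rewrite -!pt !mulr_sumr -!big_split /= mulr_sumr; apply: eq_bigr => z _.
rewrite !mulr_sumr -!big_split /= mulr_sumr; apply: eq_bigr => w _.
ring.
Qed.

Lemma matched_coupling_fst z : \sum_w matched_coupling z w = kawasaki beta x z.
Proof.
rewrite kawasakiE // /matched_coupling exchange_big; apply: eq_bigr => q _ /=.
rewrite -mulr_sumr; congr (_ * _).
have one (b : Omega n k) : \sum_w (w == b)%:R = 1 :> R.
  by rewrite (bigD1 b) //= eqxx big1 ?addr0 // => w /negbTE->.
rewrite !big_split /= -!mulr_sumr !one -/(a1 q); ring.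
Qed.

Lemma matched_coupling_snd w : \sum_z matched_coupling z w = kawasaki beta y w.
Proof.
rewrite kawasakiE // /matched_coupling exchange_big /=.
have gqK : involutive gq by move=> [s t]; rewrite /gq /= !gK.
rewrite [RHS](reindex gq) /=; last by apply: onW_bij; apply: inv_bij.
apply: eq_big => [q|q _]; first by rewrite swappable_matched.
rewrite -mulr_sumr; congr (_ * _).
have one (b : Omega n k) (c : R) : \sum_z (z == b)%:R * c = c.
  by rewrite (sum_delta (fun=> c)).
rewrite !big_split /= -!mulr_sumr !one -/(a2 q); ring.
Qed.

Let d e : R := differ R (val x) (val y) e.

Lemma differ_matched e : d (g e) = d e.
Proof.
rewrite /d /differ gxy; have -> : val x (g e) = val y e by rewrite -gxy gK.
by rewrite eq_sym.
Qed.

(** If both copies move, every touched discrepancy is removed together with its partner. The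
    exception is a proposal whose two edges are matched to each other: the copies then exchange
    these positions and still differ at both, whence the term with coefficient 4. *)
Lemma hamming_matched q : swappable (val x) q ->
  [/\ hamming R (swapO x q) y = hamming R x y + (1 - 2 * d q.1) + (1 - 2 * d q.2),
      hamming R x (swapO y (gq q)) = hamming R x y + (1 - 2 * d q.1) + (1 - 2 * d q.2) &
      hamming R (swapO x q) (swapO y (gq q)) =
        hamming R x y - 2 * d q.1 - 2 * d q.2 + 4 * (g q.1 == q.2)%:R].
Proof.
move=> xq; have yq : swappable (val y) (gq q) by rewrite swappable_matched.
split; first exact: hamming_swapO.
  rewrite hammingC (hamming_swapO R _ yq) hammingC /= -(differ_matched q.1) -(differ_matched q.2).
  by rewrite /d /differ ![val y _ == _]eq_sym.
rewrite hammingC (hamming_swapO R _ yq) hammingC (hamming_swapO R _ xq) -/(d q.1) -/(d q.2).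
rewrite val_swapO // /d /differ /= !gxy !ffunE.
case/andP: (xq) => xs xt; rewrite xs (negbTE xt).
have gst : (g q.2 == q.1) = (g q.1 == q.2).
  by apply/eqP/eqP => <-; rewrite gK.
have xg e : val x (g e) = val y e by rewrite -gxy gK.
have fixP e : (g e == e) = (val x e == val y e).
  apply/eqP/eqP => [E|]; last exact: gfix.
  by rewrite -{2}E gxy.
rewrite !xg gst !fixP xs (negbTE xt).
have [E|ne] := eqVneq (g q.1) q.2.
  have := gxy q.1; rewrite E xs => y2; have := gxy q.2; rewrite -{1}E gK (negbTE xt) => y1.
  by rewrite y1 y2 /=; lra.
by case: (val y q.1); case: (val y q.2) => /=; lra.
Qed.

(** A proposal at two agreeing positions harms only if exactly one copy accepts, at cost 2; [A]
    bounds this. Each discrepancy touched by a proposal gains at least [2 m] on average, giving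
    [m N] times the distance in total. Proposals between matched positions gain nothing; they are
    half as many as the discrepancies, which gives the last term. *)
Lemma matched_hamming_bound (m A : R) :
  (forall q, m <= a1 q) -> (forall q, m <= a2 q) ->
  \sum_(q | swappable (val x) q) (1 - d q.1) * (1 - d q.2) * `|a1 q - a2 q| <= A ->
  \sum_z \sum_w matched_coupling z w * hamming R z w <=
  hamming R x y + r * (2 * A - m * 'C(n, 2)%:R * hamming R x y + 2 * hamming R x y).
Proof.
move=> m1 m2 HA; rewrite matched_coupling_expect.
have r0 : 0 < r by apply: pair_rate_gt0.
have d01 e : d e = 0 \/ d e = 1.
  by rewrite /d /differ; case: (_ != _); [right|left].
have step : \sum_(q | swappable (val x) q) r *
    (am q * hamming R (swapO x q) (swapO y (gq q)) + (a1 q - am q) * hamming R (swapO x q) y +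
     (a2 q - am q) * hamming R x (swapO y (gq q)) + (1 - a1 q - a2 q + am q) * hamming R x y)
  <= \sum_(q | swappable (val x) q) (r * hamming R x y +
      r * (2 * ((1 - d q.1) * (1 - d q.2) * `|a1 q - a2 q|) - 2 * m * (d q.1 * 1 + 1 * d q.2)
           + 4 * ((g q.1 == q.2)%:R))).
  apply: ler_sum => q xq; have [-> -> ->] := hamming_matched xq.
  have [h0 h1 h2 h3] := min_accept_facts q.
  have mm : m <= am q by rewrite /am le_min m1 m2.
  have am1 : am q <= 1 by apply: le_trans h1 _; exact: accept_le1.
  have ab : a1 q + a2 q - 2 * am q = `|a1 q - a2 q|.
    by rewrite /am; case: (lerP (a1 q) (a2 q)) => _; ring.
  rewrite -mulrDr ler_pM2l // -ab.
  have G0 : 0 <= (g q.1 == q.2)%:R :> R by [].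
  have G1 : am q * (g q.1 == q.2)%:R <= (g q.1 == q.2)%:R by rewrite ler_piMl.
  by case: (d01 q.1) => ->; case: (d01 q.2) => ->; lra.
apply: le_trans step _.
rewrite big_split /= -[\sum_(q | _) r * hamming R x y]mulr_suml card_swappable // mul1r lerD2l.
rewrite -mulr_sumr ler_pM2l // big_split sumrB /= -!mulr_sumr big_split /=.
have [S1 S2] := sum_edg_differ R x y.
rewrite (sum_swappable (val x) d (fun=> 1)) (sum_swappable (val x) (fun=> 1) d).
rewrite [\sum_s edg R (val x) s * 1](eq_bigr _ (fun e _ => mulr1 (edg R (val x) e))).
rewrite [\sum_t (1 - edg R (val x) t) * 1](eq_bigr _ (fun e _ => mulr1 (1 - edg R (val x) e))).
rewrite sum_edg sum_edgC S1 S2.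
have G : \sum_(q | swappable (val x) q) (g q.1 == q.2)%:R <= hamming R x y / 2.
  rewrite -S1 big_mkcond /= -(pair_big predT predT (fun s t =>
    if swappable (val x) (s, t) then (g s == t)%:R else 0 : R)) /=.
  apply: ler_sum => s _; rewrite (bigD1 (g s)) //= [X in _ + X]big1 ?addr0; last first.
    by move=> t /negbTE; rewrite eq_sym => ->; rewrite if_same.
  rewrite eqxx /swappable /= /differ /edg.
  have -> : val x (g s) = val y s by rewrite -gxy gK.
  by case: (val x s); case: (val y s); rewrite /= ?mul1r ?mul0r.
lra.
Qed.

End Coupling.

Section ContractionCoupling.
Variable R : realType.

Lemma swap_energy_common n k (beta : R) (x y : Omega n k) q : (0 < n)%N -> 0 <= beta ->
  `|accept beta (val x) q - accept beta (val y) q| <=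
  beta / (2 * n%:R) * (`|edeg R (val x) q.2 - edeg R (val y) q.2| +
                       `|edeg R (val x) q.1 - edeg R (val y) q.1|).
Proof.
move=> n0 b0; have nn : 0 < n%:R :> R by rewrite ltr0n.
apply: (le_trans (sigmoid_lip _ _)).
rewrite ler_pdivrMr // /swap_energy -mulrBr normrM ger0_norm; last first.
  by rewrite divr_ge0 ?mulr_ge0 // ltW.
have -> : beta / (2 * n%:R) * (`|edeg R (val x) q.2 - edeg R (val y) q.2| +
    `|edeg R (val x) q.1 - edeg R (val y) q.1|) * 4 =
  2 * beta / n%:R * (`|edeg R (val x) q.2 - edeg R (val y) q.2| +
    `|edeg R (val x) q.1 - edeg R (val y) q.1|) by field; rewrite gt_eqF.
rewrite ler_wpM2l ?divr_ge0 ?mulr_ge0 ?(ltW nn) //.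
have -> : edeg R (val x) q.2 - adj R q.1 q.2 - edeg R (val x) q.1 -
  (edeg R (val y) q.2 - adj R q.1 q.2 - edeg R (val y) q.1) =
  (edeg R (val x) q.2 - edeg R (val y) q.2) - (edeg R (val x) q.1 - edeg R (val y) q.1) by ring.
exact: ler_normB.
Qed.

(** Split decisions cost about [4 beta p (1 - p)] and the gain is about [1 / 2], per discrepancy and
    in units of [pair_rate] times [N]; the condition defining the regime leaves a margin. *)
Lemma contraction_coupling n k (p beta eta eps : R) (x y : Omega n k) :
  drift_regime n k p beta eta eps -> Gamma p eps x -> Gamma p eps y ->
  exists J : Omega n k -> Omega n k -> R,
  [/\ forall z w, 0 <= J z w, forall z, \sum_w J z w = kawasaki beta x z,
      forall w, \sum_z J z w = kawasaki beta y w &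
      \sum_z \sum_w J z w * hamming R z w <=
        (1 - eta / (2 * 'C(n, 2)%:R)) * hamming R x y].
Proof.
move=> H Gx Gy; have k0 := k_pos H; have k1 := k_small H.
have [g [gK gxy gfix]] : exists g : edge n -> edge n, [/\ involutive g,
    forall e, val y (g e) = val x e & forall e, val x e = val y e -> g e = e].
  by apply: balanced_matching; rewrite -!/(nedges _) !nedges_val.
exists (matched_coupling beta x y g); split.
- exact: matched_coupling_ge0.
- exact: matched_coupling_fst.
- exact: matched_coupling_snd.
have N0 := NN_gt0 H; have n2 := nn_ge2 H; have n0 := ltnW (regime_n H).
have [w0 wn wE we] := w_bounds H.
have [kE _ eta0 ep eq b0 be crit eps0 eple large] := H.
pose S := hamming R x y * ('C(n, 2)%:R * (2 * n%:R) * (2 * p * (1 - p) + eps)).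
have h0 : 0 <= hamming R x y by exact: hamming_ge0.
have bn : 0 <= beta / (2 * n%:R) by rewrite divr_ge0 ?mulr_ge0.
have HA : \sum_(q | swappable (val x) q) (1 - differ R (val x) (val y) q.1) *
    (1 - differ R (val x) (val y) q.2) *
    `|accept beta (val x) q - accept beta (val y) (g q.1, g q.2)| <= beta / (2 * n%:R) * S.
  apply: le_trans (ler_wpM2l bn (sum_edeg_diff y H Gx)).
  rewrite mulr_sumr; apply: ler_sum => q _.
  have big0 : 0 <= beta / (2 * n%:R) * (`|edeg R (val x) q.2 - edeg R (val y) q.2| +
    `|edeg R (val x) q.1 - edeg R (val y) q.1|) by rewrite mulr_ge0 ?addr_ge0.
  rewrite /differ; have [/gfix->|_] := eqVneq (val x q.1) (val y q.1); last first.
    by rewrite subrr !mul0r.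
  have [/gfix->|_] := eqVneq (val x q.2) (val y q.2); last by rewrite subrr mulr0 mul0r.
  by rewrite !subr0 !mul1r -surjective_pairing swap_energy_common.
have := @matched_hamming_bound R n k beta x y g k0 k1 gK gxy gfix
  (2^-1 - accept_dev n beta eps) _ _ _ HA.
move=> /(_ _ _)/le_trans; apply.
- by move=> q; case/andP: (accept_bounds H q Gx).
- by move=> q; case/andP: (accept_bounds H (g q.1, g q.2) Gy).
have p0 : 0 < p by lra.
have q0 : 0 < 1 - p by lra.
have -> : pair_rate R n k = ('C(n, 2)%:R ^+ 2 * (p * (1 - p)))^-1.
  rewrite /pair_rate kE; congr (_^-1); ring.
rewrite /S; set N : R := 'C(n, 2)%:R in N0 wE *.
have -> : 2 * (beta / (2 * n%:R) * (hamming R x y * (N * (2 * n%:R) * (2 * p * (1 - p) + eps)))) - (2^-1 - accept_dev n beta eps) * N * hamming R x y + 2 * hamming R x y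
  = hamming R x y * N * (2 * beta * (2 * p * (1 - p) + eps) - (2^-1 - accept_dev n beta eps) + 2 / N).
  by field; rewrite !gt_eqF //; lra.
have wN : 2 / N <= 4 / (n%:R - 1).
  rewrite ler_pdivrMr // mulrC -wE; lra.
have bb : 16 * (beta * eps) <= eta.
  have h1 : beta * (16 * eps) <= beta * eta ^+ 2 by rewrite ler_wpM2l.
  have h2 : beta * eta ^+ 2 <= 1 * eta by rewrite expr2 mulrA ler_wpM2r // ltW.
  lra.
have bd : 16 * (beta / n%:R) <= eta * eps.
  rewrite mulrA ler_pdivrMr; last by lra.
  have h1 : 64 * beta <= n%:R * eta ^+ 2 * eps * beta by rewrite ler_wpM2r.
  have h2 : (beta * eta) * (n%:R * eta * eps) <= 1 * (n%:R * eta * eps).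
    by rewrite ler_wpM2r // !mulr_ge0 // ltW.
  clear -h1 h2 b0; rewrite expr2 in h1; lra.
have ee : eta * eps <= eta.
  rewrite ler_piMr ?(ltW eta0) //.
  have : eta <= 1 by lra.
  by clear -eple eta0; rewrite expr2 in eple; nra.
(* Of the margin [eta] in [crit], half remains after the errors of order [beta eps], [beta / n] and
   [1 / N] are paid. *)
have br : 2 * beta * (2 * p * (1 - p) + eps) - (2^-1 - accept_dev n beta eps) + 2 / N <= - (eta / 2).
  by clear -wN bb bd ee we crit eta0; rewrite /accept_dev; lra.
have c1 : 1 <= (p * (1 - p))^-1.
  by rewrite invf_ge1 ?mulr_gt0 // mulr_ile1 //; clear - p0 q0; lra.
set b := _ + 2 / N in br *.
have -> : hamming R x y + (N ^+ 2 * (p * (1 - p)))^-1 * (hamming R x y * N * b) =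
  (1 + (p * (1 - p))^-1 * b / N) * hamming R x y.
  by field; rewrite !gt_eqF.
have -> : eta / (2 * N) = eta / 2 / N by field; rewrite gt_eqF.
rewrite ler_wpM2r // lerD2l -mulNr ler_pM2r ?invr_gt0 //.
have hb : (p * (1 - p))^-1 * b <= 1 * b.
  by rewrite ler_wnM2r //; apply: le_trans br _; rewrite oppr_le0 divr_ge0 // ltW.
lra.
Qed.

End ContractionCoupling.

(** * Point masses of the binomial law *)

Section BinomialMass.
Variable R : realType.

Definition bin_mass (M : nat) (p : R) (m : nat) : R :=
  'C(M, m)%:R * p ^+ m * (1 - p) ^+ (M - m).

Lemma bin_mass_ge0 M p m : 0 <= p <= 1 -> 0 <= bin_mass M p m.
Proof. by move=> /andP[p0 p1]; rewrite /bin_mass !mulr_ge0 ?exprn_ge0 ?subr_ge0. Qed.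

Lemma bin_mass_sum M p : \sum_(m < M.+1) bin_mass M p m = 1.
Proof.
have := exprDn (1 - p) p M; rewrite subrK expr1n => E; rewrite [RHS]E.
by apply: eq_bigr => m _; rewrite /bin_mass -[RHS]mulr_natl; ring.
Qed.

Lemma bin_massS M p m : (m < M)%N ->
  bin_mass M p m.+1 * (m.+1%:R * (1 - p)) = bin_mass M p m * ((M%:R - m%:R) * p).
Proof.
move=> mM; rewrite /bin_mass exprS.
have -> : (M - m)%N = (M - m.+1).+1 by rewrite subnSK.
rewrite exprS.
have E : 'C(M, m.+1)%:R * m.+1%:R = 'C(M, m)%:R * (M%:R - m%:R) :> R.
  by rewrite -natrB 1?ltnW // -!natrM mulnC mul_bin_left mulnC.
have -> : 'C(M, m.+1)%:R * (p * p ^+ m) * (1 - p) ^+ (M - m.+1) * (m.+1%:R * (1 - p)) =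
  ('C(M, m.+1)%:R * m.+1%:R) * (p * p ^+ m) * (1 - p) ^+ (M - m.+1) * (1 - p) by ring.
rewrite E; ring.
Qed.

Lemma bin_mass_gt0 M p m : 0 < p < 1 -> (m <= M)%N -> 0 < bin_mass M p m.
Proof.
move=> /andP[p0 p1] mM; rewrite /bin_mass !mulr_gt0 ?exprn_gt0 ?subr_gt0 //.
by rewrite ltr0n bin_gt0.
Qed.

(** The hypotheses place [m] at a mode, because the masses increase up to [p (M + 1)] and decrease
    afterwards; the largest of [M + 1] masses with sum 1 is at least [1 / (M + 1)]. *)
Lemma bin_mass_mode M p m : 0 < p < 1 -> (m <= M)%N ->
  m%:R <= p * M.+1%:R -> p * M.+1%:R <= m.+1%:R ->
  1 <= M.+1%:R * bin_mass M p m.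
Proof.
move=> p01 mM lo hi; have /andP[p0 p1] := p01.
have up j : (j < M)%N -> j.+1%:R <= p * M.+1%:R -> bin_mass M p j <= bin_mass M p j.+1.
  move=> jM h; have b0 := bin_mass_gt0 p01 (ltnW jM).
  have q0 : 0 < j.+1%:R * (1 - p) by rewrite mulr_gt0 ?ltr0n ?subr_gt0.
  rewrite -(ler_pM2r q0) bin_massS // ler_pM2l //.
  by move: h; rewrite -!natr1; lra.
have down j : (j < M)%N -> p * M.+1%:R <= j.+1%:R -> bin_mass M p j.+1 <= bin_mass M p j.
  move=> jM h; have b0 := bin_mass_gt0 p01 (ltnW jM).
  have q0 : 0 < j.+1%:R * (1 - p) by rewrite mulr_gt0 ?ltr0n ?subr_gt0.
  rewrite -(ler_pM2r q0) bin_massS // ler_pM2l //.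
  by move: h; rewrite -!natr1; lra.
have left d : (d <= m)%N -> bin_mass M p (m - d) <= bin_mass M p m.
  elim: d => [|d IH] dm; first by rewrite subn0.
  apply: le_trans (IH (ltnW dm)).
  have E : (m - d)%N = (m - d.+1).+1 by rewrite subnSK.
  rewrite E; apply: up; first by rewrite -E (leq_trans (leq_subr _ _)).
  by rewrite -E; apply: le_trans lo; rewrite ler_nat leq_subr.
have right d : (m + d <= M)%N -> bin_mass M p (m + d) <= bin_mass M p m.
  elim: d => [|d IH] dm; first by rewrite addn0.
  rewrite addnS in dm *; apply: le_trans (IH (ltnW dm)); apply: down => //.
  by apply: (le_trans hi); rewrite ler_nat ltnS leq_addr.
rewrite -[leLHS](bin_mass_sum M p) -[X in X%:R * _]card_ord mulr_natl -sumr_const.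
apply: ler_sum => j _; have jM : (j <= M)%N by rewrite -ltnS.
case: (leqP j m) => jm; first by rewrite -(subKn jm) left // leq_subr.
by rewrite -(subnKC (ltnW jm)) right // subnKC // ltnW.
Qed.

(** The mass times [e^{t (m - p M)}] is a single term of the binomial expansion of the [M]-th power
    of the moment generating function. The value of [t] minimises the resulting exponent. *)
Lemma bin_mass_chernoff M p b m : 0 < p < 1 -> 0 < b -> subgauss p b ->
  (0 < M)%N -> (m <= M)%N ->
  bin_mass M p m <= expR (- (b * (m%:R - p * M%:R) ^+ 2 / M%:R)).
Proof.
move=> /andP[p0 p1] b0 sg M0 mM; have MR : 0 < M%:R :> R by rewrite ltr0n.
pose t := 2 * b * (m%:R - p * M%:R) / M%:R.
have H : bin_mass M p m * expR (t * (m%:R - p * M%:R)) <= expR (t ^+ 2 / (4 * b)) ^+ M.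
  apply: le_trans (_ : (p * expR (t * (1 - p)) + (1 - p) * expR (- (t * p))) ^+ M <= _); last first.
    apply: lerXn2r; rewrite ?nnegrE ?expR_ge0 //.
    by rewrite addr_ge0 ?mulr_ge0 ?expR_ge0 ?subr_ge0 // ltW.
  rewrite [X in X ^+ M]addrC exprDn (bigD1 (Ordinal (mM : (m < M.+1)%N))) //=.
  rewrite -[leLHS]addr0; apply: lerD; last first.
    apply: sumr_ge0 => i _; by rewrite mulrn_wge0 // mulr_ge0 // exprn_ge0 // mulr_ge0 ?expR_ge0 ?subr_ge0 // ltW.
  rewrite !exprMn -!expRM_natl le_eqVlt; apply/orP; left; apply/eqP.
  have -> : t * (m%:R - p * M%:R) = (M - m)%:R * - (t * p) + m%:R * (t * (1 - p)).
    by rewrite natrB //; ring.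
  by rewrite expRD /bin_mass -mulr_natl; ring.
rewrite -expRM_natl in H.
rewrite -(ler_pM2r (expR_gt0 (t * (m%:R - p * M%:R)))); apply: le_trans H _.
rewrite -expRD ler_expR le_eqVlt; apply/orP; left; apply/eqP.
by rewrite /t; field; rewrite !gt_eqF.
Qed.

End BinomialMass.

(** * Squared degree deviations under the Gibbs measure *)

Section DegreeSequences.
Variable R : realType.

Lemma card_Omega n k : #|{: Omega n k}| = 'C('C(n, 2), k).
Proof.
rewrite card_sig -card_edge -card_draws.
pose f (A : {set edge n}) : graph n := [ffun e => e \in A].
have fK : cancel f (fun X => [set e | X e]%SET).
  by move=> A; apply/setP => e; rewrite inE ffunE.
rewrite -(card_imset _ (can_inj fK)); apply: eq_card => X; rewrite !inE.
apply/idP/imsetP => [kX|[A]].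
  exists [set e | X e]%SET; last by apply/ffunP => e; rewrite ffunE inE.
  by rewrite inE -(eqP kX) /nedges cardsE.
rewrite inE => /eqP <- ->; rewrite /nedges; apply/eqP/eq_card => e.
by rewrite !inE ffunE.
Qed.

Definition dev n (p : R) (X : graph n) (v : 'I_n) : R := degR R X v - (n%:R - 1) * p.

Definition sqdev n (p : R) (X : graph n) : R := \sum_v dev p X v ^+ 2.

Lemma sum_dev n k (p : R) (x : Omega n k) : k%:R = 'C(n, 2)%:R * p ->
  \sum_v dev p (val x) v = 0.
Proof.
move=> kE; rewrite sumrB sum_deg nedges_val sumr_const card_ord kE binR2 -[X in _ - X]mulr_natl; by field.
Qed.

(** With the number of edges fixed the deviations sum to zero, so centring the squared degrees only
    changes a constant, which cancels in [mu]. *)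
Lemma hamiltonian_sqdev n k (p beta : R) (x : Omega n k) : k%:R = 'C(n, 2)%:R * p ->
  hamiltonian beta (val x) = beta / n%:R * sqdev p (val x) +
    beta / n%:R * (n%:R * ((n%:R - 1) * p) ^+ 2 - 2 * k%:R).
Proof.
move=> kE; rewrite hamiltonian_degE nedges_val -mulrDr; congr (_ * _).
have -> : sqdev p (val x) = \sum_v degR R (val x) v ^+ 2 -
    2 * ((n%:R - 1) * p) * \sum_v degR R (val x) v + n%:R * ((n%:R - 1) * p) ^+ 2.
  have -> : n%:R * ((n%:R - 1) * p) ^+ 2 = \sum_(v < n) ((n%:R - 1) * p) ^+ 2.
    by rewrite sumr_const card_ord mulr_natl.
  rewrite mulr_sumr -sumrB -big_split; apply: eq_bigr => v _ /=.
  by rewrite /dev; ring.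
by rewrite sum_deg nedges_val kE binR2; by field.
Qed.

Lemma sum_edge_weight n (h : 'I_n -> R) :
  \sum_(e : edge n) \sum_(v in val e) h v = (n%:R - 1) * \sum_v h v.
Proof.
under eq_bigr => e _ do rewrite big_mkcond /=.
rewrite exchange_big mulr_sumr; apply: eq_bigr => v _ /=.
rewrite -big_mkcond /= sumr_const.
have -> : #|[pred e : edge n | v \in val e]| = n.-1 by exact: card_edges_through.
rewrite -[LHS]mulr_natl; congr (_ * _).
have n0 : (0 < n)%N by apply: leq_ltn_trans (ltn_ord v).
by rewrite -[in RHS](prednK n0) -natr1 addrK.
Qed.

(** Expanding the square, a vertex lies on [n - 1] edges and two distinct vertices on exactly
    one. *)
Lemma sum_edge_weight_sq n (h : 'I_n -> R) :
  \sum_(e : edge n) (\sum_(v in val e) h v) ^+ 2 =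
  (n%:R - 2) * \sum_v h v ^+ 2 + (\sum_v h v) ^+ 2.
Proof.
have -> : \sum_(e : edge n) (\sum_(v in val e) h v) ^+ 2 =
  \sum_v \sum_w h v * h w * (#|[pred e : edge n | (v \in val e) && (w \in val e)]|)%:R.
  transitivity (\sum_(e : edge n) \sum_v \sum_w h v * h w * ((v \in val e) && (w \in val e))%:R).
    apply: eq_bigr => e _; rewrite expr2 big_mkcond mulr_suml; apply: eq_bigr => v _ /=.
    rewrite mulr_sumr; apply: eq_bigr => w _.
    by case: (v \in _); case: (w \in _); rewrite /= ?mulr1 ?mulr0 ?mul0r.
  rewrite exchange_big; apply: eq_bigr => v _ /=.
  rewrite exchange_big; apply: eq_bigr => w _ /=.
  by rewrite -mulr_sumr card_natr.
have -> : (\sum_v h v) ^+ 2 = \sum_v \sum_w h v * h w.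
  by rewrite expr2 mulr_suml; apply: eq_bigr => v _; rewrite mulr_sumr.
rewrite mulr_sumr -big_split /=; apply: eq_bigr => v _.
have n0 : (0 < n)%N by apply: leq_ltn_trans (ltn_ord v).
rewrite (bigD1 v) //= [in RHS](bigD1 v) //=.
have -> : #|[pred e : edge n | (v \in val e) && (v \in val e)]| = n.-1.
  by rewrite -(card_edges_through v); apply: eq_card => e; rewrite !inE andbb.
have -> : \sum_(w | w != v) h v * h w * (#|[pred e : edge n | (v \in val e) && (w \in val e)]|)%:R
  = \sum_(w | w != v) h v * h w.
  by apply: eq_bigr => w wv; rewrite card_edges_through2 1?eq_sym // mulr1.
have -> : n.-1%:R = n%:R - 1 :> R by rewrite -[in RHS](prednK n0) -natr1 addrK.
ring.
Qed.

(* Chernoff bound for the product measure, with the dual weight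
   [h v = (2 b / n) dev x0 v]. *)
Lemma degree_class_bound n k (p b : R) (x0 : Omega n k) :
  0 < p < 1 -> 0 < b -> subgauss p b -> (2 <= n)%N -> k%:R = 'C(n, 2)%:R * p ->
  \sum_(x : Omega n k | [forall v, deg (val x) v == deg (val x0) v])
    p ^+ k * (1 - p) ^+ ('C(n, 2) - k) <= expR (- (b * sqdev p (val x0) / n%:R)).
Proof.
move=> /andP[p0 p1] b0 sg n2 kE; have nn : 0 < n%:R :> R by rewrite ltr0n ltnW.
pose h v := 2 * b / n%:R * dev p (val x0) v.
pose he (e : edge n) : R := \sum_(v in val e) h v.
pose wt (e : edge n) (c : bool) : R :=
  if c then p * expR (he e * (1 - p)) else (1 - p) * expR (- (he e * p)).
have wt0 e c : 0 <= wt e c.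
  by rewrite /wt; case: c; rewrite mulr_ge0 ?expR_ge0 ?subr_ge0 // ltW.
have sh : \sum_v h v = 0 by rewrite -mulr_sumr (sum_dev x0 kE) mulr0.
(* The sum over all graphs factorises over the edges. As the weights [h] sum to zero, only
   [(n - 2) * \sum_v h v ^+ 2] survives in the exponent. *)
have total : \sum_(X : graph n) \prod_e wt e (X e) <= expR (b * sqdev p (val x0) / n%:R).
  rewrite -(bigA_distr_bigA wt) /=.
  apply: le_trans (_ : \prod_(e : edge n) expR (he e ^+ 2 / (4 * b)) <= _).
    apply: ler_prod => e _; rewrite (bigD1 true) //= (big_pred1 false) /=; last by case.
    by rewrite addr_ge0 ?(wt0 e true) ?(wt0 e false) //= sg.
  rewrite -expR_sum ler_expR -mulr_suml sum_edge_weight_sq sh expr0n /= addr0.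
  have -> : \sum_v h v ^+ 2 = (2 * b / n%:R) ^+ 2 * sqdev p (val x0).
    by rewrite mulr_sumr; apply: eq_bigr => v _; rewrite exprMn.
  have S0 : 0 <= sqdev p (val x0) by apply: sumr_ge0 => v _; exact: sqr_ge0.
  have -> : (n%:R - 2) * ((2 * b / n%:R) ^+ 2 * sqdev p (val x0)) / (4 * b) =
    ((n%:R - 2) / n%:R) * (b * sqdev p (val x0) / n%:R) by field; rewrite !gt_eqF.
  rewrite ler_piMl ?divr_ge0 ?mulr_ge0 ?(ltW b0) ?(ltW nn) // ler_pdivrMr // mul1r; lra.
(* On the degree class of [x0] the tilting factor is constant, because the exponent depends on the
   graph only through its degrees. *)
have term (x : Omega n k) : [forall v, deg (val x) v == deg (val x0) v] ->
  \prod_e wt e (val x e) = p ^+ k * (1 - p) ^+ ('C(n, 2) - k) *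
     expR (2 * b * sqdev p (val x0) / n%:R).
  move=> /forallP Hd.
  have -> : \prod_e wt e (val x e) =
     \prod_e ((if val x e then p else 1 - p) * expR (he e * (edg R (val x) e - p))).
    apply: eq_bigr => e _; rewrite /wt /edg; case: (val x e) => //=.
    by rewrite sub0r mulrN.
  rewrite big_split /= -expR_sum; congr (_ * expR _).
    rewrite (bigID (fun e => val x e)) /=; congr (_ * _).
      rewrite (eq_bigr (fun=> p)) => [|e ->//]; rewrite prodr_const.
      transitivity (p ^+ nedges (val x)); last by rewrite nedges_val.
      by congr (_ ^+ _); apply: eq_card.
    rewrite (eq_bigr (fun=> 1 - p)) => [|e /negbTE->//]; rewrite prodr_const.
    transitivity ((1 - p) ^+ ('C(n, 2) - nedges (val x))); last by rewrite nedges_val.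
    congr (_ ^+ _); rewrite -card_edge /nedges -(cardC [pred e | val x e]) addKn.
    by apply: eq_card.
  under eq_bigr => e _ do rewrite mulrBr.
  rewrite sumrB -mulr_suml sum_edge_weight sh mulr0 mul0r subr0.
  have -> : \sum_e he e * edg R (val x) e = \sum_v h v * degR R (val x) v.
    rewrite /he; under eq_bigr => e _ do rewrite big_mkcond mulr_suml /=.
    rewrite exchange_big; apply: eq_bigr => v _ /=; rewrite degRE mulr_sumr.
    by apply: eq_bigr => e _; case: (v \in _); rewrite ?mulr1 ?mulr0 ?mul0r.
  have -> : \sum_v h v * degR R (val x) v = \sum_v (h v * dev p (val x0) v + h v * ((n%:R - 1) * p)).
    by apply: eq_bigr => v _; rewrite /dev /degR (eqP (Hd v)); ring.
  rewrite big_split /= -mulr_suml sh mul0r addr0 /sqdev mulr_sumr mulr_suml.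
  by apply: eq_bigr => v _; rewrite /h; ring.
set c := p ^+ k * _ in term *.
rewrite -(ler_pM2r (expR_gt0 (2 * b * sqdev p (val x0) / n%:R))) -expRD mulr_suml.
have -> : - (b * sqdev p (val x0) / n%:R) + 2 * b * sqdev p (val x0) / n%:R =
   b * sqdev p (val x0) / n%:R by ring.
apply: le_trans total.
rewrite (eq_bigr _ (fun x Hx => esym (term x Hx))).
rewrite [leRHS](bigID (fun X => (nedges X == k) && [forall v, deg X v == deg (val x0) v])) /=.
rewrite -[leLHS]addr0; apply: lerD; last by apply: sumr_ge0 => X _; apply: prodr_ge0.
rewrite le_eqVlt; apply/orP; left; apply/eqP.
rewrite [RHS](reindex_onto (fun x : Omega n k => val x) (fun X => insubd x0 X)) /=; last first.
  by move=> X /andP[hX _]; rewrite val_insubd hX.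
apply: eq_bigl => x; rewrite valKd eqxx andbT.
by rewrite (valP x).
Qed.

End DegreeSequences.

Section SquaredDeviation.
Variable R : realType.

Lemma deg_le n (X : graph n) v : (deg X v <= n.-1)%N.
Proof.
rewrite -(card_edges_through v); apply: subset_leq_card.
by apply/fintype.subsetP => e; rewrite !inE => /andP[].
Qed.

(** On a degree class of squared deviation [S] the Gibbs weight is proportional to
    [exp (beta S / n)], against a class probability of at most [exp (- b S / n)]. The prefactor
    counts the possible degree sequences and bounds the partition function from below. *)
Lemma mu_sqdev_tail n k (p beta b theta : R) :
  0 < p < 1 -> 0 < b -> 0 <= beta <= b -> subgauss p b -> (2 <= n)%N ->
  k%:R = 'C(n, 2)%:R * p -> 0 <= theta ->
  mass (@mu R n k beta) (fun x => theta * n%:R ^+ 3 < sqdev p (val x)) <=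
  n.+1%:R ^+ n * ('C(n, 2)%:R + 1) * expR (- ((b - beta) * theta * n%:R ^+ 2)).
Proof.
move=> p01 b0 /andP[be0 beb] sg n2 kE th0.
have /andP[p0 p1] := p01; have nn : 0 < n%:R :> R by rewrite ltr0n ltnW.
set bad := fun x : Omega n k => _.
pose c : R := p ^+ k * (1 - p) ^+ ('C(n, 2) - k).
have c0 : 0 < c by rewrite mulr_gt0 ?exprn_gt0 ?subr_gt0.
pose E (x : Omega n k) : R := expR (beta / n%:R * sqdev p (val x)).
have E1 x : 1 <= E x.
  by rewrite -expR0 ler_expR mulr_ge0 ?divr_ge0 ?(ltW nn) // sumr_ge0 // => v _; exact: sqr_ge0.
have kN : (k <= 'C(n, 2))%N.
  by rewrite -(ler_nat R) kE ler_piMr // ltW.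
(* [c] times the number of graphs is the binomial mass at [k = N p], which is a mode. Since [E] is
   at least 1, this bounds the partition function from below. *)
have mode : 1 <= ('C(n, 2)%:R + 1) * (\sum_(x : Omega n k) c).
  have -> : \sum_(x : Omega n k) c = bin_mass 'C(n, 2) p k.
    by rewrite sumr_const card_Omega -[LHS]mulr_natl /bin_mass mulrA.
  have N1 : 'C(n, 2).+1%:R = 'C(n, 2)%:R + 1 :> R by rewrite natr1.
  have k1 : k.+1%:R = k%:R + 1 :> R by rewrite natr1.
  have := bin_mass_mode p01 kN; rewrite N1 k1 kE; apply; lra.
(* Degrees are at most [n - 1], so the truncation by [inord] loses nothing. *)
pose ds (x : Omega n k) : {ffun 'I_n -> 'I_n.+1} := [ffun v => inord (deg (val x) v)].
have tail : \sum_(x | bad x) E x * c <=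
    n.+1%:R ^+ n * expR (- ((b - beta) * theta * n%:R ^+ 2)).
  rewrite (partition_big ds predT) //=.
  have -> : n.+1%:R ^+ n * expR (- ((b - beta) * theta * n%:R ^+ 2)) =
    \sum_(D : {ffun 'I_n -> 'I_n.+1}) expR (- ((b - beta) * theta * n%:R ^+ 2)).
    by rewrite sumr_const card_ffun !card_ord -[RHS]mulr_natl natrX.
  apply: ler_sum => D _.
  have [x0 /andP[bx0 /eqP dx0]|none] := pickP (fun x => bad x && (ds x == D)); last first.
    by rewrite big_pred0 // expR_ge0.
  have same x : ds x == D -> forall v, deg (val x) v = deg (val x0) v.
    rewrite -dx0 => /eqP/ffunP H v; have := H v; rewrite !ffunE => /(congr1 val).
    by rewrite /= !inordK // ltnS (leq_trans (deg_le _ _)) // leq_pred.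
  have sameS x : ds x == D -> sqdev p (val x) = sqdev p (val x0).
    by move=> /same H; apply: eq_bigr => v _; rewrite /dev /degR H.
  apply: le_trans (_ : E x0 * \sum_(x : Omega n k | [forall v, deg (val x) v == deg (val x0) v]) c <= _).
    rewrite mulr_sumr [leRHS](bigID (fun x => bad x && (ds x == D))) /=.
    rewrite [leLHS](eq_big (fun x => [forall v, deg (val x) v == deg (val x0) v] && (bad x && (ds x == D))) (fun=> E x0 * c)).
    - rewrite lerDl; apply: sumr_ge0 => x _; rewrite mulr_ge0 ?(ltW c0) //.
      exact: expR_ge0.
    - move=> x; apply/idP/andP => [h|[]//]; split=> //; apply/forallP => v.
      by case/andP: h => _ /same->.
    - by move=> x /andP[_ /sameS h]; rewrite /E h.
  apply: le_trans (ler_wpM2l (expR_ge0 _) (degree_class_bound x0 p01 b0 sg n2 kE)) _.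
  rewrite -expRD ler_expR.
  have -> : beta / n%:R * sqdev p (val x0) - b * sqdev p (val x0) / n%:R =
    - ((b - beta) * (sqdev p (val x0) / n%:R)) by ring.
  rewrite lerN2 -mulrA ler_wpM2l ?subr_ge0 // ler_pdivlMr // -mulrA -exprSr.
  exact/ltW/bx0.
have Z0 : 0 < \sum_(x : Omega n k) c by rewrite -(pmulr_rgt0 _ (_ : 0 < 'C(n, 2)%:R + 1)) ?(lt_le_trans _ mode) // ltr_wpDl.
pose c1 := expR (beta / n%:R * (n%:R * ((n%:R - 1) * p) ^+ 2 - 2 * k%:R)).
have HE x : expR (hamiltonian beta (val x)) = E x * c1.
  by rewrite (hamiltonian_sqdev beta x kE) expRD.
rewrite /mass /mu -mulr_suml.
rewrite (eq_bigr _ (fun x _ => HE x)) [in leLHS](eq_bigr _ (fun x _ => HE x)) -!mulr_suml.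
have ZE : \sum_(x : Omega n k) 1 <= \sum_(x : Omega n k) E x.
  by apply: ler_sum => x _; exact: E1.
have one : \sum_(x : Omega n k) c = c * \sum_(x : Omega n k) 1.
  by rewrite mulr_sumr; apply: eq_bigr => x _; rewrite mulr1.
have S1 : 0 < \sum_(x : Omega n k) (1 : R) by move: Z0; rewrite one pmulr_rgt0.
have SE : 0 < \sum_(x : Omega n k) E x by apply: lt_le_trans ZE.
have -> : (\sum_(i | bad i) E i) * c1 / ((\sum_i E i) * c1) = (\sum_(i | bad i) E i) / \sum_i E i.
  by field; rewrite !gt_eqF ?expR_gt0.
rewrite ler_pdivrMr // -(ler_pM2r c0) mulr_suml.
apply: (le_trans tail).
set X := n.+1%:R ^+ n; set Y := expR _.
have -> : X * ('C(n, 2)%:R + 1) * Y * (\sum_i E i) * c =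
  X * Y * (('C(n, 2)%:R + 1) * (c * \sum_i E i)) by ring.
rewrite ler_peMr ?mulr_ge0 ?expR_ge0 ?exprn_ge0 //.
apply: (le_trans mode); rewrite one; apply: ler_wpM2l; first by rewrite addr_ge0.
by rewrite ler_pM2l.
Qed.

End SquaredDeviation.

(** * Exact balance between consecutive levels of one degree *)

Section LevelCrossing.
Variable R : realType.

(** The map sending a graph with a swap to the swapped graph with the reversed swap is an involution
    on such pairs. *)
Lemma swap_reversal n k (F : Omega n k -> edge n * edge n -> R) :
  \sum_x \sum_(q | swappable (val x) q) F x q =
  \sum_x \sum_(q | swappable (val x) q) F (swapO x q) (q.2, q.1).
Proof.
pose P (u : Omega n k * (edge n * edge n)) := swappable (val u.1) u.2.
pose phi (u : Omega n k * (edge n * edge n)) := (swapO u.1 u.2, (u.2.2, u.2.1)).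
have Pphi u : P u -> P (phi u).
  rewrite /P /phi /swappable /= => xq; rewrite val_swapO //; case/andP: xq => xs xt.
  by rewrite swap_t // swap_s.
have phiK u : P u -> phi (phi u) = u.
  case: u => x [s t] Pu; have Pu' := Pphi _ Pu; congr (_, _).
  apply: val_inj; rewrite val_swapO //= val_swapO //=.
  by case/andP: Pu => xs xt; rewrite swapK.
rewrite !pair_big_dep /= (reindex_onto phi phi) /=; last by move=> u; exact: phiK.
apply: eq_bigl => u; rewrite -/(P (phi u)) -/(P u).
apply/andP/idP => [[h /eqP E]|h]; first by rewrite -E; exact: Pphi.
by rewrite Pphi // phiK.
Qed.

Lemma mu_swapO n k (beta : R) (x : Omega n k) q : swappable (val x) q ->
  mu beta (swapO x q) = mu beta x * expR (swap_energy beta (val x) q).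
Proof.
move=> xq; rewrite /mu val_swapO //; case/andP: xq => xs xt.
by rewrite (hamiltonian_swap xs xt) expRD mulrAC.
Qed.

Lemma deg_swapO n k (x : Omega n k) q v : swappable (val x) q ->
  v \notin val q.1 -> v \in val q.2 -> deg (val (swapO x q)) v = (deg (val x) v).+1.
Proof.
move=> xq v1 v2; apply/eqP; rewrite -(eqr_nat R) -natr1.
have := degR_swap R; rewrite /degR val_swapO // => H.
case/andP: xq => xs xt; rewrite H // (negbTE v1) v2 subr0 //.
Qed.

Definition level n k (beta : R) v m : R :=
  \sum_(x : Omega n k | deg (val x) v == m) mu beta x.

Definition raising n (v : 'I_n) (q : edge n * edge n) := (v \notin val q.1) && (v \in val q.2).
Definition lowering n (v : 'I_n) (q : edge n * edge n) := (v \in val q.1) && (v \notin val q.2).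

Lemma deg_swapO_eq n k (x : Omega n k) q v m : swappable (val x) q -> raising v q ->
  (deg (val (swapO x q)) v == m.+1) = (deg (val x) v == m).
Proof. by move=> xq /andP[v1 v2]; rewrite deg_swapO // eqSS. Qed.

(** The swaps that lower the degree of [v] from [m + 1] are the reversals of those that raise it
    from [m], and the ratio of the two weights is the exponential of the energy change. The
    unweighted side depends on the graph only through the degree of [v], so the identity becomes a
    recursion for the level masses once the weighted side is estimated. *)
Lemma crossing_up n k (beta : R) (v : 'I_n) m :
  \sum_(y : Omega n k | deg (val y) v == m.+1) mu beta y *
     (\sum_(q | swappable (val y) q) (lowering v q)%:R) =
  \sum_(x : Omega n k | deg (val x) v == m) mu beta x *
     (\sum_(q | swappable (val x) q) (raising v q)%:R * expR (swap_energy beta (val x) q)).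
Proof.
transitivity (\sum_(y : Omega n k) \sum_(q | swappable (val y) q)
    (deg (val y) v == m.+1)%:R * (lowering v q)%:R * mu beta y).
  rewrite big_mkcond; apply: eq_bigr => y _; case: eqP => _.
    by rewrite mulr_sumr; apply: eq_bigr => q _; rewrite mul1r mulrC.
  by rewrite big1 // => q _; rewrite !mul0r.
rewrite swap_reversal [RHS]big_mkcond; apply: eq_bigr => x _.
transitivity (\sum_(q | swappable (val x) q) (deg (val x) v == m)%:R *
   (mu beta x * ((raising v q)%:R * expR (swap_energy beta (val x) q)))).
  apply: eq_bigr => q xq; have -> : lowering v (q.2, q.1) = raising v q.
    by rewrite /lowering /raising andbC.
  have [rq|_] := boolP (raising v q); last by rewrite !(mul0r, mulr0).
  by rewrite deg_swapO_eq // mu_swapO // !mul1r mulr1.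
case: eqP => _; last by rewrite big1 // => q _; rewrite mul0r.
by rewrite mulr_sumr; apply: eq_bigr => q _; rewrite mul1r.
Qed.

(** The same balance with the energy factor on the upper level, for a recursion that runs
    downwards. *)
Lemma crossing_down n k (beta : R) (v : 'I_n) m :
  \sum_(x : Omega n k | deg (val x) v == m) mu beta x *
     (\sum_(q | swappable (val x) q) (raising v q)%:R) =
  \sum_(y : Omega n k | deg (val y) v == m.+1) mu beta y *
     (\sum_(q | swappable (val y) q) (lowering v q)%:R * expR (swap_energy beta (val y) q)).
Proof.
transitivity (\sum_(y : Omega n k) \sum_(q | swappable (val y) q)
    (deg (val y) v == m.+1)%:R * (lowering v q)%:R * mu beta (swapO y q)); last first.
  rewrite [RHS]big_mkcond; apply: eq_bigr => y _; case: eqP => _.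
    by rewrite mulr_sumr; apply: eq_bigr => q yq; rewrite mu_swapO // mul1r; ring.
  by rewrite big1 // => q _; rewrite !mul0r.
rewrite swap_reversal [LHS]big_mkcond; apply: eq_bigr => x _.
transitivity (\sum_(q | swappable (val x) q) (deg (val x) v == m)%:R *
   (mu beta x * (raising v q)%:R)).
  case: eqP => _; last by rewrite big1 // => q _; rewrite mul0r.
  by rewrite mulr_sumr; apply: eq_bigr => q _; rewrite mul1r.
apply: eq_bigr => q xq; have -> : lowering v (q.2, q.1) = raising v q.
  by rewrite /lowering /raising andbC.
have [rq|_] := boolP (raising v q); last by rewrite !(mul0r, mulr0).
rewrite deg_swapO_eq //; have -> : swapO (swapO x q) (q.2, q.1) = x; last by ring.
case/andP: (xq) => xs xt.
have yq : swappable (val (swapO x q)) (q.2, q.1).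
  by rewrite /swappable val_swapO //= swap_t // swap_s.
by apply: val_inj; rewrite (val_swapO R yq) (val_swapO R xq) swapK.
Qed.

Lemma sum_edg_through n k (x : Omega n k) (v : 'I_n) :
  [/\ \sum_e edg R (val x) e * (v \in val e)%:R = (deg (val x) v)%:R,
      \sum_e edg R (val x) e * (v \notin val e)%:R = k%:R - (deg (val x) v)%:R,
      \sum_e (1 - edg R (val x) e) * (v \in val e)%:R = n%:R - 1 - (deg (val x) v)%:R &
      \sum_e (1 - edg R (val x) e) * (v \notin val e)%:R =
        'C(n, 2)%:R - k%:R - (n%:R - 1 - (deg (val x) v)%:R)].
Proof.
have H1 : \sum_e edg R (val x) e * (v \in val e)%:R = (deg (val x) v)%:R by rewrite -degRE.
have n0 : (0 < n)%N by apply: leq_ltn_trans (ltn_ord v).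
have H2 : \sum_(e : edge n) (v \in val e)%:R = n%:R - 1 :> R.
  rewrite -card_natr; have -> : n%:R - 1 = n.-1%:R :> R by rewrite -[in LHS](prednK n0) -natr1 addrK.
  by congr (_%:R); exact: card_edges_through.
have H3 : \sum_e (1 - edg R (val x) e) * (v \in val e)%:R = n%:R - 1 - (deg (val x) v)%:R.
  under eq_bigr => e _ do rewrite mulrBl mul1r.
  by rewrite sumrB H1 H2.
split=> //.
  rewrite -(sum_edg R x) -H1 -sumrB; apply: eq_bigr => e _.
  by case: (v \in _) => /=; ring.
rewrite -(sum_edgC R x) -H3 -sumrB; apply: eq_bigr => e _.
by case: (v \in _) => /=; ring.
Qed.

Lemma sum_lowering n k (y : Omega n k) v :
  \sum_(q | swappable (val y) q) (lowering v q)%:R =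
  (deg (val y) v)%:R * ('C(n, 2)%:R - k%:R - (n%:R - 1 - (deg (val y) v)%:R)) :> R.
Proof.
have [h1 _ _ h4] := sum_edg_through y v; rewrite -h4 -{1}h1 -sum_swappable.
by apply: eq_bigr => q _; rewrite /lowering -natrM mulnb.
Qed.

Lemma sum_raising n k (x : Omega n k) v :
  \sum_(q | swappable (val x) q) (raising v q)%:R =
  (k%:R - (deg (val x) v)%:R) * (n%:R - 1 - (deg (val x) v)%:R) :> R.
Proof.
have [_ h2 h3 _] := sum_edg_through x v; rewrite -h2 -h3 -sum_swappable.
by apply: eq_bigr => q _; rewrite /raising -natrM mulnb.
Qed.

End LevelCrossing.

(** * Averaging the energy factor over swaps *)

Section EnergySums.
Variable R : realType.

Lemma expR_le_1Dabs (y c : R) : `|y| <= c -> expR y <= 1 + `|y| * expR c.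
Proof.
move=> yc; have [y0|y0] := lerP 0 y.
  rewrite ger0_norm // in yc *.
  have h : (1 - y) * expR y <= 1.
    have e0 := expR_gt0 y.
    have : 1 - y <= expR (- y) by exact: expR_ge1Dx.
    by rewrite expRN -(ler_pM2r e0) mulVf // gt_eqF.
  have : y * expR y <= y * expR c by rewrite ler_wpM2l // ler_expR.
  lra.
apply: le_trans (_ : 1 <= _); first by rewrite -expR0 ler_expR ltW.
by rewrite lerDl mulr_ge0 ?expR_ge0.
Qed.

Definition absdev n (p : R) (X : graph n) : R := \sum_v `|dev p X v|.

Lemma dev_abs_le n (p : R) (X : graph n) v : 0 <= p <= 1 -> `|dev p X v| <= n%:R.
Proof.
move=> /andP[p0 p1]; have n0 : (0 < n)%N by apply: leq_ltn_trans (ltn_ord v).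
have d1 : degR R X v <= n%:R - 1.
  have -> : n%:R - 1 = n.-1%:R :> R by rewrite -[in LHS](prednK n0) -natr1 addrK.
  by rewrite ler_nat deg_le.
have d0 : 0 <= degR R X v by rewrite /degR.
have n1 : 1 <= n%:R :> R by rewrite (ler_nat R 1 n).
have : 0 <= (n%:R - 1) * p by rewrite mulr_ge0 // subr_ge0.
have : (n%:R - 1) * p <= n%:R - 1 by rewrite ler_piMr // subr_ge0.
by rewrite /dev ler_norml => h1 h2; apply/andP; split; lra.
Qed.

(* AM-GM: [|d| <= d^2 / (2 kappa n) + kappa n / 2]. *)
Lemma absdev_le n (p kappa : R) (X : graph n) : (0 < n)%N -> 0 < kappa ->
  sqdev p X <= kappa ^+ 2 * n%:R ^+ 3 -> absdev p X <= kappa * n%:R ^+ 2.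
Proof.
move=> n0 k0 H; have nn : 0 < n%:R :> R by rewrite ltr0n.
have c0 : 0 < kappa * n%:R by rewrite mulr_gt0.
apply: le_trans (_ : \sum_(v < n) (dev p X v ^+ 2 / (2 * (kappa * n%:R)) + kappa * n%:R / 2) <= _).
  apply: ler_sum => v _; set d := dev p X v.
  have -> : d ^+ 2 / (2 * (kappa * n%:R)) + kappa * n%:R / 2 =
    (`|d| ^+ 2 + (kappa * n%:R) ^+ 2) / (2 * (kappa * n%:R)).
    by rewrite real_normK ?num_real //; field; rewrite !gt_eqF.
  rewrite ler_pdivlMr ?mulr_gt0 //.
  have := sqr_ge0 (`|d| - kappa * n%:R); rewrite !expr2; lra.
rewrite big_split /= -mulr_suml sumr_const card_ord -[X in _ + X]mulr_natr.
have -> : kappa * n%:R ^+ 2 = (kappa ^+ 2 * n%:R ^+ 3) / (2 * (kappa * n%:R)) + kappa * n%:R / 2 * n%:R.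
  by field; rewrite !gt_eqF.
by rewrite lerD2r ler_pM2r // invr_gt0 mulr_gt0.
Qed.

Definition edge_dev n (p : R) (X : graph n) (e : edge n) : R := \sum_(v in val e) dev p X v.

Lemma sum_edge_absdev n (p : R) (X : graph n) :
  \sum_(e : edge n) \sum_(v in val e) `|dev p X v| = (n%:R - 1) * absdev p X.
Proof. exact: sum_edge_weight. Qed.

Lemma edge_absdev_le n (p : R) (X : graph n) (e : edge n) : 0 <= p <= 1 ->
  \sum_(v in val e) `|dev p X v| <= 2 * n%:R.
Proof.
move=> p01; apply: le_trans (_ : \sum_(v in val e) n%:R <= _).
  by apply: ler_sum => v _; exact: dev_abs_le.
by rewrite sumr_const card_val_edge mulr_natl.
Qed.

(** From [e^y <= 1 + |y| e^{4 beta}], where [y] is [2 beta / n] times the deviation at an edge. *)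
Definition crossing_const (beta : R) : R := 2 * beta * expR (4 * beta).

(** The exponents are bounded by [4 beta], so the exponential is 1 plus a multiple of the deviation.
    Each vertex lies on [n - 1] edges, so the bound on [absdev] leaves an error of order
    [kappa n^2], small against the number of edges. *)
Lemma sum_exp_dev n (p beta kappa s : R) (X : graph n) (om : edge n -> R) :
  (0 < n)%N -> 0 <= p <= 1 -> 0 <= beta -> `|s| = 1 -> absdev p X <= kappa * n%:R ^+ 2 ->
  (forall e, 0 <= om e <= 1) ->
  \sum_e om e * expR (s * (2 * beta / n%:R) * edge_dev p X e) <=
  \sum_e om e + crossing_const beta * kappa * n%:R ^+ 2.
Proof.
move=> n0 p01 b0 s1 HT om01; have nn : 0 < n%:R :> R by rewrite ltr0n.
have g0 : 0 <= 2 * beta / n%:R by rewrite divr_ge0 ?mulr_ge0.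
apply: le_trans (_ : \sum_e (om e + expR (4 * beta) * (2 * beta / n%:R) * \sum_(v in val e) `|dev p X v|) <= _).
  apply: ler_sum => e _; have /andP[om0 om1] := om01 e.
  have A0 : 0 <= \sum_(v in val e) `|dev p X v| by apply: sumr_ge0.
  have ab : `|s * (2 * beta / n%:R) * edge_dev p X e| <= (2 * beta / n%:R) * \sum_(v in val e) `|dev p X v|.
    by rewrite normrM [`|s * _|]normrM s1 mul1r (ger0_norm g0) ler_wpM2l // ler_norm_sum.
  have c4 : (2 * beta / n%:R) * \sum_(v in val e) `|dev p X v| <= 4 * beta.
    have -> : 4 * beta = 2 * beta / n%:R * (2 * n%:R) by field; rewrite gt_eqF.
    by rewrite ler_wpM2l // edge_absdev_le.
  have h := expR_le_1Dabs (le_trans ab c4).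
  apply: le_trans (ler_wpM2l om0 h) _; rewrite mulrDr mulr1 lerD2l.
  apply: le_trans (ler_piMl _ om1) _; first by rewrite mulr_ge0 ?expR_ge0.
  apply: le_trans (ler_wpM2r (expR_ge0 _) ab) _.
  by rewrite le_eqVlt; apply/orP; left; apply/eqP; ring.
rewrite big_split /= lerD2l -mulr_sumr sum_edge_absdev /crossing_const.
have e0 := expR_gt0 (4 * beta).
have T0 : 0 <= absdev p X by apply: sumr_ge0.
have -> : expR (4 * beta) * (2 * beta / n%:R) * ((n%:R - 1) * absdev p X) =
  (2 * beta * expR (4 * beta)) * ((n%:R - 1) / n%:R * absdev p X) by field; rewrite gt_eqF.
rewrite -[leRHS]mulrA; apply: ler_wpM2l.
  by apply: mulr_ge0; [exact: mulr_ge0|exact: ltW].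
apply: le_trans HT; rewrite ler_piMl // ler_pdivrMr // mul1r; lra.
Qed.

(** For edges through [v] the deviation of [v] occurs in every summand and may be of order [n], so
    it is kept exactly as a common factor; only the other endpoint is averaged. *)
Lemma sum_exp_dev_through n (p beta kappa s : R) (X : graph n) (om : edge n -> R) v :
  0 <= p <= 1 -> 0 <= beta -> `|s| = 1 -> absdev p X <= kappa * n%:R ^+ 2 ->
  (forall e, 0 <= om e <= 1) ->
  \sum_e om e * ((v \in val e)%:R * expR (s * (2 * beta / n%:R) * edge_dev p X e)) <=
  expR (s * (2 * beta / n%:R) * dev p X v) *
    (\sum_e om e * (v \in val e)%:R + crossing_const beta * kappa * n%:R).
Proof.
move=> p01 b0 s1 HT om01.
have n0 : (0 < n)%N by apply: leq_ltn_trans (ltn_ord v).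
have nn : 0 < n%:R :> R by rewrite ltr0n.
have g0 : 0 <= 2 * beta / n%:R by rewrite divr_ge0 ?mulr_ge0.
have e0 := expR_gt0 (4 * beta).
pose oth (e : edge n) : R := \sum_(u | (u != v) && (u \in val e)) `|dev p X u|.
apply: le_trans (_ : expR (s * (2 * beta / n%:R) * dev p X v) * (\sum_e (om e * (v \in val e)%:R +
    expR (4 * beta) * (2 * beta / n%:R) * ((v \in val e)%:R * oth e))) <= _).
  rewrite mulr_sumr; apply: ler_sum => e _; have /andP[om0 om1] := om01 e.
  have [ve|_] := boolP (v \in val e); last by rewrite !(mul0r, mulr0) addr0 mulr0.
  have A0 : 0 <= oth e by apply: sumr_ge0.
  rewrite !mul1r mulr1 /edge_dev (bigD1 v) //= mulrDr expRD mulrCA ler_pM2l ?expR_gt0 //.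
  have -> : \sum_(i in val e | i != v) dev p X i = \sum_(u | (u != v) && (u \in val e)) dev p X u.
    by apply: eq_bigl => u; rewrite andbC.
  set D := \sum_(u | _) _.
  have ab : `|s * (2 * beta / n%:R) * D| <= (2 * beta / n%:R) * oth e.
    by rewrite normrM [`|s * _|]normrM s1 mul1r (ger0_norm g0) ler_wpM2l // ler_norm_sum.
  have c4 : (2 * beta / n%:R) * oth e <= 4 * beta.
    have -> : 4 * beta = 2 * beta / n%:R * (2 * n%:R) by field; rewrite gt_eqF.
    rewrite ler_wpM2l //; apply: le_trans (edge_absdev_le X e p01).
    by rewrite [leRHS](bigD1 v) //= /oth; under eq_bigl => u do rewrite andbC; rewrite lerDr.
  have h := expR_le_1Dabs (le_trans ab c4).
  apply: le_trans (ler_wpM2l om0 h) _; rewrite mulrDr mulr1 lerD2l.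
  apply: le_trans (ler_piMl _ om1) _; first by rewrite mulr_ge0 ?expR_ge0.
  apply: le_trans (ler_wpM2r (expR_ge0 _) ab) _.
  by rewrite le_eqVlt; apply/orP; left; apply/eqP; ring.
rewrite ler_pM2l ?expR_gt0 // big_split /= lerD2l -mulr_sumr.
(* Every other vertex is joined to [v] by exactly one edge. *)
have -> : \sum_(e : edge n) (v \in val e)%:R * oth e = \sum_(u | u != v) `|dev p X u|.
  rewrite /oth; under eq_bigr => e _ do rewrite mulr_sumr.
  rewrite (exchange_big_dep (fun u => u != v)) /=; last by move=> e u _ /andP[].
  apply: eq_bigr => u uv; rewrite -mulr_suml.
  have -> : \sum_(e : edge n | (u != v) && (u \in val e)) (v \in val e)%:R = 1 :> R.
    transitivity (#|[pred e : edge n | (u \in val e) && (v \in val e)]|%:R : R).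
      rewrite card_natr big_mkcond; apply: eq_bigr => e _ /=; rewrite uv /=.
      by case: (u \in _).
    by rewrite card_edges_through2.
  by rewrite mul1r.
have le : \sum_(u | u != v) `|dev p X u| <= kappa * n%:R ^+ 2.
  by apply: le_trans HT; rewrite /absdev [leRHS](bigD1 v) //= lerDr.
apply: le_trans (ler_wpM2l _ le) _; first by rewrite mulr_ge0 // ltW.
by rewrite /crossing_const le_eqVlt; apply/orP; left; apply/eqP; field; rewrite gt_eqF.
Qed.

(** Up to [4 beta / n] the energy splits into a contribution of the deleted and one of the added
    edge, which makes the sum over swaps factorise. The correction arises because the deleted edge
    is counted in the degrees of both its endpoints. *)
Lemma swap_energy_dev n (p beta : R) (X : graph n) q : (0 < n)%N -> 0 <= beta ->
  swappable X q -> expR (swap_energy beta X q) <=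
  expR (4 * beta / n%:R) * (expR (-1 * (2 * beta / n%:R) * edge_dev p X q.1) *
     expR (1 * (2 * beta / n%:R) * edge_dev p X q.2)).
Proof.
move=> n0 b0 /andP[Xs Xt]; rewrite -!expRD ler_expR.
have nn : 0 < n%:R :> R by rewrite ltr0n.
have g0 : 0 <= 2 * beta / n%:R by rewrite divr_ge0 ?mulr_ge0.
have E e : edge_dev p X e = edeg R X e + 2 * edg R X e - 2 * ((n%:R - 1) * p).
  rewrite /edge_dev /dev sumrB sum_deg_edge sumr_const card_val_edge; congr (_ - _).
  by rewrite -[LHS]mulr_natl.
rewrite !E /edg Xs (negbTE Xt) /swap_energy.
have -> : 4 * beta / n%:R = 2 * beta / n%:R * 2 by ring.
have := mulr_ge0 g0 (adj_ge0 R q.1 q.2).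
rewrite /=; lra.
Qed.

Lemma raising_sum n k (p beta kappa : R) (x : Omega n k) v :
  0 <= p <= 1 -> 0 <= beta -> absdev p (val x) <= kappa * n%:R ^+ 2 ->
  \sum_(q | swappable (val x) q) (raising v q)%:R * expR (swap_energy beta (val x) q) <=
  expR (4 * beta / n%:R) * ((k%:R + crossing_const beta * kappa * n%:R ^+ 2) *
    (expR (1 * (2 * beta / n%:R) * dev p (val x) v) *
      (n%:R - 1 - (deg (val x) v)%:R + crossing_const beta * kappa * n%:R))).
Proof.
move=> p01 b0 HT; have n0 : (0 < n)%N by apply: leq_ltn_trans (ltn_ord v).
have om1 e : 0 <= edg R (val x) e <= 1 by rewrite edg_ge0 edg_le1.
have om2 e : 0 <= 1 - edg R (val x) e <= 1.
  by have := edg_ge0 R (val x) e; have := edg_le1 R (val x) e => h1 h2; apply/andP; split; lra.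
have [_ _ h3 _] := sum_edg_through R x v.
have S1 := sum_exp_dev n0 p01 b0 (normrN1 R) HT om1.
have S2 := @sum_exp_dev_through n p beta kappa 1 (val x) _ v p01 b0 (normr1 R) HT om2.
rewrite h3 in S2; rewrite sum_edg in S1.
apply: le_trans (_ : expR (4 * beta / n%:R) * \sum_(q | swappable (val x) q)
   expR (-1 * (2 * beta / n%:R) * edge_dev p (val x) q.1) *
   ((v \in val q.2)%:R * expR (1 * (2 * beta / n%:R) * edge_dev p (val x) q.2)) <= _).
  rewrite mulr_sumr; apply: ler_sum => q xq.
  have h := swap_energy_dev p n0 b0 xq.
  rewrite /raising; case: (v \notin val q.1) => /=; last first.
    by rewrite mul0r !mulr_ge0 ?expR_ge0.
  by case: (v \in val q.2); rewrite ?(mul0r, mulr0) ?(mul1r (expR _)) ?lexx.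
rewrite ler_pM2l ?expR_gt0 // (sum_swappable (val x) (fun e => expR (-1 * (2 * beta / n%:R) * edge_dev p (val x) e))
   (fun e => (v \in val e)%:R * expR (1 * (2 * beta / n%:R) * edge_dev p (val x) e))).
have om1' e : 0 <= edg R (val x) e by case/andP: (om1 e).
have om2' e : 0 <= 1 - edg R (val x) e by case/andP: (om2 e).
by apply: ler_pM S1 S2; apply: sumr_ge0 => e _; rewrite !mulr_ge0 ?expR_ge0 ?om1' ?om2'.
Qed.

Lemma lowering_sum n k (p beta kappa : R) (x : Omega n k) v :
  0 <= p <= 1 -> 0 <= beta -> absdev p (val x) <= kappa * n%:R ^+ 2 ->
  \sum_(q | swappable (val x) q) (lowering v q)%:R * expR (swap_energy beta (val x) q) <=
  expR (4 * beta / n%:R) * (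
    (expR (-1 * (2 * beta / n%:R) * dev p (val x) v) *
      ((deg (val x) v)%:R + crossing_const beta * kappa * n%:R)) *
    ('C(n, 2)%:R - k%:R + crossing_const beta * kappa * n%:R ^+ 2)).
Proof.
move=> p01 b0 HT; have n0 : (0 < n)%N by apply: leq_ltn_trans (ltn_ord v).
have om1 e : 0 <= edg R (val x) e <= 1 by rewrite edg_ge0 edg_le1.
have om2 e : 0 <= 1 - edg R (val x) e <= 1.
  by have := edg_ge0 R (val x) e; have := edg_le1 R (val x) e => h1 h2; apply/andP; split; lra.
have [h1 _ _ _] := sum_edg_through R x v.
have S2 := sum_exp_dev n0 p01 b0 (normr1 R) HT om2.
have S1 := @sum_exp_dev_through n p beta kappa (-1) (val x) _ v p01 b0 (normrN1 R) HT om1.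
rewrite h1 in S1; rewrite sum_edgC in S2.
apply: le_trans (_ : expR (4 * beta / n%:R) * \sum_(q | swappable (val x) q)
   ((v \in val q.1)%:R * expR (-1 * (2 * beta / n%:R) * edge_dev p (val x) q.1)) *
   expR (1 * (2 * beta / n%:R) * edge_dev p (val x) q.2) <= _).
  rewrite mulr_sumr; apply: ler_sum => q xq.
  have h := swap_energy_dev p n0 b0 xq.
  rewrite /lowering; case: (v \notin val q.2) => /=; last first.
    by rewrite andbF mul0r !mulr_ge0 ?expR_ge0.
  by rewrite andbT; case: (v \in val q.1); rewrite ?(mul0r, mulr0) ?(mul1r (expR _)) ?lexx.
rewrite ler_pM2l ?expR_gt0 // (sum_swappable (val x)
   (fun e => (v \in val e)%:R * expR (-1 * (2 * beta / n%:R) * edge_dev p (val x) e))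
   (fun e => expR (1 * (2 * beta / n%:R) * edge_dev p (val x) e))).
have om1' e : 0 <= edg R (val x) e by case/andP: (om1 e).
have om2' e : 0 <= 1 - edg R (val x) e by case/andP: (om2 e).
by apply: ler_pM S1 S2; apply: sumr_ge0 => e _; rewrite !mulr_ge0 ?expR_ge0 ?om1' ?om2'.
Qed.

(** A bound valid for every graph, for use on the exceptional event where [sqdev] is large. *)
Lemma crude_energy_sum n k (beta : R) (x : Omega n k) (F : edge n * edge n -> bool) :
  (0 < n)%N -> 0 <= beta ->
  \sum_(q | swappable (val x) q) (F q)%:R * expR (swap_energy beta (val x) q) <=
  expR (4 * beta) * 'C(n, 2)%:R ^+ 2.
Proof.
move=> n0 b0; have nn : 0 < n%:R :> R by rewrite ltr0n.
have g0 : 0 <= 2 * beta / n%:R by rewrite divr_ge0 ?mulr_ge0.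
apply: le_trans (_ : \sum_(q : edge n * edge n) expR (4 * beta) <= _); last first.
  by rewrite sumr_const card_prod card_edge -[leLHS]mulr_natl natrM -expr2 mulrC.
rewrite big_mkcond; apply: ler_sum => q _; case: ifP => _; last exact: expR_ge0.
apply: le_trans (_ : 1 * expR (swap_energy beta (val x) q) <= _).
  by rewrite ler_wpM2r ?expR_ge0 //; case: (F q).
rewrite mul1r ler_expR /swap_energy.
have -> : 4 * beta = 2 * beta / n%:R * (2 * n%:R) by field; rewrite gt_eqF.
rewrite ler_wpM2l //; have := edeg_le R (val x) q.2; have := adj_ge0 R q.1 q.2.
have : 0 <= edeg R (val x) q.1 by rewrite /edeg.
lra.
Qed.

End EnergySums.

Section LevelRecursion.
Variable R : realType.

Lemma sum_level_bound n k (beta A E : R) v m (bad : pred (Omega n k))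
    (F : Omega n k -> R) : 0 <= A -> 0 <= E ->
  (forall x, deg (val x) v == m -> ~~ bad x -> F x <= A) ->
  (forall x, deg (val x) v == m -> F x <= E) ->
  \sum_(x : Omega n k | deg (val x) v == m) mu beta x * F x <=
  level k beta v m * A + mass (@mu R n k beta) bad * E.
Proof.
move=> A0 E0 FA FE.
apply: le_trans (_ : \sum_(x : Omega n k | deg (val x) v == m)
   (mu beta x * A + (bad x)%:R * mu beta x * E) <= _).
  apply: ler_sum => x xm; have m0 := ltW (mu_gt0 beta x).
  have [bx|bx] := boolP (bad x).
    rewrite mul1r -[leLHS]add0r; apply: lerD; first exact: mulr_ge0.
    by rewrite ler_wpM2l // FE.
  by rewrite !mul0r addr0 ler_wpM2l // FA.
rewrite big_split /= /level mulr_suml lerD2l /mass [leRHS]mulr_suml.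
rewrite [leRHS]big_mkcond [leLHS]big_mkcond; apply: ler_sum => x _.
have m0 := ltW (mu_gt0 beta x).
by case: (deg _ _ == m); case: (bad x); rewrite ?mul1r ?mul0r ?lexx // mulr_ge0.
Qed.

(** The balance identity with its weighted side estimated off the exceptional event. The only
    dependence on the other degrees left is the error governed by [kappa] and the mass of that
    event. *)
Lemma level_up n k (p beta kappa : R) (v : 'I_n) m :
  0 < p < 1 -> 0 <= beta -> 0 < kappa -> k%:R = 'C(n, 2)%:R * p -> (m < n)%N ->
  level k beta v m.+1 * (m.+1%:R * ('C(n, 2)%:R - k%:R - (n%:R - 1 - m.+1%:R))) <=
  level k beta v m * (expR (4 * beta / n%:R) *
    ((k%:R + crossing_const beta * kappa * n%:R ^+ 2) *
     (expR (2 * beta / n%:R * (m%:R - (n%:R - 1) * p)) *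
      (n%:R - 1 - m%:R + crossing_const beta * kappa * n%:R)))) +
  mass (@mu R n k beta) (fun x => kappa ^+ 2 * n%:R ^+ 3 < sqdev p (val x)) *
    (expR (4 * beta) * 'C(n, 2)%:R ^+ 2).
Proof.
move=> /andP[p0 p1] b0 ka0 kE mn.
have n0 : (0 < n)%N by apply: leq_ltn_trans mn.
have C0 : 0 <= crossing_const beta by rewrite /crossing_const !mulr_ge0 ?expR_ge0.
have mR : m%:R + 1 <= n%:R :> R by rewrite natr1 ler_nat.
have -> : level k beta v m.+1 * (m.+1%:R * ('C(n, 2)%:R - k%:R - (n%:R - 1 - m.+1%:R))) =
  \sum_(y : Omega n k | deg (val y) v == m.+1) mu beta y *
     (\sum_(q | swappable (val y) q) (lowering v q)%:R).
  rewrite /level mulr_suml; apply: eq_bigr => y /eqP ym.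
  by rewrite sum_lowering ym.
rewrite crossing_up; apply: sum_level_bound.
- rewrite mulr_ge0 ?expR_ge0 // mulr_ge0 //.
    by rewrite addr_ge0 // !mulr_ge0 // ltW.
  rewrite mulr_ge0 ?expR_ge0 // addr_ge0 ?mulr_ge0 //; [lra|exact: ltW].
- by rewrite mulr_ge0 ?expR_ge0 // exprn_ge0.
- move=> x /eqP xm gx.
  have p01 : 0 <= p <= 1 by rewrite !ltW.
  have HT : absdev p (val x) <= kappa * n%:R ^+ 2.
    by apply: absdev_le => //; rewrite leNgt.
  by have := raising_sum v p01 b0 HT; rewrite /dev /degR xm mul1r.
- by move=> x _; apply: crude_energy_sum.
Qed.

Lemma level_down n k (p beta kappa : R) (v : 'I_n) m :
  0 < p < 1 -> 0 <= beta -> 0 < kappa -> k%:R = 'C(n, 2)%:R * p -> (m < n)%N ->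
  level k beta v m * ((k%:R - m%:R) * (n%:R - 1 - m%:R)) <=
  level k beta v m.+1 * (expR (4 * beta / n%:R) *
    ((expR (- (2 * beta / n%:R * (m.+1%:R - (n%:R - 1) * p))) *
      (m.+1%:R + crossing_const beta * kappa * n%:R)) *
     ('C(n, 2)%:R - k%:R + crossing_const beta * kappa * n%:R ^+ 2))) +
  mass (@mu R n k beta) (fun x => kappa ^+ 2 * n%:R ^+ 3 < sqdev p (val x)) *
    (expR (4 * beta) * 'C(n, 2)%:R ^+ 2).
Proof.
move=> /andP[p0 p1] b0 ka0 kE mn.
have n0 : (0 < n)%N by apply: leq_ltn_trans mn.
have C0 : 0 <= crossing_const beta by rewrite /crossing_const !mulr_ge0 ?expR_ge0.
have kN : k%:R <= 'C(n, 2)%:R :> R by rewrite kE ler_piMr // ltW.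
have -> : level k beta v m * ((k%:R - m%:R) * (n%:R - 1 - m%:R)) =
  \sum_(y : Omega n k | deg (val y) v == m) mu beta y *
     (\sum_(q | swappable (val y) q) (raising v q)%:R).
  rewrite /level mulr_suml; apply: eq_bigr => y /eqP ym.
  by rewrite sum_raising ym.
rewrite crossing_down; apply: sum_level_bound.
- rewrite mulr_ge0 ?expR_ge0 // mulr_ge0 //.
    by rewrite mulr_ge0 ?expR_ge0 // addr_ge0 // !mulr_ge0 // ltW.
  by rewrite addr_ge0 ?subr_ge0 // !mulr_ge0 // ltW.
- by rewrite mulr_ge0 ?expR_ge0 // exprn_ge0.
- move=> x /eqP xm gx.
  have p01 : 0 <= p <= 1 by rewrite !ltW.
  have HT : absdev p (val x) <= kappa * n%:R ^+ 2.
    by apply: absdev_le => //; rewrite leNgt.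
  by have := lowering_sum v p01 b0 HT; rewrite /dev /degR xm !mulN1r mulNr.
- by move=> x _; apply: crude_energy_sum.
Qed.

End LevelRecursion.

(** * Solving the level recursion *)

Section TailRecursion.
Variable R : realType.

(* The ratio of consecutive levels is compared with the ratio of consecutive
   masses of the binomial law with parameters [M] and [p]. *)
Lemma tail_recursion (a : nat -> R) (n M m0 : nat) (p beta gamma e0 Q c : R) :
  0 < p < 1 -> 0 <= beta -> 0 <= gamma -> (0 < n)%N -> (n.-1 <= M)%N -> 0 <= e0 -> 1 <= Q ->
  let rho j := (1 + gamma) * (p / (1 - p)) * ((M%:R - j%:R) / j.+1%:R) *
     expR (2 * beta / n%:R * (j%:R - c)) in
  (forall j, (j.+1 < n)%N -> a j.+1 <= rho j * a j + e0) ->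
  (forall j, (j.+1 < n)%N -> rho j <= Q) -> a m0 <= 1 ->
  forall i, (m0 + i < n)%N ->
  a (m0 + i)%N <= (1 + gamma) ^+ i * (bin_mass M p (m0 + i) / bin_mass M p m0) *
    expR (beta / n%:R * (((m0 + i)%N%:R - c) ^+ 2 - (m0%:R - c) ^+ 2)) + e0 * i%:R * Q ^+ i.
Proof.
move=> p01 b0 g0 n0 nM e00 Q1 rho Ha HQ a0; have /andP[p0 p1] := p01.
have nn : 0 < n%:R :> R by rewrite ltr0n.
elim=> [|i IH] hi.
  rewrite addn0 in hi *.
  have mM : (m0 <= M)%N by rewrite (leq_trans _ nM) // -ltnS prednK.
  have b := bin_mass_gt0 p01 mM.
  by rewrite subrr mulr0 expR0 !expr0 mulr0 mul0r addr0 !mul1r mulr1 divff ?gt_eqF.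
rewrite addnS in hi *; set m := (m0 + i)%N in hi IH *.
have mM : (m < M)%N by rewrite (leq_trans _ nM) // -ltnS prednK.
have m0M : (m0 <= M)%N by rewrite (leq_trans _ (ltnW mM)) // leq_addr.
have bm := bin_mass_gt0 p01 (ltnW mM); have bm0 := bin_mass_gt0 p01 m0M.
have {}IH := IH (ltnW hi).
have Y0 : 0 <= (M%:R - m%:R) / m.+1%:R :> R.
  by apply: divr_ge0 => //; rewrite subr_ge0 ler_nat ltnW.
have P0 : 0 <= p / (1 - p) by apply: divr_ge0; lra.
have rho0 : 0 <= rho m.
  by rewrite /rho mulr_ge0 ?expR_ge0 // mulr_ge0 // mulr_ge0 // addr_ge0.
have Qi : 1 <= Q ^+ i by exact: exprn_ege1.
apply: le_trans (Ha m hi) _; apply: le_trans (lerD (ler_wpM2l rho0 IH) (lexx e0)) _.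
rewrite mulrDr -addrA; apply: lerD; last first.
  have h : rho m * (e0 * i%:R * Q ^+ i) <= Q * (e0 * i%:R * Q ^+ i).
    by rewrite ler_wpM2r ?HQ // !mulr_ge0 // (le_trans _ Qi).
  apply: le_trans (lerD h (_ : e0 <= e0 * Q ^+ i.+1)) _.
    by rewrite ler_peMr // exprn_ege1.
  by rewrite -natr1 exprS le_eqVlt; apply/orP; left; apply/eqP; ring.
have -> : bin_mass M p m.+1 = bin_mass M p m * ((p / (1 - p)) * ((M%:R - m%:R) / m.+1%:R)).
  have m1 : m.+1%:R != 0 :> R by rewrite pnatr_eq0.
  have q1 : 1 - p != 0 by rewrite subr_eq0 gt_eqF.
  apply: (mulIf (mulf_neq0 m1 q1)); rewrite bin_massS //.
  by field; apply/andP.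
rewrite /rho [(1 + gamma) ^+ i.+1]exprS.
set X := (1 + gamma) ^+ i; set P := p / (1 - p); set Y := (M%:R - m%:R) / m.+1%:R.
set b1 := bin_mass M p m; set b2 := bin_mass M p m0.
have -> : (1 + gamma) * P * Y * expR (2 * beta / n%:R * (m%:R - c)) *
  (X * (b1 / b2) * expR (beta / n%:R * ((m%:R - c) ^+ 2 - (m0%:R - c) ^+ 2))) =
  (1 + gamma) * X * (b1 * (P * Y) / b2) * expR (2 * beta / n%:R * (m%:R - c) +
      beta / n%:R * ((m%:R - c) ^+ 2 - (m0%:R - c) ^+ 2)).
  by rewrite expRD; ring.
have W0 : 0 <= (1 + gamma) * X * (b1 * (P * Y) / b2).
  apply: mulr_ge0; first by rewrite mulr_ge0 ?exprn_ge0 ?addr_ge0.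
  apply: mulr_ge0; last by rewrite invr_ge0 ltW.
  by apply: mulr_ge0; [exact: ltW|exact: mulr_ge0].
rewrite ler_wpM2l // ler_expR.
(* The linear exponents telescope to a Gaussian one because [2 u <= (u + 1)^2 - u^2]. *)
have -> : 2 * beta / n%:R * (m%:R - c) + beta / n%:R * ((m%:R - c) ^+ 2 - (m0%:R - c) ^+ 2) =
  beta / n%:R * (2 * (m%:R - c) + (m%:R - c) ^+ 2 - (m0%:R - c) ^+ 2) by ring.
rewrite ler_wpM2l ?divr_ge0 ?(ltW nn) // -natr1; lra.
Qed.

(* With [u] the deviation from the mean, the Gaussian exponent [- b u^2 / n] of
   the binomial mass beats [+ beta u^2 / n]. *)
Lemma tail_exponent (n M m : nat) (p beta b gamma : R) :
  0 <= p <= 1 -> 0 < b -> 0 <= gamma -> (0 < n)%N ->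
  n%:R <= M%:R :> R -> M%:R <= n%:R - 1 + 2 * gamma * n%:R ->
  0 <= m%:R - (n%:R - 1) * p -> (m < n)%N ->
  - (b * (m%:R - p * M%:R) ^+ 2 / M%:R) + beta / n%:R * (m%:R - (n%:R - 1) * p) ^+ 2 <=
  - ((b - beta) / n%:R * (m%:R - (n%:R - 1) * p) ^+ 2) + 6 * b * gamma * n%:R.
Proof.
move=> /andP[p0 p1] b0 g0 n0 M1 M2 um mn.
have nn : 0 < n%:R :> R by rewrite ltr0n.
have n1 : 1 <= n%:R :> R by rewrite (ler_nat R 1 n).
have mR : m%:R + 1 <= n%:R :> R by rewrite natr1 ler_nat.
set u := m%:R - (n%:R - 1) * p in um *.
have un : u <= n%:R.
  have : 0 <= (n%:R - 1) * p by rewrite mulr_ge0 // subr_ge0.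
  by rewrite /u; lra.
have Mpos : 0 < M%:R :> R by apply: lt_le_trans M1.
suff H : u ^+ 2 / n%:R - 6 * gamma * n%:R <= (m%:R - p * M%:R) ^+ 2 / M%:R.
  have : b * (u ^+ 2 / n%:R - 6 * gamma * n%:R) <= b * ((m%:R - p * M%:R) ^+ 2 / M%:R) by rewrite ler_wpM2l // ltW.
  by lra.
pose g : R := M%:R - (n%:R - 1).
have g_0 : 0 <= g by rewrite /g; lra.
have g_1 : g <= 2 * gamma * n%:R by rewrite /g; lra.
(* Centring at [p M] instead of [p (n - 1)] shifts the deviation by [p g], where [g] is at most
   [2 gamma n]. *)
have Em : m%:R - p * M%:R = u - p * g by rewrite /u /g; ring.
rewrite ler_pdivlMr // Em.
have pg : p * g <= 2 * gamma * n%:R by apply: le_trans g_1; rewrite ler_piMl.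
have pg0 : 0 <= p * g by rewrite mulr_ge0.
have lo : u ^+ 2 - 4 * gamma * n%:R ^+ 2 <= (u - p * g) ^+ 2.
  have : u * (p * g) <= n%:R * (2 * gamma * n%:R) by apply: ler_pM.
  by have := sqr_ge0 (p * g); rewrite !expr2; lra.
apply: le_trans lo.
have uu : u ^+ 2 / n%:R * M%:R <= u ^+ 2 * (1 + 2 * gamma).
  have -> : u ^+ 2 / n%:R * M%:R = u ^+ 2 * (M%:R / n%:R) by ring.
  by apply: ler_wpM2l; [exact: sqr_ge0|rewrite ler_pdivrMr //; lra].
have u2 : u ^+ 2 <= n%:R ^+ 2 by rewrite lerXn2r ?nnegrE // ltW.
have gu : gamma * u ^+ 2 <= gamma * n%:R ^+ 2 by rewrite ler_wpM2l.
have gM : gamma * n%:R * n%:R <= gamma * n%:R * M%:R.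
  by rewrite ler_wpM2l // mulr_ge0 // ltW.
rewrite mulrBl; rewrite [n%:R ^+ 2]expr2 in gu *.
lra.
Qed.

End TailRecursion.

Section AbstractTail.
Variable R : realType.

Lemma expR_le_2x (y : R) : 0 <= y -> 2 * y <= 1 -> expR y <= 1 + 2 * y.
Proof.
move=> y0 y1; have e0 := expR_gt0 y.
have h : (1 - y) * expR y <= 1.
  have : 1 - y <= expR (- y) by exact: expR_ge1Dx.
  by rewrite expRN -(ler_pM2r e0) mulVf // gt_eqF.
have : (1 - y) * expR y <= (1 - y) * (1 + 2 * y).
  apply: le_trans h _; have : y * (2 * y) <= y * 1 by rewrite ler_wpM2l.
  lra.
rewrite ler_pM2l //; lra.
Qed.

(** All factors of the ratio that do not depend on the level are within [1 + gamma] of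
    [p / (1 - p)]: the exponential contributes at most [gamma / 8], as do the error in the edge
    count and the linear term [n]. *)
Lemma recursion_prefactor (n : nat) (p beta eta gamma Ck : R) :
  0 < eta -> eta <= p -> eta <= 1 - p -> 0 <= beta -> beta * eta <= 1 ->
  0 < gamma -> gamma <= 1 -> 64 <= n%:R * eta * gamma -> (2 <= n)%N ->
  0 <= Ck -> 32 * Ck <= eta * gamma ->
  1 <= 'C(n, 2)%:R * (1 - p) - n%:R /\
  expR (4 * beta / n%:R) * ('C(n, 2)%:R * p + Ck * n%:R ^+ 2) * (1 - p) <=
  (1 + gamma) * p * ('C(n, 2)%:R * (1 - p) - n%:R).
Proof.
move=> e0 ep eq b0 be g0 g1 nl n2 C0 Cg.
have nn2 : 2 <= n%:R :> R by rewrite (ler_nat R 2 n).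
have nn : 0 < n%:R :> R by lra.
have eg : eta * gamma <= eta by rewrite ler_piMr // ltW.
have e1 : 2 * eta <= 1 by lra.
have N4 : n%:R ^+ 2 <= 4 * 'C(n, 2)%:R :> R.
  rewrite binR2 expr2; have : 0 <= (n%:R - 2) * n%:R :> R by rewrite mulr_ge0 //; lra.
  lra.
set N : R := 'C(n, 2)%:R in N4 *.
have nN : n%:R * n%:R <= 4 * N by rewrite -expr2.
have ne : 64 <= n%:R * eta.
  have : n%:R * (eta * gamma) <= n%:R * eta by rewrite ler_wpM2l // ltW.
  lra.
have N0 : 0 < N.
  by rewrite -(pmulr_rgt0 N (_ : 0 < 4)) //; apply: lt_le_trans nN; rewrite mulr_gt0.
have nNe : 8 * n%:R <= N * (eta * gamma).
  have h : n%:R * 64 <= n%:R * (n%:R * eta * gamma) by rewrite ler_wpM2l // ltW.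
  have : n%:R * n%:R * (eta * gamma) <= 4 * N * (eta * gamma) by rewrite ler_wpM2r // mulr_ge0 // ltW.
  lra.
have Nq : N * eta <= N * (1 - p) by rewrite ler_wpM2l // ltW.
have Neg : N * (eta * gamma) <= N * eta by rewrite ler_wpM2l // ltW.
split; first lra.
have E : expR (4 * beta / n%:R) <= 1 + gamma / 8.
  have y0 : 0 <= 4 * beta / n%:R by rewrite divr_ge0 ?mulr_ge0 // ltW.
  have yl : 4 * beta / n%:R <= gamma / 16.
    rewrite ler_pdivrMr //.
    have h1 : 64 * beta <= n%:R * eta * gamma * beta by rewrite ler_wpM2r.
    have h2 : beta * eta * (n%:R * gamma) <= 1 * (n%:R * gamma).
      by rewrite ler_wpM2r // mulr_ge0 // ltW.
    lra.
  apply: le_trans (expR_le_2x y0 _) _; lra.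
have P : N * p + Ck * n%:R ^+ 2 <= N * p * (1 + gamma / 8).
  have h1 : Ck * n%:R ^+ 2 <= Ck * (4 * N) by rewrite ler_wpM2l.
  have h2 : 32 * Ck * N <= eta * gamma * N by rewrite ler_wpM2r // ltW.
  have h3 : eta * (gamma * N) <= p * (gamma * N) by rewrite ler_wpM2r // mulr_ge0 // ltW.
  lra.
have Q : N * (1 - p) * (1 - gamma / 8) <= N * (1 - p) - n%:R.
  have h3 : eta * (gamma * N) <= (1 - p) * (gamma * N) by rewrite ler_wpM2r // mulr_ge0 // ltW.
  lra.
have p0 : 0 < p by lra.
have q0 : 0 < 1 - p by lra.
apply: le_trans (_ : (1 + gamma / 8) * (N * p * (1 + gamma / 8)) * (1 - p) <= _).
  rewrite ler_wpM2r ?(ltW q0) //; apply: ler_pM; rewrite ?expR_ge0 //.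
  by rewrite addr_ge0 ?mulr_ge0 ?exprn_ge0 // ltW.
apply: le_trans (_ : (1 + gamma) * p * (N * (1 - p) * (1 - gamma / 8)) <= _); last first.
  by rewrite ler_wpM2l // mulr_ge0 // ?(ltW p0) //; lra.
have -> : (1 + gamma / 8) * (N * p * (1 + gamma / 8)) * (1 - p) =
  (N * p * (1 - p)) * ((1 + gamma / 8) * (1 + gamma / 8)) by ring.
have -> : (1 + gamma) * p * (N * (1 - p) * (1 - gamma / 8)) =
  (N * p * (1 - p)) * ((1 + gamma) * (1 - gamma / 8)) by ring.
rewrite ler_wpM2l ?mulr_ge0 ?(ltW N0) ?(ltW p0) ?(ltW q0) //.
have : gamma * gamma <= gamma * 1 by rewrite ler_wpM2l // ltW.
lra.
Qed.

(** Stated for an abstract sequence so that it serves both tails: the lower one is obtained by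
    reflecting the levels and replacing [p] by [1 - p]. The Gaussian tilt by [beta] is beaten by the
    subgaussian decay at [beta + eta]; half of the surplus [eta zeta^2] absorbs the errors in
    [gamma]. *)
Lemma level_tail (a : nat -> R) (n : nat) (p beta eta zeta gamma Ck e0 : R) :
  0 < eta -> eta <= p -> eta <= 1 - p -> 0 <= beta -> beta * eta <= 1 ->
  subgauss p (beta + eta) ->
  0 < gamma -> 0 < zeta -> zeta <= 1 -> 2 * (6 * (eta^-1 + 1) + 1) * gamma <= eta * zeta ^+ 2 ->
  64 <= n%:R * eta * gamma -> (2 <= n)%N -> 0 <= Ck -> 32 * Ck <= eta * gamma ->
  0 <= e0 -> (forall m, 0 <= a m <= 1) ->
  (forall m, (m.+1 < n)%N ->
    a m.+1 * (m.+1%:R * ('C(n, 2)%:R * (1 - p) - n%:R)) <=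
    a m * (expR (4 * beta / n%:R) * (('C(n, 2)%:R * p + Ck * n%:R ^+ 2) *
      (expR (2 * beta / n%:R * (m%:R - (n%:R - 1) * p)) *
       (n%:R - 1 - m%:R + Ck * n%:R)))) + e0) ->
  forall m, (m < n)%N -> zeta * n%:R <= m%:R - (n%:R - 1) * p ->
  a m <= 3 * n%:R * expR (- (eta * zeta ^+ 2 / 2 * n%:R)) +
    e0 * n%:R * (6 * eta^-1 * expR (2 * eta^-1) * n%:R) ^+ n.
Proof.
move=> e_0 ep eq b0 be sg g0 z0 z1 gz nl n2 C0 Cg e00 a01 Ha m mn um.
have nn2 : 2 <= n%:R :> R by rewrite (ler_nat R 2 n).
have nn : 0 < n%:R :> R by lra.
have n0 : (0 < n)%N by apply: ltnW.
have p0 : 0 < p by lra.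
have q0 : 0 < 1 - p by lra.
have p01 : 0 < p < 1 by apply/andP; lra.
have e1 : 2 * eta <= 1 by lra.
have ei : 0 < eta^-1 by rewrite invr_gt0.
have ei2 : 2 <= eta^-1 by rewrite -[leRHS]mul1r ler_pdivlMr //; lra.
have zz : zeta ^+ 2 <= zeta by rewrite expr2 ler_piMr // ltW.
have gz1 : 38 * gamma <= eta * zeta ^+ 2.
  have : eta^-1 * gamma >= 2 * gamma by rewrite ler_wpM2r // ltW.
  lra.
have ez : eta * zeta ^+ 2 <= eta * zeta by rewrite ler_wpM2l // ltW.
have ez2 : eta * zeta <= zeta / 2.
  have : eta * zeta <= 2^-1 * zeta by rewrite ler_wpM2r ?(ltW z0) //; clear - e1; lra.
  lra.
have g1 : gamma <= 1 by lra.
have [Npos pre] := recursion_prefactor e_0 ep eq b0 be g0 g1 nl n2 C0 Cg.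
have gn : 64 <= n%:R * gamma.
  have : n%:R * gamma * eta <= n%:R * gamma * 1.
    by rewrite ler_wpM2l ?mulr_ge0 ?(ltW nn) ?(ltW g0) //; clear - e1 e_0; lra.
  clear - nl; lra.
(* A slightly larger number of trials: the extra [gamma n] absorbs the additive error [Ck n] in the
   count of absent edges at the vertex. *)
pose M := Num.truncn (n%:R * (1 + gamma)).
have nG : 0 <= n%:R * (1 + gamma) by rewrite mulr_ge0 // addr_ge0 // ltW.
have /andP[Ml Mu] := truncn_itv nG.
rewrite -/M -natr1 in Ml Mu.
have nM : n%:R <= M%:R :> R.
  by rewrite ler_nat /M truncn_ge_nat //; rewrite mulrDr mulr1 lerDl mulr_ge0 // ltW.
have nMn : (n <= M)%N by rewrite -(ler_nat R).
have M2 : M%:R <= n%:R - 1 + 2 * gamma * n%:R by clear - Ml gn; lra.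
have M3 : M%:R <= 2 * n%:R :> R.
  have : n%:R * gamma <= n%:R * 1 by rewrite ler_wpM2l // ltW.
  clear - Ml; lra.
pose c := (n%:R - 1) * p.
(* The recursion starts at the mode of the comparison law, where [a m0 <= 1] suffices and the
   division by the binomial mass costs only a factor linear in [n]. *)
pose m0 := Num.truncn (p * M.+1%:R).
have pM0 : 0 <= p * M.+1%:R by rewrite mulr_ge0 // ltW.
have /andP[m0l m0u] := truncn_itv pM0; rewrite -/m0 in m0l m0u.
have m0M : (m0 <= M)%N.
  rewrite -ltnS -(ltr_nat R); apply: le_lt_trans m0l _.
  by rewrite gtr_pMl ?ltr0n //; case/andP: p01.
have mode := bin_mass_mode p01 m0M m0l (ltW m0u).
have bm0 := bin_mass_gt0 p01 m0M.
have m0m : (m0 <= m)%N.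
  rewrite -(ler_nat R); apply: le_trans m0l _; rewrite -natr1.
  have h1 : p * M%:R <= p * (n%:R * (1 + gamma)) by rewrite ler_wpM2l // ltW.
  have h2 : p * (n%:R * gamma) <= n%:R * gamma by rewrite ler_piMl ?mulr_ge0 ?(ltW nn) ?(ltW g0) // ltW //; case/andP: p01.
  have h3 : n%:R * (38 * gamma) <= n%:R * (zeta / 2) by rewrite ler_wpM2l ?(ltW nn) //; lra.
  rewrite /c in um; lra.
(* A crude bound on every ratio: [2 eta^-1] for the prefactor, [2 n] for the binomial quotient and
   the exponential for the tilt. It only multiplies the error [e0]. *)
pose Q := 6 * eta^-1 * expR (2 * eta^-1) * n%:R.
have eb1 : 1 <= expR (2 * eta^-1) by rewrite -expR0 ler_expR mulr_ge0 // ltW.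
have Q1 : 1 <= Q.
  have h : 6 * eta^-1 * 1 <= 6 * eta^-1 * expR (2 * eta^-1).
    by rewrite ler_wpM2l // mulr_ge0 // ltW.
  have h6 : 1 <= 6 * eta^-1 by clear - ei2; lra.
  have : 1 * 1 <= 6 * eta^-1 * expR (2 * eta^-1) * n%:R.
    by apply: ler_pM; rewrite // ?ler1n //; apply: le_trans h; rewrite mulr1.
  by rewrite mulr1.
have beta_i : beta <= eta^-1 by rewrite -[leRHS]mul1r ler_pdivlMr.
have pq : p / (1 - p) <= eta^-1.
  rewrite ler_pdivrMr // mulrC ler_pdivlMr //.
  have : p * eta <= 1 * eta by rewrite ler_wpM2r // ?(ltW e_0) // ltW //; case/andP: p01.
  clear - eq; lra.
have pq0 : 0 <= p / (1 - p) by rewrite divr_ge0 // ltW.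
have step := @tail_recursion R a n M m0 p beta gamma e0 Q c p01 b0 (ltW g0) n0
  (leq_trans (leq_pred n) nMn) e00 Q1.
have {}step := step _ _ _ (m - m0)%N; rewrite subnKC // in step.
have {}step : a m <= (1 + gamma) ^+ (m - m0) * (bin_mass M p m / bin_mass M p m0) *
  expR (beta / n%:R * ((m%:R - c) ^+ 2 - (m0%:R - c) ^+ 2)) + e0 * (m - m0)%N%:R * Q ^+ (m - m0).
  apply: step => //.
  - move=> j jn.
    have jR : j%:R + 2 <= n%:R :> R by rewrite -natrD ler_nat addn2.
    have j0 : 0 <= j%:R :> R by [].
    have j1 : 1 <= j.+1%:R :> R by rewrite ler1n.
    have aj := a01 j; have aj1 := a01 j.+1; case/andP: aj => aj_0 aj_1.
    case/andP: aj1 => aj1_0 aj1_1.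
    pose D : R := 'C(n, 2)%:R * (1 - p) - n%:R.
    have D1 : 1 <= D by [].
    have Dj : 0 < j.+1%:R * D by rewrite mulr_gt0 ?ltr0n // (lt_le_trans ltr01).
    rewrite -(ler_pM2r Dj); apply: le_trans (Ha j jn) _.
    rewrite [leRHS]mulrDl; apply: lerD; last first.
      rewrite ler_peMr // -[leLHS]mul1r; apply: ler_pM => //.
    set EX := expR (2 * beta / n%:R * _).
    have -> : (1 + gamma) * (p / (1 - p)) * ((M%:R - j%:R) / j.+1%:R) * EX * a j * (j.+1%:R * D) =
      a j * (((1 + gamma) * p * D / (1 - p)) * (EX * (M%:R - j%:R))).
      by field; rewrite !gt_eqF //; lra.
    rewrite ler_wpM2l // mulrA; apply: ler_pM.
    + by rewrite mulr_ge0 ?expR_ge0 // addr_ge0 ?mulr_ge0 ?exprn_ge0 // ltW.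
    + by rewrite mulr_ge0 ?expR_ge0 // addr_ge0 ?mulr_ge0 ?(ltW nn) //; clear - jR; lra.
    + by rewrite ler_pdivlMr.
    rewrite ler_wpM2l ?expR_ge0 //.
    have : 32 * Ck * n%:R <= eta * gamma * n%:R by rewrite ler_wpM2r // ltW.
    have : gamma * n%:R * eta <= gamma * n%:R * 1.
      by rewrite ler_wpM2l ?mulr_ge0 ?(ltW g0) ?(ltW nn) //; clear - e1 e_0; lra.
    clear - jR Mu gn; lra.
  - move=> j jn.
    have jR : j%:R + 2 <= n%:R :> R by rewrite -natrD ler_nat addn2.
    have j1 : 1 <= j.+1%:R :> R by rewrite ler1n.
    have j0 : 0 <= j%:R :> R by [].
    have EXle : expR (2 * beta / n%:R * (j%:R - c)) <= expR (2 * eta^-1).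
      rewrite ler_expR.
      have : 2 * beta / n%:R * (j%:R - c) <= 2 * beta / n%:R * n%:R.
        rewrite ler_wpM2l ?divr_ge0 ?mulr_ge0 ?(ltW nn) //.
        have : 0 <= c by rewrite mulr_ge0 ?(ltW p0) //; clear - nn2; lra.
        by clear - jR; lra.
      rewrite divfK ?gt_eqF //; clear - beta_i; lra.
    have Yle : (M%:R - j%:R) / j.+1%:R <= 2 * n%:R :> R.
      rewrite ler_pdivrMr ?ltr0n //.
      have : 2 * n%:R * 1 <= 2 * n%:R * j.+1%:R :> R by rewrite ler_wpM2l // mulr_ge0 // ltW.
      clear - M3 j0; lra.
    have Y0 : 0 <= (M%:R - j%:R) / j.+1%:R :> R by rewrite divr_ge0 //; clear - jR nM; lra.
    apply: le_trans (_ : 2 * eta^-1 * (2 * n%:R) * expR (2 * eta^-1) <= _).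
      have g1' : 0 <= 1 + gamma by rewrite addr_ge0 // ltW.
      have g2' : 1 + gamma <= 2 by rewrite -[2]/(1 + 1) lerD2l.
      have gp0 : 0 <= (1 + gamma) * (p / (1 - p)) by exact: mulr_ge0.
      have gp1 := ler_pM g1' pq0 g2' pq.
      apply: ler_pM EXle; first exact: mulr_ge0 gp0 Y0; first exact: expR_ge0.
      exact: ler_pM gp0 Y0 gp1 Yle.
    have : 0 <= eta^-1 * expR (2 * eta^-1) * n%:R by rewrite !mulr_ge0 ?expR_ge0 // ltW.
    rewrite /Q; clear; lra.
  - by case/andP: (a01 m0).
apply: le_trans step _; apply: lerD; last first.
  have mm0 : (m - m0 <= n)%N by rewrite (leq_trans (leq_subr _ _)) // ltnW.
  rewrite -/Q -[leLHS]mulrA -[leRHS]mulrA ler_wpM2l //.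
  apply: ler_pM; first by [].
  - by rewrite exprn_ge0 // (le_trans ler01).
  - by rewrite ler_nat.
  - exact: ler_weXn2l.
have b_pos : 0 < beta + eta by rewrite ltr_wpDl.
have mM : (m <= M)%N by rewrite (leq_trans (ltnW mn)).
have M0 : (0 < M)%N by rewrite (leq_trans n0).
have ch := bin_mass_chernoff p01 b_pos sg M0 mM.
have um0 : 0 <= m%:R - (n%:R - 1) * p by apply: le_trans um; rewrite mulr_ge0 // ltW.
have p01' : 0 <= p <= 1 by case/andP: p01 => ? ?; rewrite !ltW.
have te := @tail_exponent R n M m p beta (beta + eta) gamma p01' b_pos (ltW g0) n0 nM M2 um0 mn.
have gpow : (1 + gamma) ^+ (m - m0) <= expR (gamma * n%:R).
  rewrite mulrC expRM_natl; apply: le_trans (_ : (1 + gamma) ^+ n <= _).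
    by rewrite ler_weXn2l ?lerDl ?(ltW g0) // (leq_trans (leq_subr _ _)) // ltnW.
  by rewrite lerXn2r ?nnegrE ?expR_ge0 ?expR_ge1Dx // addr_ge0 // ltW.
have inv_mode : (bin_mass M p m0)^-1 <= 3 * n%:R.
  rewrite -[leLHS]mul1r ler_pdivrMr //; apply: (le_trans mode).
  by rewrite ler_pM2r // -natr1; clear - M3 nn2; lra.
have b_m0 : 0 <= bin_mass M p m by apply: bin_mass_ge0.
apply: le_trans (_ : expR (gamma * n%:R) * (expR (- ((beta + eta) * (m%:R - p * M%:R) ^+ 2 / M%:R)) * (3 * n%:R)) *
   expR (beta / n%:R * (m%:R - c) ^+ 2) <= _).
  have X0 : 0 <= (1 + gamma) ^+ (m - m0) by rewrite exprn_ge0 // addr_ge0 // ltW.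
  have Z0 : 0 <= bin_mass M p m / bin_mass M p m0 by rewrite divr_ge0 // ltW.
  have i0 : 0 <= (bin_mass M p m0)^-1 by rewrite invr_ge0 ltW.
  apply: ler_pM; [exact: mulr_ge0|exact: expR_ge0| |].
    apply: ler_pM X0 Z0 gpow _; exact: ler_pM.
  rewrite ler_expR ler_wpM2l ?divr_ge0 ?(ltW nn) // gerBl.
  exact: sqr_ge0.
have -> : forall A B D : R, expR A * (expR B * (3 * n%:R)) * expR D = 3 * n%:R * expR (A + (B + D)).
  by move=> A B D; rewrite !expRD; ring.
rewrite ler_wpM2l ?mulr_ge0 ?(ltW nn) // ler_expR.
apply: le_trans (lerD (lexx _) te) _.
have -> : beta + eta - beta = eta by ring.
set u := m%:R - (n%:R - 1) * p in um *.
have uu : (zeta * n%:R) ^+ 2 <= u ^+ 2.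
  by rewrite lerXn2r ?nnegrE // mulr_ge0 // ltW.
have uu2 : eta * zeta ^+ 2 * n%:R <= eta / n%:R * u ^+ 2.
  have : eta / n%:R * (zeta * n%:R) ^+ 2 <= eta / n%:R * u ^+ 2.
    by rewrite ler_wpM2l // divr_ge0 // ltW.
  have -> // : eta / n%:R * (zeta * n%:R) ^+ 2 = eta * zeta ^+ 2 * n%:R.
  by field; rewrite gt_eqF.
(* The total loss is [6 b gamma n] from the change of centring, with [b = beta + eta], plus
   [gamma n] from the power of [1 + gamma]; the hypothesis linking [gamma] to [zeta] makes it at
   most half of the gain. *)
have bg : (6 * (beta + eta) + 1) * (gamma * n%:R) <= (6 * (eta^-1 + 1) + 1) * (gamma * n%:R).
  by rewrite ler_wpM2r ?mulr_ge0 ?(ltW g0) ?(ltW nn) //; clear - beta_i e1; lra.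
have gzn : 2 * (6 * (eta^-1 + 1) + 1) * gamma * n%:R <= eta * zeta ^+ 2 * n%:R.
  by rewrite ler_wpM2r // ltW.
clear - uu2 bg gzn; lra.
Qed.

End AbstractTail.

(** * Absorbing polynomial and superexponential factors *)

Section EventualBounds.
Variable R : realType.

(** From [e^y >= (y / (m + 1))^(m + 1)]: one extra power of [n] dominates the coefficient [A]. *)
Lemma poly_le_expR (A d : R) (m : nat) : 0 < d ->
  exists n0, forall n, (n0 <= n)%N -> A * n%:R ^+ m <= expR (d * n%:R).
Proof.
move=> d0; pose q := (d / m.+1%:R) ^+ m.+1.
have q0 : 0 < q by rewrite exprn_gt0 // divr_gt0 ?ltr0n.
exists (Num.truncn (`|A| / q)).+1 => n nn.
have An : A <= q * n%:R.
  apply: le_trans (ler_norm A) _; rewrite mulrC -ler_pdivrMr //.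
  apply: le_trans (ltW (truncnS_gt _)) _; by rewrite ler_nat.
apply: le_trans (_ : q * n%:R * n%:R ^+ m <= _); first by rewrite ler_wpM2r // exprn_ge0.
rewrite -mulrA -exprS /q -exprMn.
have -> : expR (d * n%:R) = expR (d / m.+1%:R * n%:R) ^+ m.+1.
  by rewrite -expRM_natl [_ * (_ * n%:R)]mulrA mulrCA mulfV ?pnatr_eq0 // mulr1.
have y0 : 0 <= d / m.+1%:R * n%:R by rewrite mulr_ge0 // divr_ge0 // ltW.
rewrite lerXn2r ?nnegrE ?expR_ge0 //.
by apply: le_trans (expR_ge1Dx _); rewrite lerDr.
Qed.

(** Every factor except the Gaussian one is at most a power [(A n)^(j n)], hence [e^{O(n log n)}],
    which [e^{- d n^2}] dominates with room for [e^{- h n}]. *)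
Lemma error_negligible (K E d h : R) : 1 <= K -> 1 <= E -> 0 < d ->
  exists n0, forall n, (n0 <= n)%N ->
  n.+1%:R ^+ n * ('C(n, 2)%:R + 1) * expR (- (d * n%:R ^+ 2)) * (E * 'C(n, 2)%:R ^+ 2) *
    n%:R * (K * n%:R) ^+ n <= expR (- (h * n%:R)).
Proof.
move=> K1 E1 d0; pose A := 2 * K * E.
have KE : 1 <= K * E by rewrite -[leLHS]mulr1; apply: ler_pM.
have A2 : 2 <= A by rewrite /A -mulrA ler_peMr.
have AK : K <= A by rewrite /A mulrAC; rewrite ler_peMl //; clear - K1 E1; lra.
have AE : E <= A by rewrite /A ler_peMl //; clear - K1 E1; lra.
have d18 : 0 < d / 18 by rewrite divr_gt0.
have [n1 Hn1] := @poly_le_expR A _ 1 d18.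
exists (maxn (maxn n1 7) (Num.truncn (2 * h / d)).+1) => n.
rewrite !geq_max -andbA => /and3P[nn1 n7 nh].
have n7R : 7 <= n%:R :> R by rewrite (ler_nat R 7).
have nn : 0 < n%:R :> R by clear - n7R; lra.
have Ah : h <= d / 2 * n%:R.
  have : 2 * h / d <= n%:R.
    by apply: le_trans (ltW (truncnS_gt _)) _; rewrite ler_nat.
  by rewrite ler_pdivrMr //; clear; lra.
set N : R := 'C(n, 2)%:R.
have N0 : 0 <= N by [].
have N2 : N <= n%:R ^+ 2.
  rewrite /N binR2 expr2; have : 0 <= n%:R * n%:R :> R by rewrite mulr_ge0.
  clear - nn; lra.
have N1 : N + 1 <= n%:R ^+ 2.
  rewrite /N binR2 expr2; have : 7 * 7 <= n%:R * n%:R :> R by apply: ler_pM.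
  clear - nn; lra.
have nA : n%:R <= A * n%:R by rewrite ler_peMl ?(ltW nn) //; clear - A2; lra.
have An1 : 1 <= A * n%:R by apply: le_trans nA; clear - n7R; lra.
have f1 : n.+1%:R ^+ n <= (A * n%:R) ^+ n.
  rewrite lerXn2r ?nnegrE ?(le_trans ler01 An1) // -natr1.
  have : 2 * n%:R <= A * n%:R by rewrite ler_wpM2r.
  clear - n7R; lra.
have f2 : (K * n%:R) ^+ n <= (A * n%:R) ^+ n.
  by rewrite lerXn2r ?nnegrE ?ler_wpM2r ?(le_trans ler01 An1) // mulr_ge0 // (le_trans ler01).
have f3 : (N + 1) * (E * N ^+ 2) * n%:R <= (A * n%:R) ^+ (7 * n).
  apply: le_trans (_ : (A * n%:R) ^+ 7 <= _); last by rewrite ler_weXn2l // leq_pmulr // (leq_trans _ n7).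
  apply: le_trans (_ : n%:R ^+ 2 * (E * (n%:R ^+ 2) ^+ 2) * n%:R <= _).
    rewrite ler_wpM2r //; apply: ler_pM => //; first by rewrite addr_ge0.
      by rewrite mulr_ge0 ?exprn_ge0 //; clear - E1; lra.
    by rewrite ler_wpM2l ?lerXn2r ?nnegrE ?exprn_ge0 //; clear - E1; lra.
  have -> : n%:R ^+ 2 * (E * (n%:R ^+ 2) ^+ 2) * n%:R = E * n%:R ^+ 7 :> R by ring.
  rewrite exprMn ler_wpM2r ?exprn_ge0 //; apply: (le_trans AE).
  by rewrite -[leLHS]expr1 ler_weXn2l //; clear - A2; lra.
(* The exponent [9 n] collects [n] from the degree sequences, [7 n] from the polynomial factors and
   [n] from the amplification in the recursion; accordingly [A n <= e^{(d / 18) n}]. *)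
have key : (A * n%:R) ^+ (9 * n) <= expR (d / 2 * n%:R ^+ 2).
  have -> : expR (d / 2 * n%:R ^+ 2) = expR (d / 18 * n%:R) ^+ (9 * n).
    by rewrite -expRM_natl natrM; congr expR; field.
  by rewrite lerXn2r ?nnegrE ?expR_ge0 ?(le_trans ler01) //; have := Hn1 n nn1; rewrite expr1.
have -> : n.+1%:R ^+ n * (N + 1) * expR (- (d * n%:R ^+ 2)) * (E * N ^+ 2) * n%:R * (K * n%:R) ^+ n
  = (n.+1%:R ^+ n * ((N + 1) * (E * N ^+ 2) * n%:R) * (K * n%:R) ^+ n) * expR (- (d * n%:R ^+ 2)) by ring.
apply: le_trans (_ : expR (d / 2 * n%:R ^+ 2) * expR (- (d * n%:R ^+ 2)) <= _).
  rewrite ler_wpM2r ?expR_ge0 //; apply: le_trans key.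
  have -> : (9 * n = n + 7 * n + n)%N by rewrite -{2 4}(mul1n n) -!mulnDl.
  have E0 : 0 <= E by clear - E1; lra.
  have K0 : 0 <= K by clear - K1; lra.
  have g1 : 0 <= n.+1%:R ^+ n :> R by rewrite exprn_ge0.
  have g2 : 0 <= (K * n%:R) ^+ n by rewrite exprn_ge0 // mulr_ge0.
  have g3 : 0 <= (N + 1) * (E * N ^+ 2) * n%:R by rewrite !mulr_ge0 ?exprn_ge0 ?addr_ge0.
  by rewrite exprD exprD; apply: ler_pM; [exact: mulr_ge0|by []|exact: ler_pM|by []].
rewrite -expRD ler_expR.
have : h * n%:R <= d / 2 * n%:R * n%:R by rewrite ler_wpM2r // ltW.
clear; rewrite expr2; lra.
Qed.

End EventualBounds.

(** * Concentration of the Gibbs measure on the regular set *)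

Section StaticConcentration.
Variable R : realType.

Lemma level_itv n k (beta : R) (v : 'I_n) m : 0 <= level k beta v m <= 1.
Proof.
have mu0 (x : Omega n k) : 0 <= mu beta x by exact/ltW/mu_gt0.
rewrite /level sumr_ge0 //=.
case: (pickP (fun x : Omega n k => deg (val x) v == m)) => [x _|none].
  have [_ <-] := mu_distribution beta x.
  by rewrite [leLHS]big_mkcond; apply: ler_sum => y _; case: ifP.
by rewrite big_pred0.
Qed.

(** The constants are fixed in the order [gamma], [kappa], [n0], each from [eta] and [zeta] alone,
    so the bound is uniform in [p] and [beta]. *)
Lemma level_concentration (eta zeta : R) : 0 < eta -> 2 * eta <= 1 -> 0 < zeta -> zeta <= 1 ->
  exists n0, forall p beta : R, eta <= p -> eta <= 1 - p -> 0 <= beta -> beta * eta <= 1 ->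
  subgauss p (beta + eta) -> forall n k (v : 'I_n) m, (n0 <= n)%N -> k%:R = 'C(n, 2)%:R * p ->
  (m < n)%N -> zeta * n%:R <= `|m%:R - (n%:R - 1) * p| ->
  level k beta v m <= 4 * n%:R * expR (- (eta * zeta ^+ 2 / 2 * n%:R)).
Proof.
move=> e0 e1 z0 z1; have ei : 0 < eta^-1 by rewrite invr_gt0.
have Z0 : 0 < eta * zeta ^+ 2 by rewrite mulr_gt0 ?exprn_gt0.
pose G := 2 * (6 * (eta^-1 + 1) + 1).
have G0 : 0 < G by rewrite /G; clear - ei; lra.
pose gamma := eta * zeta ^+ 2 / G.
have g0 : 0 < gamma by rewrite divr_gt0.
have gG : G * gamma <= eta * zeta ^+ 2 by rewrite /gamma mulrC divfK ?gt_eqF.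
have cc_ge0 (b : R) : 0 <= b -> 0 <= crossing_const b.
  by move=> b0; rewrite /crossing_const !mulr_ge0 ?expR_ge0.
pose Cc := crossing_const eta^-1 + 1.
have Cc0 : 0 < Cc by rewrite ltr_wpDl // cc_ge0 // ltW.
(* Chosen so that the averaging error [crossing_const beta * kappa] is at most [eta gamma / 32],
   uniformly in [beta]. *)
pose kappa := eta * gamma / (32 * Cc).
have ka0 : 0 < kappa by apply: divr_gt0; exact: mulr_gt0.
have d0 : 0 < eta * kappa ^+ 2 by apply: mulr_gt0; rewrite ?exprn_gt0.
pose K := 6 * eta^-1 * expR (2 * eta^-1); pose E := expR (4 * eta^-1).
have E1 : 1 <= E by rewrite -expR0 ler_expR mulr_ge0 // ltW.
have K1 : 1 <= K.
  have ei2 : 2 <= eta^-1 by rewrite -[leRHS]mul1r ler_pdivlMr.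
  rewrite /K -[leLHS]mulr1; apply: ler_pM => //; first by clear - ei2; lra.
  by rewrite -expR0 ler_expR mulr_ge0 // ltW.
have [n1 Hn1] := error_negligible (eta * zeta ^+ 2 / 2) K1 E1 d0.
exists (maxn (maxn n1 2) (Num.truncn (64 / (eta * gamma))).+1) => p beta ep eq b0 be sg n k v m.
rewrite !geq_max -andbA => /and3P[nn1 n2 n64] kE mn um.
have nl : 64 <= n%:R * eta * gamma.
  rewrite -mulrA -ler_pdivrMr; last exact: mulr_gt0.
  by apply: le_trans (ltW (truncnS_gt _)) _; rewrite ler_nat.
have beta_i : beta <= eta^-1 by rewrite -[leRHS]mul1r ler_pdivlMr.
have ccb : crossing_const beta <= Cc.
  apply: le_trans (_ : crossing_const eta^-1 <= _); last by rewrite lerDl.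
  rewrite /crossing_const; apply: ler_pM; rewrite ?mulr_ge0 ?expR_ge0 //.
    by rewrite ler_wpM2l.
  by rewrite ler_expR ler_wpM2l.
pose Ck := crossing_const beta * kappa.
have Ck0 : 0 <= Ck by rewrite mulr_ge0 ?cc_ge0 // ltW.
have Ckg : 32 * Ck <= eta * gamma.
  have h : Ck <= Cc * kappa by rewrite ler_wpM2r // ltW.
  have -> : eta * gamma = 32 * (Cc * kappa) by rewrite /kappa; field; rewrite gt_eqF.
  by rewrite ler_wpM2l.
have p01 : 0 < p < 1 by apply/andP; clear - ep eq e0; split; lra.
have nn : 0 < n%:R :> R by rewrite ltr0n (leq_trans _ n2).
pose bad := fun x : Omega n k => kappa ^+ 2 * n%:R ^+ 3 < sqdev p (val x).
have M0 : 0 <= mass (@mu R n k beta) bad by apply: sumr_ge0 => x _; exact/ltW/mu_gt0.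
pose er := mass (@mu R n k beta) bad * (expR (4 * beta) * 'C(n, 2)%:R ^+ 2).
have er0 : 0 <= er by rewrite !mulr_ge0 ?expR_ge0 ?exprn_ge0.
have K0 : 0 <= K by rewrite !mulr_ge0 ?expR_ge0 // ltW.
have er_le : er * n%:R * (K * n%:R) ^+ n <= expR (- (eta * zeta ^+ 2 / 2 * n%:R)).
  apply: le_trans (Hn1 n nn1).
  have Kn : 0 <= (K * n%:R) ^+ n by apply: exprn_ge0; exact: mulr_ge0.
  rewrite [in leLHS]/er ler_wpM2r // ler_wpM2r //.
  apply: ler_pM; [exact: M0|by rewrite mulr_ge0 ?expR_ge0 ?exprn_ge0| |].
    have be1 : 0 <= beta <= beta + eta by rewrite b0 lerDl ltW.
    have := mu_sqdev_tail p01 (ltr_wpDl b0 e0) be1 sg n2 kE (sqr_ge0 kappa).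
    by have -> : beta + eta - beta = eta by ring.
  by rewrite ler_wpM2r ?exprn_ge0 // ler_expR ler_wpM2l.
have fin (a : R) : a <= 3 * n%:R * expR (- (eta * zeta ^+ 2 / 2 * n%:R)) +
    er * n%:R * (6 * eta^-1 * expR (2 * eta^-1) * n%:R) ^+ n ->
    a <= 4 * n%:R * expR (- (eta * zeta ^+ 2 / 2 * n%:R)).
  move=> h; apply: le_trans h _; apply: le_trans (lerD (lexx _) er_le) _.
  have : 1 * expR (- (eta * zeta ^+ 2 / 2 * n%:R)) <= n%:R * expR (- (eta * zeta ^+ 2 / 2 * n%:R)).
    by rewrite ler_wpM2r ?expR_ge0 // ler1n (leq_trans _ n2).
  clear; lra.
move: um; rewrite ler_normr => /orP[um|um]; apply: fin.
  apply: (@level_tail R (fun m => level k beta v m) n p beta eta zeta gamma Ck er) => //.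
    by move=> i; exact: level_itv.
  move=> i iN; have H := level_up v p01 b0 ka0 kE (ltnW iN); rewrite kE in H.
  apply: le_trans H.
  have /andP[l0 _] := level_itv k beta v i.+1.
  rewrite ler_wpM2l // ler_wpM2l //.
  have : 0 <= i.+1%:R :> R by [].
  clear; lra.
(* The lower tail becomes an upper tail for the complementary degree [n - 1 - m] and density
   [1 - p]. *)
have mm' : (n.-1 - (n.-1 - m) = m)%N by rewrite subKn // -ltnS prednK // (leq_trans _ n2).
rewrite -[in leLHS]mm'; set m' := (n.-1 - m)%N.
have natr_refl i : (i < n)%N -> (n.-1 - i)%N%:R = n%:R - 1 - i%:R :> R.
  move=> iN; have n_gt0 : (0 < n)%N by apply: leq_ltn_trans iN.
  rewrite natrB; last by rewrite -ltnS prednK.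
  by rewrite -subn1 natrB.
have q01 : 0 < 1 - p < 1 by move: p01; clear; lra.
have ep' : eta <= 1 - (1 - p) by clear - ep; lra.
have m'n : (m' < n)%N by rewrite /m' (leq_ltn_trans (leq_subr _ _)) // prednK // (leq_trans _ n2).
apply: (@level_tail R (fun i => level k beta v (n.-1 - i)%N) n (1 - p) beta eta zeta gamma Ck er) => //.
- exact: subgaussC.
- by move=> i; exact: level_itv.
- move=> i iN; pose j := (n.-1 - i.+1)%N.
  have jS : (n.-1 - i)%N = j.+1 by rewrite /j subnS prednK // subn_gt0 -ltnS prednK // (leq_trans _ n2).
  have jn : (j < n)%N by rewrite /j (leq_ltn_trans (leq_subr _ _)) // prednK // (leq_trans _ n2).
  have jE : j%:R = n%:R - 1 - i.+1%:R :> R by exact: natr_refl.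
  have j1E : j.+1%:R = n%:R - 1 - i%:R :> R by rewrite -jS natr_refl // ltnW.
  rewrite jS -/j; have H := level_down v p01 b0 ka0 kE jn.
  have /andP[l0 _] := level_itv k beta v j.
  have -> : 1 - (1 - p) = p by ring.
  apply: le_trans (le_trans _ H) _.
    rewrite ler_wpM2l // kE.
    have -> : n%:R - 1 - j%:R = i.+1%:R :> R by rewrite jE; ring.
    rewrite mulrC ler_wpM2r // lerD2l lerN2.
    by rewrite ler_nat ltnW.
  rewrite kE -/Ck j1E.
  have -> : - (2 * beta / n%:R * (n%:R - 1 - i%:R - (n%:R - 1) * p)) =
    2 * beta / n%:R * (i%:R - (n%:R - 1) * (1 - p)) by ring.
  have -> : 'C(n, 2)%:R - 'C(n, 2)%:R * p = 'C(n, 2)%:R * (1 - p) by ring.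
  by rewrite [X in expR (4 * beta / n%:R) * X]mulrC.
rewrite natr_refl //.
have -> : n%:R - 1 - m%:R - (n%:R - 1) * (1 - p) = - (m%:R - (n%:R - 1) * p) by ring.
by [].
Qed.

(** An edge degree is the sum of the degrees of its endpoints up to a bounded correction. An edge
    degree off by more than [2 n eps] therefore forces one endpoint to deviate by [n eps / 2]; the
    slack [n eps] covers the correction, which is at most 4. *)
Lemma dev_large n k (p eps : R) (x : Omega n k) : 0 <= p <= 1 -> (0 < n)%N ->
  4 <= n%:R * eps -> ~~ Gamma p eps x -> exists v, eps / 2 * n%:R <= `|dev p (val x) v|.
Proof.
move=> /andP[p0 p1] n0 ne nG.
have [e he] : exists e, 2 * n%:R * eps < `|edeg R (val x) e - 2 * n%:R * p|.
  apply/not_existsP => no; move/negP: nG; apply; apply/GammaP => // e.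
  by rewrite leNgt; apply/negP; exact: no.
apply/not_existsP => no.
have S : \sum_(v in val e) dev p (val x) v =
    edeg R (val x) e - 2 * n%:R * p + 2 * (edg R (val x) e + p).
  rewrite sumrB sum_deg_edge sumr_const (eqP (valP e)) -mulr_natl.
  by ring.
have U : `|\sum_(v in val e) dev p (val x) v| <= eps * n%:R.
  apply: le_trans (ler_norm_sum _ _ _) _.
  apply: le_trans (_ : \sum_(v in val e) eps / 2 * n%:R <= _).
    apply: ler_sum => v _; rewrite leNgt; apply/negP => /ltW; exact: no.
  rewrite sumr_const (eqP (valP e)) -[leLHS]mulr_natl.
  by rewrite le_eqVlt; apply/orP; left; apply/eqP; field.
have E : `|edg R (val x) e + p| <= 2.
  rewrite /edg ger0_norm ?addr_ge0 //; case: (val x e); clear - p1; rewrite /=; lra.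
have : `|edeg R (val x) e - 2 * n%:R * p| <= eps * n%:R + 4.
  have -> : edeg R (val x) e - 2 * n%:R * p =
    \sum_(v in val e) dev p (val x) v - 2 * (edg R (val x) e + p) by rewrite S; ring.
  apply: le_trans (ler_normB _ _) _; rewrite normrM (@ger0_norm _ 2) //.
  clear - U E; lra.
clear - he ne; lra.
Qed.

(** A union bound over the [n] vertices and the [n] possible degrees; half of the exponential rate
    pays for the resulting factor [4 n^3]. *)
Lemma Gamma_concentration (eta eps : R) : 0 < eta -> 2 * eta <= 1 -> 0 < eps -> eps <= 1 ->
  exists c n0, 0 < c /\ forall p beta : R, eta <= p -> eta <= 1 - p -> 0 <= beta ->
  beta * eta <= 1 -> subgauss p (beta + eta) -> forall n k, (n0 <= n)%N ->
  k%:R = 'C(n, 2)%:R * p -> mass (@mu R n k beta) (predC (Gamma p eps)) <= expR (- (c * n%:R)).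
Proof.
move=> e0 e1 s0 s1.
have z0 : 0 < eps / 2 by rewrite divr_gt0.
have z1 : eps / 2 <= 1 by clear - s1; lra.
have [n1 H1] := level_concentration e0 e1 z0 z1.
pose h := eta * (eps / 2) ^+ 2 / 2.
have h0 : 0 < h by rewrite !mulr_gt0 ?exprn_gt0 ?invr_gt0.
have h2 : 0 < h / 2 by rewrite divr_gt0.
have [n2 H2] := poly_le_expR 4 3 h2.
exists (h / 2), (maxn (maxn n1 n2) (Num.truncn (4 / eps)).+1); split=> //.
move=> p beta ep eq b0 be sg n k; rewrite !geq_max -andbA => /and3P[nn1 nn2 ne] kE.
have n0 : (0 < n)%N by apply: leq_trans ne.
have ne4 : 4 <= n%:R * eps.
  rewrite -ler_pdivrMr //.
  by apply: le_trans (ltW (truncnS_gt _)) _; rewrite ler_nat.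
have p01 : 0 <= p <= 1 by apply/andP; clear - ep eq e0; split; lra.
have mu0 (x : Omega n k) : 0 <= mu beta x by exact/ltW/mu_gt0.
pose large (u : R) := eps / 2 * n%:R <= `|u|.
pose B := 4 * n%:R * expR (- (h * n%:R)).
have B0 : 0 <= B by rewrite !mulr_ge0 ?expR_ge0.
have tail v : \sum_(x : Omega n k | large (dev p (val x) v)) mu beta x <= n%:R * B.
  have dn (x : Omega n k) : (deg (val x) v < n)%N.
    by rewrite (leq_ltn_trans (deg_le _ _)) // prednK.
  rewrite (partition_big (fun x => Ordinal (dn x)) xpredT) //=.
  apply: le_trans (_ : \sum_(m < n) B <= _); last by rewrite sumr_const card_ord mulr_natl.
  apply: ler_sum => m _.
  have [lm|sm] := boolP (large (m%:R - (n%:R - 1) * p)); last first.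
    rewrite big_pred0 // => x; apply/negP => /andP[+ /eqP xm].
    by rewrite /dev /degR -[X in X%:R]/(nat_of_ord (Ordinal (dn x))) xm => /(negP sm).
  apply: le_trans (H1 p beta ep eq b0 be sg n k v m nn1 kE (ltn_ord m) lm).
  rewrite /level [leLHS]big_mkcond [leRHS]big_mkcond; apply: ler_sum => x _.
  rewrite -(inj_eq val_inj) /=; case: ifP => [/andP[_ ->]|_] //.
  by case: ifP.
apply: le_trans (_ : \sum_v \sum_(x : Omega n k | large (dev p (val x) v)) mu beta x <= _).
  under [leRHS]eq_bigr => v _ do rewrite big_mkcond.
  rewrite exchange_big /mass [leLHS]big_mkcond; apply: ler_sum => x _ /=.
  case: ifP => [xG|_]; last by apply: sumr_ge0 => v _; case: ifP.
  have [v hv] := dev_large p01 n0 ne4 xG.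
  rewrite (bigD1 v) //= /large hv lerDl; apply: sumr_ge0 => w _; case: ifP => //.
apply: le_trans (_ : \sum_(v < n) n%:R * B <= _); first exact: ler_sum.
rewrite sumr_const card_ord -[leLHS]mulr_natl.
have -> : n%:R * (n%:R * B) = 4 * n%:R ^+ 3 * expR (- (h * n%:R)) by rewrite /B; ring.
apply: le_trans (ler_wpM2r (expR_ge0 _) (H2 n nn2)) _.
by rewrite -expRD ler_expR le_eqVlt; apply/orP; left; apply/eqP; field.
Qed.

End StaticConcentration.

(** * Uniform constants, confinement and mixing time *)

Section Confinement.
Variable R : realType.

(** The gap between [beta] and [c_crit p] is used only through the subgaussian bound at
    [beta + eta]; the cap at [1 / 2] provides [2 eta <= 1]. *)
Lemma uniform_constants (B : set (R * R)) : compact B -> (B `<=` @R_Kaw R)%classic ->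
  exists eta : R, [/\ 0 < eta, 2 * eta <= 1 & forall p beta, B (p, beta) ->
    [/\ eta <= p, eta <= 1 - p, 0 <= beta, beta * eta <= 1
      & 4 * beta * p * (1 - p) <= 2^-1 - eta] /\ subgauss p (beta + eta)].
Proof.
move=> Bc Bs; have [e [e0 H]] := region_uniform Bc Bs.
pose eta := Order.min e 2^-1.
have eta0 : 0 < eta by rewrite lt_min e0 invr_gt0 ltr0n.
have ele : eta <= e by rewrite ge_min lexx.
have elh : eta <= 2^-1 by rewrite ge_min lexx orbT.
exists eta; split=> //; first by clear - elh; lra.
move=> p beta /H [h1 h2 /andP[h3 h4] h5 h6].
split; first split=> //.
- exact: le_trans h1.
- exact: le_trans h2.
- apply: le_trans (_ : beta * e <= _); first by rewrite ler_wpM2l.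
  by rewrite -ler_pdivlMr // mul1r.
- by apply: le_trans h5 _; rewrite lerD2l lerN2.
have p01 : 0 < p < 1 by apply/andP; clear - h1 h2 e0; split; lra.
have [_ sg] := subgauss_crit p01; apply: subgauss_le sg; first by rewrite ltr_wpDl.
by apply: le_trans h6; rewrite lerD2l.
Qed.

Lemma binR2_le n : 2 * 'C(n, 2)%:R <= n%:R ^+ 2 :> R.
Proof. by rewrite binR2 expr2; have : 0 <= n%:R :> R by []; clear; lra. Qed.

Lemma contraction_factor_ge0 n (eta : R) : (2 <= n)%N -> 2 * eta <= 1 ->
  0 <= 1 - eta / (2 * 'C(n, 2)%:R).
Proof.
move=> n2 e1; have N1 : 1 <= 'C(n, 2)%:R :> R by rewrite ler1n bin_gt0.
by rewrite subr_ge0 ler_pdivrMr; clear - N1 e1; lra.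
Qed.

(** The least value of the Lyapunov function outside [Gamma p e]. *)
Definition exit_level n (eta e : R) := expR (tilt eta e * (2 * n%:R * e)).

(** The largest expected increase of the Lyapunov function in one step from [Gamma p e]. *)
Definition step_gain n (eta e : R) :=
  2 * 'C(n, 2)%:R * expR (tilt eta e * (1 + 2 * n%:R * ((1 - eta) * e))).

(** The gap, per unit of [n], between the exponents of [exit_level] and [step_gain]. *)
Definition exit_rate (eta e : R) := 2 * tilt eta e * eta * e.

(** Starting at half width puts the initial value below the exit level by a factor that is at least
    as favourable as the one for a single step, because [2 eta <= 1]. The factor [expR 1] comes from
    the jump size, as the tilt is at most 1. *)
Lemma exit_bound n k (p beta eta e : R) (x : Omega n k) T : 2 * eta <= 1 ->
  drift_regime n k p beta eta e -> Gamma p (e / 2) x ->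
  (lyapunov p (tilt eta e) x + T%:R * step_gain n eta e) / exit_level n eta e <=
  (1 + T%:R) * (expR 1 * n%:R ^+ 2 * expR (- (exit_rate eta e * n%:R))).
Proof.
move=> e1 H Gx; have n0 : (0 < n)%N by apply: ltnW (regime_n H).
have et0 := regime_eta H; have s0 := regime_eps H.
set lam := tilt eta e; have l0 : 0 < lam by rewrite /lam /tilt !mulr_gt0 ?invr_gt0.
have s1 : e <= 1.
  have : eta ^+ 2 <= 1 by rewrite expr_le1 //; clear - e1 et0; lra.
  by have := regime_eps_le H; clear; lra.
have l1 : lam <= 1.
  rewrite /lam /tilt; have : eta * e <= 1 * 1 by apply: ler_pM => //; clear - e1 et0 s0; lra.
  clear; lra.
have L0 : 0 < exit_level n eta e by exact: expR_gt0.
set W := expR 1 * n%:R ^+ 2 * _.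
have W1 b : b <= 1 - exit_rate eta e * n%:R -> 2 * 'C(n, 2)%:R * expR b <= W.
  move=> hb; rewrite /W [expR 1 * _]mulrC -[leRHS]mulrA -expRD.
  by apply: ler_pM; rewrite ?expR_ge0 ?mulr_ge0 ?ler_expR // binR2_le.
rewrite mulrDl mulrDl mul1r; apply: lerD.
  apply: le_trans (_ : 2 * 'C(n, 2)%:R * expR (lam * (2 * n%:R * (e / 2))) / exit_level n eta e <= _).
    by rewrite ler_wpM2r ?invr_ge0 ?(ltW L0) // lyapunov_inside // ltW.
  rewrite /exit_level -expRN -[leLHS]mulrA -expRD; apply: W1; rewrite /exit_rate -/lam.
  have : (2 * eta) * (lam * e * n%:R) <= 1 * (lam * e * n%:R).
    by rewrite ler_wpM2r // !mulr_ge0 // ltW.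
  clear; lra.
rewrite -[leLHS]mulrA ler_wpM2l //.
rewrite /step_gain /exit_level -/lam -[leLHS]mulrA -expRN -expRD; apply: W1.
rewrite /exit_rate -/lam; clear - l1; lra.
Qed.

Section Regime.
Variables (n k : nat) (p beta eta e : R).
Hypothesis regime : drift_regime n k p beta eta e.

Let lam_ge0 : 0 <= tilt eta e.
Proof.
by rewrite /tilt !mulr_ge0 ?invr_ge0 ?(ltW (regime_eta regime)) ?(ltW (regime_eps regime)).
Qed.

Let n_gt0 : (0 < n)%N. Proof. exact: ltnW (regime_n regime). Qed.

Let stoch : stochastic (@kawasaki R n k beta).
Proof. exact: stochastic_kawasaki (k_pos regime) (k_small regime). Qed.

Let gain_ge0 : 0 <= step_gain n eta e. Proof. by rewrite !mulr_ge0 ?expR_ge0. Qed.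

Lemma kawasaki_survival (x : Omega n k) T : 2 * eta <= 1 -> Gamma p (e / 2) x ->
  1 - (1 + T%:R) * (expR 1 * n%:R ^+ 2 * expR (- (exit_rate eta e * n%:R))) <=
  survival (kawasaki beta) (Gamma p e) T x.
Proof.
move=> e1 Gx; apply: le_trans (_ : 1 - (lyapunov p (tilt eta e) x + T%:R * step_gain n eta e) /
   exit_level n eta e <= _).
  by rewrite lerD2l lerN2; exact: exit_bound e1 regime Gx.
apply: survival_lyapunov => //.
- exact: expR_gt0.
- by move=> y; exact: lyapunov_ge0.
- by move=> y Gy; exact: lyapunov_drift regime Gy.
- by move=> y Gy; exact: lyapunov_outside n_gt0 lam_ge0 Gy.
Qed.

Lemma kawasaki_contraction (x y : Omega n k) T : 2 * eta <= 1 ->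
  Gamma p (e / 2) x -> Gamma p (e / 2) y ->
  dTV (step_law (kawasaki beta) x T) (step_law (kawasaki beta) y T) <=
  (1 - eta / (2 * 'C(n, 2)%:R)) ^+ T * 'C(n, 2)%:R +
  2 * ((1 + T%:R) * (expR 1 * n%:R ^+ 2 * expR (- (exit_rate eta e * n%:R)))).
Proof.
move=> e1 Gx Gy.
have r0 := contraction_factor_ge0 (regime_n regime) e1.
have H := (@dTV_contraction R _ _ (Gamma p e) (lyapunov p (tilt eta e)) (@hamming R n k)
  (exit_level n eta e) (step_gain n eta e) (1 - eta / (2 * 'C(n, 2)%:R)) T x y
  stoch (expR_gt0 _) gain_ge0 r0).
apply: le_trans (H _ _ _ _ _ _) _ => {H}.
- by move=> z; exact: lyapunov_ge0.
- by move=> z Gz; exact: lyapunov_drift regime Gz.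
- by move=> z Gz; exact: lyapunov_outside n_gt0 lam_ge0 Gz.
- by move=> z w; exact: hamming_ge0.
- by move=> z w; exact: hamming_ge1.
- by move=> z w Gz Gw; exact: contraction_coupling regime Gz Gw.
apply: lerD; first by rewrite ler_wpM2l ?exprn_ge0 ?hamming_le.
have -> : (lyapunov p (tilt eta e) x + lyapunov p (tilt eta e) y + T%:R * (2 * step_gain n eta e)) /
  exit_level n eta e =
  (lyapunov p (tilt eta e) x + T%:R * step_gain n eta e) / exit_level n eta e +
  (lyapunov p (tilt eta e) y + T%:R * step_gain n eta e) / exit_level n eta e.
  by rewrite -mulrDl; congr (_ / _); ring.
by rewrite [2 * _]mulr_natl mulr2n lerD // (exit_bound T e1 regime).
Qed.

End Regime.

(** After [T] steps the contraction factor is at most [(n^2 / delta)^(-2)]. One such factor cancels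
    the initial distance, the other yields [delta] with a gain of [1 / n^2]. *)
Lemma geometric_mixing n (eta delta : R) T : (2 <= n)%N -> 0 < eta -> 2 * eta <= 1 ->
  0 < delta -> delta <= 1 -> 2 / eta * n%:R ^+ 2 * ln (n%:R ^+ 2 / delta) <= T%:R ->
  (1 - eta / (2 * 'C(n, 2)%:R)) ^+ T * 'C(n, 2)%:R <= delta / 4.
Proof.
move=> n2 e0 e1 d0 d1 hT; have nn2 : 2 <= n%:R :> R by rewrite (ler_nat R 2).
have nsq : 4 <= n%:R ^+ 2 :> R.
  have : 2 * 2 <= n%:R * n%:R :> R by apply: ler_pM.
  by rewrite expr2; clear; lra.
have N1 : 1 <= 'C(n, 2)%:R :> R by rewrite ler1n bin_gt0.
have NN := binR2_le n.
have r0 := contraction_factor_ge0 n2 e1.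
pose w := n%:R ^+ 2 / delta.
have n20 : 0 < n%:R ^+ 2 :> R by clear - nsq; lra.
have w0 : 0 < w by rewrite divr_gt0.
have key : (1 - eta / (2 * 'C(n, 2)%:R)) ^+ T <= (w ^+ 2)^-1.
  apply: le_trans (_ : expR (- (eta / n%:R ^+ 2)) ^+ T <= _).
    rewrite lerXn2r ?nnegrE ?expR_ge0 //; apply: le_trans (expR_ge1Dx _).
    rewrite lerD2l lerN2 ler_wpM2l ?(ltW e0) // lef_pV2 ?posrE //.
    by clear - N1; lra.
  have -> : (w ^+ 2)^-1 = expR (- (2 * ln w)).
    by rewrite expRN expRM_natl lnK ?posrE.
  rewrite -expRM_natl ler_expR mulrN lerN2.
  have : eta / n%:R ^+ 2 * (2 / eta * n%:R ^+ 2 * ln w) <= eta / n%:R ^+ 2 * T%:R.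
    by rewrite ler_wpM2l // divr_ge0 // ltW.
  rewrite [_ * T%:R]mulrC; apply: le_trans.
  by rewrite le_eqVlt; apply/orP; left; apply/eqP; field; rewrite !gt_eqF //; clear - nn2; lra.
apply: le_trans (ler_wpM2r _ key) _ => //.
have -> : (w ^+ 2)^-1 = delta / n%:R ^+ 2 * (delta / n%:R ^+ 2).
  by rewrite /w expr2 invfM invf_div.
set v := delta / n%:R ^+ 2.
have v0 : 0 <= v by rewrite divr_ge0 // ltW.
have vn : v * n%:R ^+ 2 = delta by rewrite /v divfK ?gt_eqF.
have v1 : v <= 4^-1.
  rewrite ler_pdivrMr //; clear - nsq d1; lra.
have h1 : v * v * 'C(n, 2)%:R <= v * v * n%:R ^+ 2.
  by apply: ler_wpM2l; [exact: mulr_ge0|clear - NN N1; lra].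
have h2 : v * delta <= 4^-1 * delta by rewrite ler_wpM2r // ltW.
rewrite -[v * v * n%:R ^+ 2]mulrA vn in h1; apply: (le_trans h1); clear - h2; lra.
Qed.

(** Because [delta] is at least [e^{- c n}], the logarithm is at most of order [n^2] and the mixing
    time is polynomial, hence well within the confinement time. *)
Lemma mixing_time_le n (C c delta : R) : (0 < n)%N -> 0 < C -> 0 < c ->
  expR (- (c * n%:R)) <= delta -> delta <= 1 ->
  let T := `|Num.ceil (C * n%:R ^+ 2 * ln (n%:R ^+ 2 / delta))|%N in
  C * n%:R ^+ 2 * ln (n%:R ^+ 2 / delta) <= T%:R <= (C * (1 + c) + 1) * n%:R ^+ 4.
Proof.
move=> n0 C0 c0 dl d1; have d0 : 0 < delta by exact: lt_le_trans (expR_gt0 _) dl.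
have nn1 : 1 <= n%:R :> R by rewrite ler1n.
have nsq : 1 <= n%:R ^+ 2 :> R by exact: exprn_ege1.
have n20 : 0 < n%:R ^+ 2 :> R by apply: lt_le_trans nsq.
set y := ln _.
have y0 : 0 <= y.
  by rewrite ln_ge0 // ler_pdivlMr // mul1r (le_trans d1).
have yu : y <= (1 + c) * n%:R ^+ 2.
  rewrite /y lnM ?posrE ?invr_gt0 // lnV ?posrE //.
  have h1 : ln (n%:R ^+ 2) <= n%:R ^+ 2 :> R by apply: ltW; apply: ln_sublinear.
  have h2 : - (c * n%:R) <= ln delta by rewrite -[leLHS]expRK ler_ln ?posrE ?expR_gt0.
  have h3 : c * n%:R <= c * n%:R ^+ 2 by rewrite ler_wpM2l ?(ltW c0) // expr2 ler_peMr.
  clear - h1 h2 h3; lra.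
set z := C * n%:R ^+ 2 * y.
have z0 : 0 <= z by rewrite !mulr_ge0 // ltW.
have zT : `|Num.ceil z|%N%:R = (Num.ceil z)%:~R :> R.
  by rewrite natr_absz ger0_norm // ceil_ge0 (lt_le_trans _ z0) // oppr_lt0.
have /andP[c1 c2] := ceil_itv z.
rewrite /= zT c2 /=; apply: le_trans (_ : z + 1 <= _).
  by rewrite -lerBlDr; move: c1; rewrite intrD => /ltW.
rewrite mulrDl mul1r; apply: lerD; last exact: exprn_ege1.
have -> : C * (1 + c) * n%:R ^+ 4 = C * n%:R ^+ 2 * ((1 + c) * n%:R ^+ 2) by ring.
by rewrite ler_wpM2l // mulr_ge0 // ltW.
Qed.

End Confinement.

Theorem theorem2p1 (R : realType) (B : set (R * R)) (B_compact : compact B)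
    (B_sub : (B `<=` @R_Kaw R)%classic) :
  exists eps0 : R, 0 < eps0 /\
  forall eps : R, 0 < eps -> eps <= eps0 ->
  exists (alpha c C : R) (n0 : nat), [/\ 0 < alpha, 0 < c, 0 < C &
  forall (p beta : R), B (p, beta) ->
  forall (n k : nat), (n0 <= n)%N -> k%:R = 'C(n, 2)%:R * p ->
    mass (@mu R n k beta) (predC (Gamma p (eps / 4)))
      <= C * expR (- (c * n%:R)) /\
    forall x : Omega n k, Gamma p (eps / 4) x ->
      (forall T : nat, T%:R <= expR (alpha * n%:R) ->
         coupled_until (kawasaki beta) (kawasaki_res p beta eps) x T
           (1 - C * expR (- (c * n%:R)))) /\
      (forall delta : R, expR (- (c * n%:R)) <= delta -> delta <= 1 ->
         let T := `|Num.ceil (C * n%:R ^+ 2 * ln (n%:R ^+ 2 / delta))|%N in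
         dTV (step_law (kawasaki_res p beta eps) x T)
             (cond_mass (mu beta) (Gamma p eps)) <= delta /\
         dTV (step_law (kawasaki beta) x T) (mu beta) <= delta)].
Proof.
have [eta [e0 e1 HB]] := uniform_constants B_compact B_sub.
have eta2 : 0 < eta ^+ 2 by rewrite exprn_gt0.
(* With [e = eps / 2] this is precisely the requirement [16 e <= eta ^+ 2] of the drift regime. *)
exists (eta ^+ 2 / 8); split=> [|eps s0 sl]; first by rewrite divr_gt0.
have eta21 : eta ^+ 2 <= 1 by rewrite expr_le1 //; clear - e0 e1; lra.
(* Drift and contraction are used at width [e]: one swap from there stays within width [eps], and
   the prescribed starting width [eps / 4] is [e / 2]. *)
pose e := eps / 2; have es0 : 0 < e by rewrite divr_gt0.
pose a := exit_rate eta e.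
have a0 : 0 < a by rewrite /a /exit_rate /tilt !mulr_gt0 ?invr_gt0.
have a4 : 0 < a / 4 by rewrite divr_gt0.
have q0 : 0 < eps / 4 by rewrite divr_gt0.
have q1 : eps / 4 <= 1 by clear - sl eta21; lra.
have [c1 [n1 [c10 H1]]] := Gamma_concentration e0 e1 q0 q1.
have c2 : 0 < c1 / 2 by rewrite divr_gt0.
(* Strictly smaller than the rates [a / 2] and [c1] of the two error terms, so that each of them is
   at most an eighth of [e^{- c n}] for large [n]. *)
pose c := Order.min (a / 4) (c1 / 2).
have c0 : 0 < c by rewrite lt_min a4.
have ca : c <= a / 4 by rewrite ge_min lexx.
have cc : c <= c1 / 2 by rewrite ge_min lexx orbT.
(* The value required by [geometric_mixing]; being at least 1, it also serves as the prefactor of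
   the exponential bounds. *)
pose C := 2 / eta; have C0 : 0 < C by rewrite divr_gt0.
have C1 : 1 <= C by rewrite ler_pdivlMr //; clear - e1 e0; lra.
have [n2 H2] := poly_le_expR (2 * expR 1) 2 a4.
have [n3 H3] := poly_le_expR 8 0 a4.
have [n4 H4] := poly_le_expR 8 0 c2.
have [n5 H5] := poly_le_expR (C * (1 + c) + 1) 4 a4.
exists (a / 4), c, C, (maxn (maxn (maxn n1 n2) (maxn n3 n4))
  (maxn n5 (maxn 2 (Num.truncn (64 / (eta ^+ 2 * e))).+1))); split=> //.
move=> p beta /HB [[ep eq b0 be crit] sg] n k.
rewrite !geq_max -!andbA => /and5P[N1 N2 N3 N4 /and3P[N5 N6 N7]] kE.
have n_gt0 : (0 < n)%N by apply: ltnW.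
have large : 64 <= n%:R * eta ^+ 2 * e.
  rewrite -mulrA -ler_pdivrMr ?mulr_gt0 //.
  by apply: le_trans (ltW (truncnS_gt _)) _; rewrite ler_nat.
have regime : drift_regime n k p beta eta e.
  by split=> //; rewrite /e; clear - sl; lra.
have n_eps : 1 <= n%:R * eps.
  have : n%:R * e * eta ^+ 2 <= n%:R * e by rewrite ler_piMr // mulr_ge0 // ltW.
  rewrite /e in large *; clear - large; lra.
have en : e / 2 = eps / 4 by rewrite /e; field.
(* The failure probability grows linearly in [T]. Of the rate [a], a quarter pays for the time
   horizon and a quarter for the polynomial factor. *)
have fail (T : nat) : T%:R <= expR (a / 4 * n%:R) ->
    (1 + T%:R) * (expR 1 * n%:R ^+ 2 * expR (- (a * n%:R))) <= expR (- (a / 2 * n%:R)).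
  move=> hT; have h1 : 1 + T%:R <= 2 * expR (a / 4 * n%:R).
    have : 1 <= expR (a / 4 * n%:R) by rewrite -[leLHS]expR0 ler_expR mulr_ge0 ?(ltW a4).
    clear - hT; lra.
  have -> : expR (- (a / 2 * n%:R)) =
    expR (a / 4 * n%:R) * (expR (a / 4 * n%:R) * expR (- (a * n%:R))).
    by rewrite -!expRD; congr expR; field.
  have -> : (1 + T%:R) * (expR 1 * n%:R ^+ 2 * expR (- (a * n%:R))) =
    (1 + T%:R) / 2 * ((2 * expR 1 * n%:R ^+ 2) * expR (- (a * n%:R))) by field.
  apply: ler_pM; rewrite ?mulr_ge0 ?expR_ge0 ?exprn_ge0 ?invr_ge0 ?addr_ge0 //.
    by rewrite ler_pdivrMr // mulrC.
  by rewrite ler_wpM2r ?expR_ge0 ?H2.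
have small_a : 8 * expR (- (a / 2 * n%:R)) <= expR (- (c * n%:R)).
  have -> : - (a / 2 * n%:R) = - (a / 4 * n%:R) - a / 4 * n%:R by field.
  rewrite expRD mulrCA; apply: le_trans (_ : expR (- (a / 4 * n%:R)) * 1 <= _).
    rewrite ler_wpM2l ?expR_ge0 // expRN ler_pdivrMr ?expR_gt0 // mul1r.
    by have := H3 n N3; rewrite expr0 mulr1.
  by rewrite mulr1 ler_expR lerN2 ler_wpM2r.
have small_c : 8 * expR (- (c1 * n%:R)) <= expR (- (c * n%:R)).
  have -> : - (c1 * n%:R) = - (c1 / 2 * n%:R) - c1 / 2 * n%:R by field.
  rewrite expRD mulrCA; apply: le_trans (_ : expR (- (c1 / 2 * n%:R)) * 1 <= _).
    rewrite ler_wpM2l ?expR_ge0 // expRN ler_pdivrMr ?expR_gt0 // mul1r.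
    by have := H4 n N4; rewrite expr0 mulr1.
  by rewrite mulr1 ler_expR lerN2 ler_wpM2r.
have conc : mass (@mu R n k beta) (predC (Gamma p (eps / 4))) <= expR (- (c1 * n%:R)).
  exact: H1.
have Ec : expR (- (c * n%:R)) <= C * expR (- (c * n%:R)) by rewrite ler_peMl ?expR_ge0.
have Ea := expR_ge0 (- (a / 2 * n%:R)); have Ec1 := expR_ge0 (- (c1 * n%:R)).
split; first by apply: le_trans conc (le_trans _ Ec); clear - small_c Ec1; lra.
move=> x Gx; have Gxe : Gamma p (e / 2) x by rewrite en.
have sK := @stochastic_kawasaki R n k beta (k_pos regime) (k_small regime).
have sQ := @stochastic_kawasaki_res R n k p beta eps (k_pos regime) (k_small regime).
have KQ z : Gamma p e z -> @kawasaki R n k beta z =1 kawasaki_res p beta eps z.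
  move=> Gz; apply: kawasaki_res_interior => [|q sq]; last exact: Gamma_swap n_gt0 n_eps Gz sq.
  by apply: Gamma_le n_gt0 _ Gz; rewrite /e; clear - s0; lra.
have surv (T : nat) : T%:R <= expR (a / 4 * n%:R) ->
    1 - expR (- (a / 2 * n%:R)) <= survival (kawasaki beta) (Gamma p e) T x.
  move=> hT; apply: le_trans (kawasaki_survival regime T e1 Gxe).
  by rewrite lerD2l lerN2 fail.
split=> [T hT|delta dl d1 T].
  apply: (survival_coupled_until sK sQ KQ); apply: le_trans (surv T hT).
  by rewrite lerD2l lerN2; apply: le_trans Ec; clear - small_a Ea; lra.
have d0 : 0 < delta by exact: lt_le_trans (expR_gt0 _) dl.
have /andP[T1 T2] := mixing_time_le n_gt0 C0 c0 dl d1; rewrite -/T in T1 T2.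
have hT : T%:R <= expR (a / 4 * n%:R) by exact: le_trans T2 (H5 n N5).
have muD := mu_distribution beta x.
(* Contraction from any two starting points in [Gamma p (eps / 4)] is averaged over a stationary
   starting point; the static bound pays for those outside. *)
have full : dTV (step_law (kawasaki beta) x T) (mu beta) <=
    delta / 4 + 2 * expR (- (a / 2 * n%:R)) + expR (- (c1 * n%:R)).
  apply: le_trans (lerD (lexx _) conc); apply: dTV_stationary => //.
  - exact: mu_stationary (k_pos regime) (k_small regime).
  - by rewrite addr_ge0 ?mulr_ge0 ?invr_ge0 // ltW.
  move=> y Gy; have Gye : Gamma p (e / 2) y by rewrite en.
  apply: le_trans (kawasaki_contraction regime T e1 Gxe Gye) _.
  by apply: lerD; [exact: geometric_mixing T1|rewrite ler_wpM2l // fail].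
split; last by apply: le_trans full _; clear - small_a small_c dl Ea Ec1; lra.
apply: le_trans (dTV_triangle _ (step_law (kawasaki beta) x T) _) _.
apply: le_trans (lerD (lexx _) (dTV_triangle _ (mu beta) _)) _.
have Gxl : Gamma p eps x by apply: Gamma_le n_gt0 _ Gx; clear - s0; lra.
have massG : 0 < mass (@mu R n k beta) (Gamma p eps).
  rewrite /mass (bigD1 x) //= ltr_pwDl ?mu_gt0 //.
  by apply: sumr_ge0 => y _; exact/ltW/mu_gt0.
have rest : dTV (@mu R n k beta) (cond_mass (mu beta) (Gamma p eps)) <= expR (- (c1 * n%:R)).
  rewrite (dTV_cond_mass muD massG); apply: le_trans conc.
  rewrite /mass [leLHS]big_mkcond [leRHS]big_mkcond; apply: ler_sum => y _.
  have m0 : 0 <= mu beta y by exact/ltW/mu_gt0.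
  case: ifP => [/negP nG|_]; last by case: ifP.
  rewrite ifT //; apply/negP => Gy; apply: nG.
  by apply: Gamma_le n_gt0 _ Gy; clear - s0; lra.
have restr : dTV (step_law (kawasaki_res p beta eps) x T) (step_law (kawasaki beta) x T) <=
    expR (- (a / 2 * n%:R)).
  rewrite dTVC; apply: le_trans (dTV_survival x T sK sQ KQ) _.
  have := surv T hT; clear; lra.
(* The total is [delta / 4] plus five exponential terms, counted with multiplicity, of at most
   [delta / 8] each. *)
apply: le_trans (lerD restr (lerD full rest)) _.
clear - small_a small_c dl Ea Ec1; lra.
Qed.
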